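(* Let $\{\!\{-,-\}\!\}\colon A\otimes A\to A\otimes A$ be a double Poisson bracket on an algebra $A$, and let $\{-,-\}$ be the bracket on the commutative algebra underlying $\mathcal F(A)$ in the symmetric monoidal category of diagonal $\mathbb S$-bimodules which is determined on generators by $$\{a,b\}_{1,1}=\{\!\{a,b\}\!\}\cdot(1\ 2),\quad\{\pi(a),b\}_{0,1}=\{a,b\}_A=-\{b,\pi(a)\}_{1,0},\quad\{\pi(a),\pi(b)\}_{0,0}=\pi(\{a,b\}_A)$$ for $a,b\in A$, where $\{a,b\}_A$ is the image of $\{\!\{a,b\}\!\}$ under the multiplication of $A$. Then $\{-,-\}$ is a morphism of generalized wheelspaces (i.e. it is compatible with contractions) and gives $\mathcal F(A)$ the structure of a Poisson wheelgebra.
   Context: Conventions. $k$ is a field of characteristic $0$; vector spaces, algebras and $\otimes$ are over $k$; algebras are associative. $\mathbb N_0=\{0,1,2,\dots\}$, $\mathbb N=\{1,2,\dots\}$. $\mathbb S_n$ is the group of permutations of $\{1,\dots,n\}$ (product = composition of maps). For $\sigma\in\mathbb S_n,\tau\in\mathbb S_m$, $\sigma\oplus\tau\in\mathbb S_{n+m}$ is the block sum, giving $\mathbb S_n\times\mathbb S_m\subseteq\mathbb S_{n+m}$. For $\tau\in\mathbb S_r$ the block permutation $b_{m_1,\dots,m_r}(\tau)\in\mathbb S_{m_1+\dots+m_r}$ is $s+\sum_{i<j}m_i\mapsto s+\sum_{i<\tau(j)}m_{\tau^{-1}(i)}$ for $1\le s\le m_j$; $\beta_{n,m}=b_{n,m}((1\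 2))$. $(i\ \dots\ j)$ denotes the cycle $i\mapsto i+1\mapsto\dots\mapsto j\mapsto i$. A diagonal $\mathbb S$-bimodule is a sequence $S=(S(n))_{n\in\mathbb N_0}$ of $k\mathbb S_n$-bimodules; morphisms are sequences of bimodule maps. Double Poisson brackets. A double bracket on $A$ is a linear map $\{\!\{-,-\}\!\}\colon A\otimes A\to A\otimes A$ with $\{\!\{b,a\}\!\}=-\tau\{\!\{a,b\}\!\}$ ($\tau$ the flip) and $\{\!\{a,bc\}\!\}=\{\!\{a,b\}\!\}c+b\{\!\{a,c\}\!\}$ for the outer bimodule structure $x(y\otimes z)w=xy\otimes zw$. It is Poisson if $\sum_{\sigma\in C_3}\tau_\sigma\circ L\circ\tau_{\sigma^{-1}}=0$, where $L=(\{\!\{-,-\}\!\}\otimes\mathrm{id})\circ(\mathrm{id}\otimes\{\!\{-,-\}\!\})$, $C_3\subset\mathbb S_3$ is the cyclic subgroup and $\tau_\sigma$ is the permutation of tensor factors $\tau_\sigma(a_1\otimes a_2\otimes a_3)=a_{\sigma^{-1}(1)}\otimes a_{\sigma^{-1}(2)}\otimes a_{\sigma^{-1}(3)}$. Then $\{-,-\}_A$ induces well-defined maps $A_{\mathrm{cyc}}\otimes A\to A$ and $A_{\mathrm{cyc}}\otimes A_{\mathrm{cyc}}\to A_{\mathrm{cyc}}$. Wheelspaces. For $\sigma\in\mathbb S_n$ and $1\le i\le n$, $r^n_i(\sigma)\in\mathbb S_{n-1}$ is obtained from $\sigma$ by deleting $i$ from the source and $\sigma(i)$ from the target and renumbering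 in the order-preserving way; $l^n_j(\sigma)=(r^n_j(\sigma^{-1}))^{-1}$. A wheelspace is a diagonal $\mathbb S$-bimodule $S$ with linear maps (contractions) ${}^n_jt_i\colon S(n)\to S(n-1)$, $n\in\mathbb N$, $1\le i,j\le n$, such that (W1) ${}^n_jt_i(\sigma v\tau)=l^n_j(\sigma)\cdot{}^{\ \ \ \ n}_{\sigma^{-1}(j)}t_{\tau(i)}(v)\cdot r^n_i(\tau)$ for $\sigma,\tau\in\mathbb S_n$; (W2) ${}^n_jt_i\circ{}^{n+1}_{\ \ \ell}t_k={}^n_{j'}t_{i'}\circ{}^{n+1}_{\ \ \ell'}t_{k'}$, where $(i',k')=(k-1,i)$ if $i<k$ and $(k,i+1)$ if $k\le i$, and $(j',\ell')$ is obtained from $(j,\ell)$ by the same rule. For a wheelspace $S$, a morphism of generalized wheelspaces $S\otimes S\to S$ is equivalently a family of $k(\mathbb S_n\times\mathbb S_m)$-bimodule maps $f_{n,m}\colon S(n)\otimes S(m)\to S(n+m)$ compatible with contractions: ${}^{n+m}_{\ \ \ j}t_i\circ f_{n,m}=f_{n-1,m}\circ({}^n_jt_i\otimes\mathrm{id})$ if $i,j\le n$ and $=f_{n,m-1}\circ(\mathrm{id}\otimes{}^{\ \ m}_{j-n}t_{i-n})$ if $i,j>n$. A commutative wheelgebra is a wheelspace $S$ with such a family $\mu_{n,m}$ (written $vw$) that is associative, has a unit $1\in S(0)$, and satisfies $vw=\beta_{m,n}\cdot(wv)\cdot\beta_{n,m}$ for $v\in S(n),w\in S(m)$. A bracket on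 the underlying algebra in diagonal $\mathbb S$-bimodules is a family of $k(\mathbb S_n\times\mathbb S_m)$-bimodule maps $\{-,-\}_{n,m}\colon S(n)\otimes S(m)\to S(n+m)$ such that, for $u\in S(p),v\in S(n),w\in S(m)$, $\{v,w\}=-\beta_{m,n}\cdot\{w,v\}\cdot\beta_{n,m}$ and $\{u,vw\}=\{u,v\}w+b_{n,p,m}((1\ 2))\cdot(v\{u,w\})\cdot b_{p,n,m}((1\ 2))$. A Poisson wheelgebra is a commutative wheelgebra with a bracket that is compatible with contractions and satisfies the Jacobi identity $0=\{u,\{v,w\}\}+b_{n,m,p}((1\ 2\ 3))\cdot\{v,\{w,u\}\}\cdot b_{p,n,m}((1\ 3\ 2))+b_{m,p,n}((1\ 3\ 2))\cdot\{w,\{u,v\}\}\cdot b_{p,n,m}((1\ 2\ 3))$. Fock wheelgebra. Let $A_{\mathrm{cyc}}=A/[A,A]$ ($[A,A]$ the linear span of commutators) with projection $\pi$. $\mathcal F(A)$ is the commutative wheelgebra with $\mathcal F(A)(n)=U_n\otimes\mathrm{Sym}(A_{\mathrm{cyc}})$, where $U_n=A^{\otimes n}\otimes_{k\mathbb S_n}(k\mathbb S_n\otimes(k\mathbb S_n)^{\mathrm{op}})$ (along $\sigma\mapsto\sigma\otimes\sigma^{-1}$) is the $k\mathbb S_n$-bimodule generated by the vector space $A^{\otimes n}$ (elements written $(a_1|\dots|a_n)$) subject to $\sigma^{-1}\cdot(a_1|\dots|a_n)\cdot\sigma=(a_{\sigma(1)}|\dots|a_{\sigma(n)})$; product $(\tau\cdot\underline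 a\cdot\sigma\otimes\omega)(\tau'\cdot\underline a'\cdot\sigma'\otimes\omega')=(\tau\oplus\tau')\cdot(\underline a|\underline a')\cdot(\sigma\oplus\sigma')\otimes\omega\omega'$; unit $1\in\mathrm{Sym}(A_{\mathrm{cyc}})$; and contractions determined by (W1) and by the values of ${}^n_jt_i$ on $(a_1|\dots|a_n)\otimes\omega$: for $i<j$, $(a_1|\dots|a_{i-1}|a_ia_j|a_{i+1}|\dots|\widehat{a_j}|\dots|a_n)\cdot(i\ \dots\ j-1)\otimes\omega$; for $i=j$, $(a_1|\dots|\widehat{a_i}|\dots|a_n)\otimes\pi(a_i)\omega$; for $i>j$, $(a_1|\dots|\widehat{a_j}|\dots|a_{i-1}|a_ia_j|a_{i+1}|\dots|a_n)\cdot(j\ \dots\ i-1)^{-1}\otimes\omega$ (hat = omitted). As a commutative algebra in diagonal $\mathbb S$-bimodules, $\mathcal F(A)$ is the symmetric algebra on $A$ (placed in weight $1$) and $A_{\mathrm{cyc}}$ (placed in weight $0$), so a bracket on it is uniquely determined by, and can be prescribed by, antisymmetric values on these generators; $\{\!\{a,b\}\!\}\in A^{\otimes2}$ is viewed in $\mathcal F(A)(2)$.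
   Formalization: The value on generators is taken as {a,b}_{1,1} = (1 2)·{{a,b}} instead of {{a,b}}·(1 2); with the stated contraction conventions the printed formula is not compatible with contractions (e.g. k<x,y>, {{x,y}}=1⊗1, on x and yyx). *)

(* Defs.v *)
From HB Require Import structures.
From mathcomp Require Import all_boot all_order all_algebra all_fingroup.
From mathcomp Require Import zify.
From mathcomp Require Import boolp freeg.
(* imported again because of repr and lift, shadowed by fingroup and freeg *)
From mathcomp Require Import generic_quotient fintype.

Set Implicit Arguments.
Unset Strict Implicit.
Unset Printing Implicit Defensive.

Import GRing.Theory.

Local Open Scope ring_scope.
Local Open Scope quotient_scope.

Section Quotient.
Variables (k : fieldType) (V : lmodType k) (R : V -> Prop).

Inductive in_span : V -> Prop :=
| in_span0 : in_span 0
| in_spanD c r v : R r -> in_span v -> in_span (c *: r + v).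

Lemma in_span_add u v : in_span u -> in_span v -> in_span (u + v).
Proof.
move=> hu hv; elim: hu => [|c r w hr _ ih]; first by rewrite add0r.
by rewrite -addrA; exact: in_spanD.
Qed.

Lemma in_span_scale c u : in_span u -> in_span (c *: u).
Proof.
elim=> [|d r w hr _ ih]; first by rewrite scaler0; exact: in_span0.
by rewrite scalerDr scalerA; exact: in_spanD.
Qed.

Lemma in_span_gen r : R r -> in_span r.
Proof. by move=> hr; rewrite -[r]addr0 -[r]scale1r; exact/in_spanD/in_span0. Qed.

Definition span_equiv : rel V := fun u v => `[< in_span (u - v) >].

Lemma span_equiv_class : equiv_class_of span_equiv.
Proof.
split=> [u|u v|v u w]; rewrite /span_equiv.
- by rewrite subrr; apply/asboolP; exact: in_span0.
- by apply/asboolP/asboolP => /(in_span_scale (-1)); rewrite scaleN1r opprB.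
- move=> /asboolP huv /asboolP hvw; apply/asboolP.
  by have := in_span_add huv hvw; rewrite addrA subrK.
Qed.

Canonical span_equivRel := EquivRelPack span_equiv_class.

Definition quot_sort := {eq_quot span_equivRel}.
HB.instance Definition _ := Choice.on quot_sort.
HB.instance Definition _ := EqQuotient.on quot_sort.

Let pi (v : V) : quot_sort := \pi_quot_sort v.

Let pi_eq u v : in_span (u - v) -> pi u = pi v.
Proof. by move=> h; apply/eqP; rewrite piE; exact/asboolP. Qed.

Let repr_pi v : in_span (repr (pi v) - v).
Proof.
have /eqP : pi (repr (pi v)) = pi v by exact: reprK.
by rewrite piE => /asboolP.
Qed.

Let qadd (x y : quot_sort) := pi (repr x + repr y).
Let qopp (x : quot_sort) := pi (- repr x).
Let qscale c (x : quot_sort) := pi (c *: repr x).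

Let qaddE u v : qadd (pi u) (pi v) = pi (u + v).
Proof.
by apply: pi_eq; rewrite opprD addrACA; apply: in_span_add; exact: repr_pi.
Qed.
Let qoppE u : qopp (pi u) = pi (- u).
Proof.
apply: pi_eq; rewrite -opprD -[X in in_span X]scaleN1r.
by apply: in_span_scale; exact: repr_pi.
Qed.
Let qscaleE c u : qscale c (pi u) = pi (c *: u).
Proof.
by apply: pi_eq; rewrite -scalerBr; apply: in_span_scale; exact: repr_pi.
Qed.

Let qW (P : quot_sort -> Prop) : (forall v, P (pi v)) -> forall x, P x.
Proof. by move=> h x; rewrite -[x]reprK; exact: h. Qed.

Let qaddA : associative qadd.
Proof.
elim/qW=> x; elim/qW=> y; elim/qW=> z.
by rewrite !qaddE addrA.
Qed.
Let qaddC : commutative qadd.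
Proof. by elim/qW=> x; elim/qW=> y; rewrite !qaddE addrC. Qed.
Let qadd0 : left_id (pi 0) qadd.
Proof. by elim/qW=> x; rewrite !qaddE add0r. Qed.
Let qaddN : left_inverse (pi 0) qopp qadd.
Proof. by elim/qW=> x; rewrite qoppE qaddE addNr. Qed.

HB.instance Definition _ :=
  GRing.isZmodule.Build quot_sort qaddA qaddC qadd0 qaddN.

Let qscaleA a b x : qscale a (qscale b x) = qscale (a * b) x.
Proof. by elim/qW: x => x; rewrite !qscaleE scalerA. Qed.
Let qscale1 : left_id 1 qscale.
Proof. by elim/qW=> x; rewrite qscaleE scale1r. Qed.
Let qscaleDr : right_distributive qscale +%R.
Proof.
move=> c; elim/qW=> x; elim/qW=> y.
by rewrite -[_ + _]/(qadd _ _) qaddE !qscaleE -[RHS]/(qadd _ _) qaddE scalerDr.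
Qed.
Let qscaleDl x : {morph qscale^~ x : a b / a + b}.
Proof.
elim/qW: x => x a b.
by rewrite !qscaleE -[RHS]/(qadd _ _) qaddE scalerDl.
Qed.

HB.instance Definition _ := GRing.Zmodule_isLmodule.Build k quot_sort
  qscaleA qscale1 qscaleDr qscaleDl.

Definition quotmod : lmodType k := quot_sort.
Definition qproj (v : V) : quotmod := pi v.

Lemma qproj_linear : linear qproj.
Proof.
by move=> c u v; rewrite -[RHS]/(qadd (qscale _ _) _) /qproj qscaleE qaddE.
Qed.

(* f evaluated at a representative: the induced map when f is linear and     *)
(* kills R (qlift_linear, qliftE).                                           *)
Definition qlift (M : Type) (f : V -> M) (x : quotmod) : M :=
  f (repr (x : quot_sort)).

Section Lift.
Variables (M : lmodType k) (f : {linear V -> M}).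
Hypothesis fR : forall r, R r -> f r = 0.

Lemma qliftE v : qlift f (qproj v) = f v.
Proof.
apply/eqP; rewrite -subr_eq0 -linearB; apply/eqP.
elim: (repr_pi v) => [|c r w hr _ ih]; first exact: linear0.
by rewrite linearP ih addr0 fR // scaler0.
Qed.

Lemma qlift_linear : linear (qlift f).
Proof.
move=> c; elim/qW=> u; elim/qW=> v.
by rewrite -/(qproj u) -/(qproj v) -qproj_linear !qliftE linearP.
Qed.

End Lift.
End Quotient.

Section Presentation.
Variables (k : fieldType) (X : choiceType).

Definition fgen (x : X) : {freeg X / k} := << x >>.

Definition presented (R : {freeg X / k} -> Prop) : lmodType k := quotmod R.
Definition pgen (R : {freeg X / k} -> Prop) (x : X) : presented R :=
  qproj R (fgen x).

Section Lift.
Variables (M : lmodType k) (R : {freeg X / k} -> Prop) (f : X -> M).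

Lemma fglift_linear : linear (fglift f : {freeg X / k} -> M).
Proof.
have fD u v : fglift f (u + v : {freeg X / k}) = fglift f u + fglift f v.
  have sub := lift_is_additive f.
  have f0 : fglift f (0 : {freeg X / k}) = 0 by have := sub 0 0; rewrite !subrr.
  have fN w : fglift f (- w : {freeg X / k}) = - fglift f w.
    by have := sub 0 w; rewrite f0 !sub0r.
  by rewrite -{1}[v]opprK sub fN opprK.
have f0 : fglift f (0 : {freeg X / k}) = 0.
  by apply: (addrI (fglift f 0)); rewrite -fD !addr0.
move=> c u v; rewrite fD; congr (_ + _).
have -> : c *: u = \sum_(x <- dom u) << c * coeff x u *g x >> by [].
rewrite -[u in RHS]freeg_sumE !(big_morph (fglift f) fD f0) scaler_sumr.
by apply: eq_bigr => x _; rewrite !liftU scalerA.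
Qed.

HB.instance Definition _ :=
  GRing.isLinear.Build k {freeg X / k} M _ (fglift f) fglift_linear.

Lemma fglift_gen x : fglift f (fgen x) = f x.
Proof. by rewrite liftU scale1r. Qed.

(* Total; the linear map with values f on generators when f respects the     *)
(* relations (plift_linear, plift_gen).                                      *)
Definition plift : presented R -> M := qlift (fglift f).

Hypothesis fR : forall r, R r -> fglift f r = 0.

Lemma plift_linear : linear plift.
Proof. exact: qlift_linear fR. Qed.

Lemma plift_gen x : plift (pgen R x) = f x.
Proof. by rewrite /plift /pgen (qliftE fR); exact: fglift_gen. Qed.
End Lift.
End Presentation.

Definition bilinear_map (k : fieldType) (U V W : lmodType k)
    (f : U -> V -> W) : Prop :=
  (forall v, linear (f ^~ v)) /\ (forall u, linear (f u)).

(* Composition of maps: the product of 'S_n in MathComp is the opposite one. *)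
Definition pcomp n (s t : 'S_n) : 'S_n := (t * s)%g.
Notation "s \oS t" := (pcomp s t) (at level 40, left associativity).

(* f as a permutation, the identity if f is not one *)
Definition as_perm (T : finType) (f : T -> T) : {perm T} :=
  insubd (1%g : {perm T}) [ffun x => f x].

Lemma as_permE (T : finType) (f : T -> T) : injective f -> as_perm f =1 f.
Proof.
move=> f_inj x; rewrite /as_perm -pvalE /insubd insubT /=.
  by apply/injectiveP => y z; rewrite !ffunE; exact: f_inj.
by move=> ?; rewrite ffunE.
Qed.

(* The cycle i |-> i+1 |-> ... |-> j |-> i on 'I_n; indices start at 0, so   *)
(* that (1 2) is cyc 2 0 1 and (1 2 3) is cyc 3 0 2.                         *)
Definition cyc n (i j : nat) : 'S_n :=
  as_perm (fun x : 'I_n =>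
    insubd x (if i <= x < j then x.+1 else if x == j :> nat then i else x)%N).

Lemma cycE n i j (x : 'I_n) : (i <= j < n)%N ->
  cyc n i j x = (if i <= x < j then x.+1 else if x == j :> nat then i else x)%N
  :> nat.
Proof.
move=> hij; have hv (y : 'I_n) :
    ((if i <= y < j then y.+1 else if y == j :> nat then i else y) < n)%N.
  by have := ltn_ord y; do ?case: ifP => //; lia.
have E (y : 'I_n) := insubdK y (hv y).
rewrite as_permE ?E // => y z /(congr1 val).
rewrite /= !E => h; apply: val_inj => /=; move: h.
by do ?case: ifP => //; lia.
Qed.

Definition psum n m (s : 'S_n) (t : 'S_m) : 'S_(n + m) :=
  as_perm (fun x => match split x with
                    | inl i => lshift m (s i)
                    | inr j => rshift n (t j)
                    end).

Lemma psum_inj n m (s : 'S_n) (t : 'S_m) : injective (fun x : 'I_(n + m) =>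
  match split x with inl i => lshift m (s i) | inr j => rshift n (t j) end).
Proof.
pose g (u : 'I_n + 'I_m) :=
  match u with inl i => inl (s i) | inr j => inr (t j) end.
have g_inj : injective g.
  by move=> [i|j] [i'|j'] //= [] /perm_inj ->.
suff -> : (fun x : 'I_(n + m) =>
    match split x with inl i => lshift m (s i) | inr j => rshift n (t j) end) =
    (fun x => unsplit (g (split x))).
  exact: inj_comp (can_inj (@unsplitK n m))
           (inj_comp g_inj (can_inj (@splitK n m))).
by apply/funext => x; case: (split x).
Qed.

Lemma psum_lshift n m (s : 'S_n) (t : 'S_m) i :
  psum s t (lshift m i) = lshift m (s i).
Proof.
by rewrite (as_permE (@psum_inj n m s t)) (unsplitK (inl i : 'I_n + 'I_m)).
Qed.

Lemma psum_rshift n m (s : 'S_n) (t : 'S_m) j :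
  psum s t (rshift n j) = rshift n (t j).
Proof.
by rewrite (as_permE (@psum_inj n m s t)) (unsplitK (inr j : 'I_n + 'I_m)).
Qed.

(* The block permutation b_{m_1,...,m_r}(tau), as a permutation of 'I_N where *)
(* N is m_1 + ... + m_r up to a propositional equality of naturals.           *)
Definition block_fun r (m : r.-tuple nat) (tau : 'S_r) (x : nat) : nat :=
  let off j := (\sum_(i < r | (i < j)%N) tnth m i)%N in
  let off' j := (\sum_(i < r | (i < j)%N) tnth m (tau^-1%g i))%N in
  if [pick j : 'I_r | (off j <= x < off j + tnth m j)%N] is Some j
  then (x - off j + off' (tau j))%N else x.

Definition blk N r (m : r.-tuple nat) (tau : 'S_r) : 'S_N :=
  as_perm (fun x : 'I_N => insubd x (block_fun m tau x)).

Section Offset.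
Variables (r : nat) (f : 'I_r -> nat).
Let off (j : nat) := (\sum_(i < r | (i < j)%N) f i)%N.

Lemma offS (j : 'I_r) : off j.+1 = (off j + f j)%N.
Proof.
rewrite /off (bigD1 j) //= addnC; congr (_ + _)%N; apply: eq_bigl => i.
by rewrite ltnS ltn_neqAle andbC.
Qed.

Lemma off_mono j j' : (j <= j')%N -> (off j <= off j')%N.
Proof.
move=> h; rewrite /off [leqRHS](bigID (fun i : 'I_r => (i < j)%N)) /=.
apply: leq_trans (leq_addr _ _); rewrite leq_eqVlt; apply/orP; left.
apply/eqP; apply: eq_bigl => i.
by case: ltnP => h'; rewrite ?andbF // andbT (leq_trans h' h).
Qed.

Lemma off_uniq (i j : 'I_r) x : (off i <= x < off i + f i)%N ->
  (off j <= x < off j + f j)%N -> i = j.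
Proof.
rewrite -!offS => /andP[hi1 hi2] /andP[hj1 hj2]; apply/val_inj => /=.
case: (ltngtP i j) => // /off_mono h; exfalso.
  by have := leq_trans hi2 (leq_trans h hj1); rewrite ltnn.
by have := leq_trans hj2 (leq_trans h hi1); rewrite ltnn.
Qed.

Lemma off_total : off r = (\sum_i f i)%N.
Proof. by apply: eq_bigl => i; rewrite ltn_ord. Qed.

Lemma off_cover x : (x < \sum_i f i)%N ->
  exists i : 'I_r, (off i <= x < off i + f i)%N.
Proof.
rewrite -off_total => hx.
have ex : exists j, (x < off j)%N by exists r.
case: (ex_minnP ex) => -[|j] hj min; first by rewrite /off big1 in hj.
have hjr : (j < r)%N by exact: min.
exists (Ordinal hjr); rewrite -offS /= hj andbT leqNgt.
by apply/negP => /min; rewrite ltnn.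
Qed.
End Offset.

Lemma block_funE r (m : r.-tuple nat) (tau : 'S_r) (j : 'I_r) s :
  (s < tnth m j)%N ->
  block_fun m tau (s + \sum_(i < r | (i < j)%N) tnth m i) =
  (s + \sum_(i < r | (i < tau j)%N) tnth m (tau^-1%g i))%N.
Proof.
move=> hs; rewrite /block_fun.
set x := (s + _)%N.
have hx : (\sum_(i < r | (i < j)%N) tnth m i <= x <
          \sum_(i < r | (i < j)%N) tnth m i + tnth m j)%N.
  by rewrite /x leq_addl /= [X in (_ < X)%N]addnC ltn_add2r.
case: pickP => [i hi|/(_ j)]; last by rewrite hx.
by rewrite (off_uniq (f := tnth m) hi hx) /x addnK.
Qed.

Lemma blkE N r (m : r.-tuple nat) (tau : 'S_r) : sumn m = N ->
  forall x : 'I_N, blk N m tau x = block_fun m tau x :> nat.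
Proof.
move=> hN.
have sumE : (\sum_i tnth m i = N)%N.
  by rewrite -hN sumnE big_tuple.
have sumE' : (\sum_i tnth m (tau^-1%g i) = N)%N.
  by rewrite -sumE; apply: esym; rewrite (reindex_inj (@perm_inj _ tau^-1%g)).
have dec (x : 'I_N) : exists (j : 'I_r) (s : nat), [/\ (s < tnth m j)%N,
    x = (s + \sum_(i < r | (i < j)%N) tnth m i)%N :> nat &
    block_fun m tau x =
    (s + \sum_(i < r | (i < tau j)%N) tnth m (tau^-1%g i))%N].
  have /off_cover[j /andP[h1 h2]] : (x < \sum_i tnth m i)%N by rewrite sumE.
  exists j, (x - \sum_(i < r | (i < j)%N) tnth m i)%N.
  have hs : (x - \sum_(i < r | (i < j)%N) tnth m i < tnth m j)%N.
    by rewrite ltn_subLR.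
  by rewrite -(block_funE tau hs) subnK.
have hlt (x : 'I_N) : (block_fun m tau x < N)%N.
  have [j [s [hs _ ->]]] := dec x.
  rewrite -[X in (_ < X)%N]sumE' -(off_total (fun i => tnth m (tau^-1%g i))).
  apply: leq_trans (off_mono (fun i => tnth m (tau^-1%g i)) (ltn_ord (tau j))).
  by rewrite offS permK [X in (_ < X)%N]addnC ltn_add2r.
have E (x : 'I_N) := insubdK x (hlt x).
move=> x; rewrite as_permE ?E // => y z /(congr1 val).
rewrite /= !E.
have [j [s [hs hy ->]]] := dec y; have [j' [s' [hs' hz ->]]] := dec z => e.
have ejj : j = j'.
  apply: (@perm_inj _ tau); apply: (off_uniq (f := fun i => tnth m (tau^-1%g i))
    (x := (s + \sum_(i < r | (i < tau j)%N) tnth m (tau^-1%g i))%N)).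
    by rewrite permK leq_addl /= [X in (_ < X)%N]addnC ltn_add2r.
  by rewrite e permK leq_addl /= [X in (_ < X)%N]addnC ltn_add2r.
apply: val_inj => /=; rewrite hy hz; rewrite ejj in e *.
by move/addIn: e => ->.
Qed.

(* rdel i s is r_i^n(s) and ldel j s is l_j^n(s), for s : 'S_n with n = n'+1 *)
Definition rdel n (i : 'I_n.+1) (s : 'S_n.+1) : 'S_n :=
  as_perm (fun x : 'I_n => odflt x (unlift (s i) (s (lift i x)))).
Definition ldel n (j : 'I_n.+1) (s : 'S_n.+1) : 'S_n :=
  ((rdel j s^-1)^-1)%g.

Lemma rdelE n (i : 'I_n.+1) (s : 'S_n.+1) :
  lift_perm i (s i) (rdel i s) = s.
Proof.
apply/permP => x; case: (unliftP i x) => [y ->|->]; last by rewrite lift_perm_id.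
have hl (z : 'I_n) : lift (s i) (odflt z (unlift (s i) (s (lift i z)))) = s (lift i z).
  case: unliftP => //= h; have := neq_lift i z.
  by rewrite -(inj_eq (@perm_inj _ s)) h eqxx.
rewrite lift_perm_lift as_permE ?hl // => z z' /(congr1 (lift (s i))).
by rewrite !hl => /perm_inj /lift_inj.
Qed.

(* wt n j i is the contraction with left index j and right index i. *)
Record wheel_data (k : fieldType) := WheelData {
  wcar :> nat -> lmodType k;
  wl : forall n, 'S_n -> wcar n -> wcar n;
  wr : forall n, wcar n -> 'S_n -> wcar n;
  wt : forall n, 'I_n.+1 -> 'I_n.+1 -> wcar n.+1 -> wcar n
}.

Definition wcast (k : fieldType) (S : wheel_data k) m n (e : m = n) (x : S m) :
  S n := eq_rect m (fun i => S i : Type) x n e.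

Record is_sbimodule (k : fieldType) (S : wheel_data k) : Prop := {
  wl_linear : forall n (s : 'S_n), linear (@wl k S n s);
  wr_linear : forall n (s : 'S_n), linear ((@wr k S n) ^~ s);
  wl1 : forall n (v : S n), wl 1%g v = v;
  wr1 : forall n (v : S n), wr v 1%g = v;
  wlM : forall n (s t : 'S_n) (v : S n), wl (s \oS t) v = wl s (wl t v);
  wrM : forall n (s t : 'S_n) (v : S n), wr v (s \oS t) = wr (wr v s) t;
  wlr : forall n (s t : 'S_n) (v : S n), wl s (wr v t) = wr (wl s v) t
}.

(* (i, k) |-> (i', k') in the axiom (W2) *)
Definition swap_idx n (i : 'I_n.+1) (l : 'I_n.+2) : 'I_n.+1 * 'I_n.+2 :=
  if (i < l)%N then (inord l.-1, inord i) else (inord l, inord i.+1).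

Record is_wheelspace (k : fieldType) (S : wheel_data k) : Prop := {
  wheelspace_sbimodule : is_sbimodule S;
  wt_linear : forall n (j i : 'I_n.+1), linear (@wt k S n j i);
  wt_equivariant : forall n (j i : 'I_n.+1) (s t : 'S_n.+1) (v : S n.+1),
    wt j i (wl s (wr v t)) =
    wl (ldel j s) (wr (wt (s^-1%g j) (t i) v) (rdel i t));
  wt_comm : forall n (i j : 'I_n.+1) (p l : 'I_n.+2) (v : S n.+2),
    wt j i (wt l p v) =
    wt (swap_idx j l).1 (swap_idx i p).1
      (wt (swap_idx j l).2 (swap_idx i p).2 v)
}.

Definition pairing (k : fieldType) (S : wheel_data k) : Type :=
  forall n m, S n -> S m -> S (n + m)%N.

Record is_bimodule_pairing (k : fieldType) (S : wheel_data k)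
    (f : pairing S) : Prop := {
  pairing_bilinear : forall n m, bilinear_map (f n m);
  pairing_equivariant : forall n m (s s' : 'S_n) (t t' : 'S_m)
      (v : S n) (w : S m),
    f n m (wl s (wr v s')) (wl t (wr w t')) =
    wl (psum s t) (wr (f n m v w) (psum s' t'))
}.

Record contraction_compatible (k : fieldType) (S : wheel_data k)
    (f : pairing S) : Prop := {
  contraction_left : forall n m (j i : 'I_n.+1) (v : S n.+1) (w : S m),
    wt (lshift m j : 'I_(n + m).+1) (lshift m i : 'I_(n + m).+1)
      (f n.+1 m v w : S (n + m).+1) =
    f n m (wt j i v) w;
  contraction_right : forall n m (j i : 'I_m.+1) (v : S n) (w : S m.+1),
    wt (cast_ord (addnS n m) (rshift n j)) (cast_ord (addnS n m) (rshift n i))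
      (wcast (addnS n m) (f n m.+1 v w)) =
    f n m v (wt j i w)
}.

Record is_comm_wheelgebra (k : fieldType) (S : wheel_data k)
    (mu : pairing S) (one : S 0%N) : Prop := {
  wheelgebra_wheelspace : is_wheelspace S;
  wmul_pairing : is_bimodule_pairing mu;
  wmul_contraction : contraction_compatible mu;
  wmulA : forall p n m (u : S p) (v : S n) (w : S m),
    wcast (addnA p n m) (mu p (n + m)%N u (mu n m v w)) =
    mu (p + n)%N m (mu p n u v) w;
  wmul1l : forall n (v : S n), mu 0%N n one v = v;
  wmul1r : forall n (v : S n), wcast (addn0 n) (mu n 0%N v one) = v;
  wmulC : forall n m (v : S n) (w : S m),
    mu n m v w = wcast (addnC m n)
      (wl (blk _ [tuple m; n] (cyc 2 0 1))
        (wr (mu m n w v) (blk _ [tuple n; m] (cyc 2 0 1))))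
}.

Record is_bracket (k : fieldType) (S : wheel_data k)
    (mu br : pairing S) : Prop := {
  bracket_pairing : is_bimodule_pairing br;
  bracket_antisym : forall n m (v : S n) (w : S m),
    br n m v w = - wcast (addnC m n)
      (wl (blk _ [tuple m; n] (cyc 2 0 1))
        (wr (br m n w v) (blk _ [tuple n; m] (cyc 2 0 1))));
  bracket_leibniz : forall p n m (u : S p) (v : S n) (w : S m),
    br p (n + m)%N u (mu n m v w) =
    wcast (esym (addnA p n m)) (mu (p + n)%N m (br p n u v) w) +
    wcast (addnCA n p m)
      (wl (blk _ [tuple n; p; m] (cyc 3 0 1))
        (wr (mu n (p + m)%N v (br p m u w))
            (blk _ [tuple p; n; m] (cyc 3 0 1))))
}.

Lemma addn_rot n m p : (n + (m + p) = p + (n + m))%N.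
Proof. by rewrite addnA addnC. Qed.

Definition bracket_jacobi (k : fieldType) (S : wheel_data k)
    (br : pairing S) : Prop :=
  forall p n m (u : S p) (v : S n) (w : S m),
    0 = br p (n + m)%N u (br n m v w)
      + wcast (addn_rot n m p)
          (wl (blk _ [tuple n; m; p] (cyc 3 0 2))
            (wr (br n (m + p)%N v (br m p w u))
                (blk _ [tuple p; n; m] (cyc 3 0 2)^-1%g)))
      + wcast (etrans (addn_rot m p n) (addn_rot n m p))
          (wl (blk _ [tuple m; p; n] (cyc 3 0 2)^-1%g)
            (wr (br m (p + n)%N w (br p n u v))
                (blk _ [tuple p; n; m] (cyc 3 0 2)))).

Record is_poisson_wheelgebra (k : fieldType) (S : wheel_data k)
    (mu : pairing S) (one : S 0%N) (br : pairing S) : Prop := {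
  poisson_comm_wheelgebra : is_comm_wheelgebra mu one;
  poisson_bracket : is_bracket mu br;
  poisson_contraction : contraction_compatible br;
  poisson_jacobi : bracket_jacobi br
}.

(* Associative, not necessarily unital. *)
Record assoc_algebra (k : fieldType) := AssocAlgebra {
  acar :> lmodType k;
  amul : acar -> acar -> acar;
  amul_bilinear : bilinear_map amul;
  amulA : associative amul
}.

Section TensorPower.
Variables (k : fieldType) (V : lmodType k).

Definition tset n (a : n.-tuple V) (i : 'I_n) (x : V) : n.-tuple V :=
  [tuple if j == i then x else tnth a j | j < n].

Definition permute_tuple n (s : 'S_n) (a : n.-tuple V) : n.-tuple V :=
  [tuple tnth a (s i) | i < n].

Inductive tpow_rel n : {freeg (n.-tuple V) / k} -> Prop :=
| TpowLin a i c x y : tpow_rel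
    (fgen k (tset a i (c *: x + y))
     - (c *: fgen k (tset a i x) + fgen k (tset a i y))).

Definition tpow n : lmodType k := presented (@tpow_rel n).
Definition pure n (a : n.-tuple V) : tpow n := pgen (@tpow_rel n) a.
Definition tlift n (M : lmodType k) (f : n.-tuple V -> M) : tpow n -> M :=
  plift f.

Lemma tliftP n (M : lmodType k) (f : n.-tuple V -> M) :
  (forall a i c x y, f (tset a i (c *: x + y)) =
     c *: f (tset a i x) + f (tset a i y)) ->
  linear (tlift f) /\ forall a, tlift f (pure a) = f a.
Proof.
move=> hf; have fR r : tpow_rel r -> fglift f r = 0.
  by case=> a i c x y; rewrite linearB linearP /= !fglift_gen hf subrr.
by split; [exact: plift_linear | exact: plift_gen].
Qed.

Definition tcat m n (x : tpow m) (y : tpow n) : tpow (m + n) :=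
  tlift (fun a => tlift (fun b => pure [tuple of a ++ b]) y) x.

(* (a_1 ... a_n) |-> (a_{s^-1(1)} ... a_{s^-1(n)}) *)
Definition tensor_perm n (s : 'S_n) : tpow n -> tpow n :=
  tlift (fun a => pure (permute_tuple s^-1%g a)).
End TensorPower.

Section DoubleBracket.
Variables (k : fieldType) (A : assoc_algebra k).

(* outer structure: x (y (x) z) w = xy (x) zw *)
Definition outer_l (x : A) : tpow A 2 -> tpow A 2 :=
  tlift (fun a => pure [tuple amul x (tnth a 0); tnth a 1]).
Definition outer_r (y : tpow A 2) (x : A) : tpow A 2 :=
  tlift (fun a => pure [tuple tnth a 0; amul (tnth a 1) x]) y.

Variable D : {linear tpow A 2 -> tpow A 2}.

Definition dbr (a b : A) : tpow A 2 := D (pure [tuple a; b]).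

Record is_double_bracket : Prop := {
  dbr_antisym : forall a b, dbr b a = - tensor_perm (cyc 2 0 1) (dbr a b);
  dbr_leibniz : forall a b c,
    dbr a (amul b c) = outer_r (dbr a b) c + outer_l b (dbr a c)
}.

Definition id_dbr : tpow A 3 -> tpow A 3 :=
  tlift (fun a : 3.-tuple A =>
    tcat (pure [tuple tnth a 0]) (dbr (tnth a 1) (tnth a 2))).
Definition dbr_id : tpow A 3 -> tpow A 3 :=
  tlift (fun a : 3.-tuple A =>
    tcat (dbr (tnth a 0) (tnth a 1)) (pure [tuple tnth a 2])).

Definition is_double_poisson : Prop :=
  is_double_bracket /\
  forall x : tpow A 3,
    \sum_(s in <[cyc 3 0 2]>%g) tensor_perm s (dbr_id (id_dbr (tensor_perm s^-1%g x))) = 0.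

(* {a, b}_A *)
Definition dbr_mul (a b : A) : A :=
  tlift (fun t => amul (tnth t 0) (tnth t 1)) (dbr a b).
End DoubleBracket.

Section Tensor.
Variables (k : fieldType) (V W : lmodType k).

Inductive tens_rel : {freeg (V * W)%type / k} -> Prop :=
| TensL c v v' w : tens_rel
    (fgen k (c *: v + v', w) - (c *: fgen k (v, w) + fgen k (v', w)))
| TensR c v w w' : tens_rel
    (fgen k (v, c *: w + w') - (c *: fgen k (v, w) + fgen k (v, w'))).

Definition tens : lmodType k := presented tens_rel.
Definition tens_mk (v : V) (w : W) : tens := pgen tens_rel (v, w).
Definition tens_lift (M : lmodType k) (f : V -> W -> M) : tens -> M :=
  plift (fun p => f p.1 p.2).

Lemma tens_liftP (M : lmodType k) (f : V -> W -> M) : bilinear_map f ->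
  linear (tens_lift f) /\ forall v w, tens_lift f (tens_mk v w) = f v w.
Proof.
move=> [fl fr]; set g := fun p : V * W => f p.1 p.2.
have gR r : tens_rel r -> fglift g r = 0.
  case=> [c v v' w|c v w w']; rewrite linearB linearP /= !fglift_gen /g /=.
    by rewrite [X in X - _](fl w) subrr.
  by rewrite [X in X - _](fr v) subrr.
split; first exact: plift_linear.
by move=> v w; rewrite -[RHS]/(g (v, w)); exact: plift_gen.
Qed.
End Tensor.

Section SymmetricAlgebra.
Variables (k : fieldType) (V : lmodType k).

(* a word stands for the product of its letters *)
Inductive sym_rel : {freeg (seq V) / k} -> Prop :=
| SymLin c v v' s : sym_rel
    (fgen k ((c *: v + v') :: s) - (c *: fgen k (v :: s) + fgen k (v' :: s)))
| SymPerm s t : perm_eq s t -> sym_rel (fgen k s - fgen k t).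

Definition SymAlg : lmodType k := presented sym_rel.
Definition sym_word (s : seq V) : SymAlg := pgen sym_rel s.
Definition sym_lift (M : lmodType k) (f : seq V -> M) : SymAlg -> M := plift f.
Definition sym_mul (x y : SymAlg) : SymAlg :=
  sym_lift (fun s => sym_lift (fun t => sym_word (s ++ t)) y) x.

Lemma sym_liftP (M : lmodType k) (f : seq V -> M) :
  (forall s, linear (fun v => f (v :: s))) ->
  (forall s t, perm_eq s t -> f s = f t) ->
  linear (sym_lift f) /\ forall s, sym_lift f (sym_word s) = f s.
Proof.
move=> fl fp; have fR r : sym_rel r -> fglift f r = 0.
  case=> [c v v' s|s t st].
    rewrite linearB linearP /= !fglift_gen.
    by rewrite (fl s c v v') subrr.
  by rewrite linearB /= !fglift_gen (fp _ _ st) subrr.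
by split; [exact: plift_linear | exact: plift_gen].
Qed.
End SymmetricAlgebra.

Section Fock.
Variables (k : fieldType) (A : assoc_algebra k).

Inductive comm_rel : A -> Prop :=
| CommRel a b : comm_rel (amul a b - amul b a).

Definition Acyc : lmodType k := quotmod comm_rel.
Definition cycproj (a : A) : Acyc := qproj comm_rel a.

Section BimoduleU.
Variable n : nat.

(* (s, x, t) stands for s . x . t *)
Inductive U_rel : {freeg ('S_n * tpow A n * 'S_n)%type / k} -> Prop :=
| URelLin s t c x y : U_rel
    (fgen k (s, c *: x + y, t) - (c *: fgen k (s, x, t) + fgen k (s, y, t)))
| URelPerm s t r a : U_rel
    (fgen k (s \oS r^-1%g, pure a, r \oS t)
     - fgen k (s, pure (permute_tuple r a), t)).

Definition Ubim : lmodType k := presented U_rel.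
Definition U_mk (s : 'S_n) (x : tpow A n) (t : 'S_n) : Ubim :=
  pgen U_rel (s, x, t).
Definition U_lift (M : lmodType k) (f : 'S_n -> tpow A n -> 'S_n -> M) :
  Ubim -> M := plift (fun p => f p.1.1 p.1.2 p.2).

Lemma U_liftP (M : lmodType k) (f : 'S_n -> tpow A n -> 'S_n -> M) :
  (forall s t, linear (fun x => f s x t)) ->
  (forall s t r a, f (s \oS r^-1%g) (pure a) (r \oS t) =
     f s (pure (permute_tuple r a)) t) ->
  linear (U_lift f) /\ forall s x t, U_lift f (U_mk s x t) = f s x t.
Proof.
move=> fl fp; set g := fun p : 'S_n * tpow A n * 'S_n => f p.1.1 p.1.2 p.2.
have gR r : U_rel r -> fglift g r = 0.
  case=> [s t c x y|s t r' a].
    rewrite linearB linearP /= !fglift_gen /g /=.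
    by rewrite (fl s t c x y) subrr.
  by rewrite linearB /= !fglift_gen /g /= fp subrr.
split; first exact: plift_linear.
by move=> s x t; rewrite -[RHS]/(g (s, x, t)); exact: plift_gen.
Qed.

Definition U_l (r : 'S_n) : Ubim -> Ubim := U_lift (fun s x t => U_mk (r \oS s) x t).
Definition U_r (y : Ubim) (r : 'S_n) : Ubim :=
  U_lift (fun s x t => U_mk s x (t \oS r)) y.
End BimoduleU.

Definition U_mul n m (x : Ubim n) (y : Ubim m) : Ubim (n + m) :=
  U_lift (fun s a t => U_lift (fun s' a' t' =>
    U_mk (psum s s') (tcat a a') (psum t t')) y) x.

Definition fock_car (n : nat) : lmodType k := tens (Ubim n) (SymAlg Acyc).

Definition fock_l n (s : 'S_n) : fock_car n -> fock_car n :=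
  tens_lift (fun x w => tens_mk (U_l s x) w).
Definition fock_r n (v : fock_car n) (s : 'S_n) : fock_car n :=
  tens_lift (fun x w => tens_mk (U_r x s) w) v.

Definition fock_embed n (x : tpow A n) : fock_car n :=
  tens_mk (U_mk 1%g x 1%g) (sym_word [::]).

(* The contraction of (a_1 | ... | a_n) (x) w, in the cases i < j, i > j and
   i = j; fock_contr extends it by (W1).  In merge, a_i a_j sits at the place
   of a_i and the entry j is removed. *)
Definition fock_contr_pure n (j i : 'I_n.+1) (a : n.+1.-tuple A)
    (w : SymAlg Acyc) : fock_car n :=
  let merge : n.-tuple A :=
    [tuple if lift j x == i then amul (tnth a i) (tnth a j)
           else tnth a (lift j x) | x < n] in
  let omit : n.-tuple A := [tuple tnth a (lift i x) | x < n] in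
  if (i < j)%N then tens_mk (U_mk 1%g (pure merge) (cyc n i j.-1)) w
  else if (j < i)%N then
    tens_mk (U_mk 1%g (pure merge) (cyc n j i.-1)^-1%g) w
  else tens_mk (U_mk 1%g (pure omit) 1%g)
         (sym_mul (sym_word [:: cycproj (tnth a i)]) w).

Definition fock_contr n (j i : 'I_n.+1) : fock_car n.+1 -> fock_car n :=
  tens_lift (fun x w => U_lift (fun s y t =>
    fock_l (ldel j s)
      (fock_r (tlift (fun a => fock_contr_pure (s^-1%g j) (t i) a w) y)
              (rdel i t))) x).

Definition fock : wheel_data k := @WheelData k fock_car fock_l fock_r fock_contr.

Definition fock_mul : pairing fock := fun n m v v' =>
  tens_lift (fun x w => tens_lift (fun x' w' =>
    tens_mk (U_mul x x') (sym_mul w w') : fock (n + m)%N) v') v.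

Definition fock_one : fock 0 := fock_embed (pure [tuple]).

Definition fock_gen1 (a : A) : fock 1 := fock_embed (pure [tuple a]).
Definition fock_gen0 (x : Acyc) : fock 0 :=
  tens_mk (U_mk 1%g (pure [tuple]) 1%g) (sym_word [:: x]).

(* In weight (1, 1) the transposition acts on the left of {{a, b}}.  Acting on
   the right, it would be inconsistent with the contractions: as
   t_(1,1) ((p | q) . (1 2)) = t_(1,2) (p | q) = (q p), compatibility would
   force {pi a, b} to be the sum of the q p, not of the p q as in
   fock_bracket01, where {{a, b}} = sum of p (x) q.  With (1 2) on the left,
   t_(1,1) ((1 2) . (p | q)) = t_(2,1) (p | q) = (p q). *)
Record fock_bracket_values (D : {linear tpow A 2 -> tpow A 2})
    (br : pairing fock) : Prop := {
  fock_bracket11 : forall a b : A,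
    br 1%N 1%N (fock_gen1 a) (fock_gen1 b) =
    fock_l (cyc 2 0 1) (fock_embed (dbr D a b));
  fock_bracket01 : forall a b : A,
    br 0%N 1%N (fock_gen0 (cycproj a)) (fock_gen1 b) =
    fock_gen1 (dbr_mul D a b);
  fock_bracket10 : forall a b : A,
    br 1%N 0%N (fock_gen1 b) (fock_gen0 (cycproj a)) =
    - fock_gen1 (dbr_mul D a b);
  fock_bracket00 : forall a b : A,
    br 0%N 0%N (fock_gen0 (cycproj a)) (fock_gen0 (cycproj b)) =
    fock_gen0 (cycproj (dbr_mul D a b))
}.

End Fock.

(* Main.v *)
(* Write an element of F(A)(n) as a polynomial in commuting letters: the strand
   of (s, a, t) at position x becomes the matrix entry (a_x)_ij with output
   label i = s(x) and input label j = t^-1(x), and an element of A_cyc becomes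
   a closed letter.  This embeds all the F(A)(n) into one commutative algebra Q
   with labels in nat, as the span of the monomials in which each label below n
   occurs once as an output and once as an input.  The S_n-actions become
   relabellings, the product of F(A) becomes multiplication after a shift of
   the labels, and the contraction of the output p with the input q becomes the
   second-order differential operator on Q that maps a_pq to pi(a), the other
   letters to 0, and has symbol (a_iq, b_pj) |-> (ab)_ij.
   The bracket is the biderivation of Q given on open letters by Van den
   Bergh's formula {a_ij, b_kl} = {{a, b}}'_kj {{a, b}}''_il.  Being
   identities between differential operators, the axioms need only be checked
   on few letters: (W2) is associativity of A, compatibility with contractions
   is the Leibniz rule of the double bracket, and the Jacobi identity on open
   letters is the double Jacobi identity.  On closed letters Jacobi follows by
   contraction, as pi(a) is the contraction of an a_ij. *)
From HB Require Import structures.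
Require Import Defs.
From mathcomp Require Import all_boot all_order all_algebra all_fingroup.
From mathcomp Require Import zify ring.
From mathcomp Require Import boolp freeg.
From mathcomp Require Import generic_quotient fintype.

Set Implicit Arguments.
Unset Strict Implicit.
Unset Printing Implicit Defensive.

Import GRing.Theory.

Local Open Scope ring_scope.
Local Open Scope quotient_scope.

(** Inside $\mathcal F(A)(n)$, every operation would need a proof that a map out of a presentation
    respects the relations, and every axiom a comparison across casts such as $m+n=n+m$ and across
    block permutations. In $Q$ a cast changes nothing, and a permutation, extended by the identity,
    is a relabelling of all of $\mathbb N_0$. The embedding has an explicit retraction, which sorts
    the strands of a monomial by output; so both the well-definedness of an operation and its axioms
    follow from its formula on letters.

    A contraction is not a derivation: it has cross terms between two factors. They vanish when one
    factor avoids both contracted labels, which is the situation of the compatibility axioms. The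
    bracket of $\mathcal F(A)$ is defined through the retraction, so the bracket of two elements of
    the image must be shown to stay in the image; this is a count of labels. Uniqueness is a
    separate argument: products, actions and generators produce all of $\mathcal F(A)$. *)

Section Presented.
Variables (k : fieldType).

Lemma quotmod_surj (V : lmodType k) (R : V -> Prop) (x : quotmod R) :
  exists v, x = qproj R v.
Proof. by exists (repr (x : quot_sort R)); rewrite /qproj reprK. Qed.

Lemma freegU_scale (X : choiceType) c (x : X) :
  << c *g x >> = c *: fgen k x :> {freeg X / k}.
Proof.
apply/eqP/freeg_eqP => y.
by rewrite coeff_fgscale !coeffU mul1r.
Qed.

Lemma linear_compose (U M N : lmodType k) (g : M -> N) (f : U -> M) :
  linear g -> linear f -> linear (g \o f).
Proof. by move=> lg lf c x y; rewrite /= lf lg. Qed.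

Lemma linear_add (U M : lmodType k) (f g : U -> M) :
  linear f -> linear g -> linear (fun y => f y + g y).
Proof. by move=> lf lg c x y; rewrite lf lg scalerDr addrACA. Qed.

Lemma linear_mul (U : lmodType k) (M : algType k) (x : M) (f : U -> M) :
  linear f -> linear (fun y => x * f y).
Proof. by move=> lf c u v; rewrite lf mulrDr scalerAr. Qed.

Lemma linear_combination (U M : lmodType k) c (f g : U -> M) :
  linear f -> linear g -> linear (fun y => c *: f y + g y).
Proof.
move=> lf lg d u v.
by rewrite lf lg !scalerDr !scalerA addrACA (mulrC c d).
Qed.

Section LinearProp.
Variables (U M : lmodType k) (f : U -> M).
Hypothesis lf : linear f.

(** Most maps below are bare functions that become linear only under hypotheses; these three facts
    replace [linear0], [linearD], [linearN] for them. *)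
Lemma linear_prop0 : f 0 = 0.
Proof. by have := lf (-1) 0 0; rewrite !scaleN1r addr0 oppr0 addNr. Qed.

Lemma linear_propD u v : f (u + v) = f u + f v.
Proof. by have := lf 1 u v; rewrite !scale1r. Qed.

Lemma linear_propN u : f (- u) = - f u.
Proof. by have := lf (-1) u 0; rewrite linear_prop0 !scaleN1r !addr0. Qed.
End LinearProp.

(** The quotient map is onto, and an element of the free module is the sum of its coefficients times
    generators. *)
Lemma presented_ind (X : choiceType) (R : {freeg X / k} -> Prop)
    (P : presented R -> Prop) :
  P 0 -> (forall c x u, P u -> P (c *: pgen R x + u)) -> forall u, P u.
Proof.
move=> P0 PD u; have [v ->] := quotmod_surj u.
have lin := @qproj_linear k _ R.
rewrite -[v]freeg_sumE.
elim: (dom v) => [|x s ih].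
  rewrite big_nil.
  by rewrite (linear_prop0 lin).
rewrite big_cons freegU_scale lin; exact: PD.
Qed.

Lemma presented_ext (X : choiceType) (R : {freeg X / k} -> Prop)
    (M : lmodType k) (f g : presented R -> M) :
  linear f -> linear g -> (forall x, f (pgen R x) = g (pgen R x)) -> f =1 g.
Proof.
move=> lf lg fg; elim/presented_ind => [|c x u ih].
  by rewrite (linear_prop0 lf) (linear_prop0 lg).
by rewrite lf lg fg ih.
Qed.

Lemma qproj_rel (V : lmodType k) (R : V -> Prop) u v :
  R (u - v) -> qproj R u = qproj R v.
Proof.
move=> h; apply/eqP; rewrite piE; apply/asboolP; exact: in_span_gen.
Qed.

End Presented.

(** * The algebra of letters *)

Section LetterAlgebra.
Variables (k : fieldType) (A : assoc_algebra k).

Definition letter : Type := (nat * nat * A + Acyc A)%type.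
HB.instance Definition _ := Choice.on letter.

(* The matrix entry a_ij: a strand with output i, input j and entry a. *)
Definition op (i j : nat) (a : A) : letter := inl (i, j, a).
Definition cl (x : Acyc A) : letter := inr x.

(** Linearity is imposed on the first letter only; [WordPerm] carries it to the others and makes the
    product commutative. *)
Inductive word_rel : {freeg (seq letter) / k} -> Prop :=
| WordOp c i j a b w : word_rel
    (fgen k (op i j (c *: a + b) :: w)
     - (c *: fgen k (op i j a :: w) + fgen k (op i j b :: w)))
| WordCl c x y w : word_rel
    (fgen k (cl (c *: x + y) :: w)
     - (c *: fgen k (cl x :: w) + fgen k (cl y :: w)))
| WordPerm s t : perm_eq s t -> word_rel (fgen k s - fgen k t).

Definition letter_alg : Type := presented word_rel.
HB.instance Definition _ := GRing.Lmodule.copy letter_alg (presented word_rel).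
Local Notation Q := letter_alg.

Definition word (w : seq letter) : Q := pgen word_rel w.

(** Bundling a function on words with its compatibility with [word_rel] makes [word_lift] linear
    without side conditions. *)
Record word_map (M : lmodType k) := WordMap {
  wfun :> seq letter -> M;
  wfun_op : forall i j w, linear (fun a => wfun (op i j a :: w));
  wfun_cl : forall w, linear (fun x => wfun (cl x :: w));
  wfun_perm : forall s t, perm_eq s t -> wfun s = wfun t
}.

Definition word_lift (M : lmodType k) (f : word_map M) : Q -> M :=
  plift (R := word_rel) f.

Lemma word_map_rel (M : lmodType k) (f : word_map M) r :
  word_rel r -> fglift f r = 0.
Proof.
case=> [c i j a b w|c x y w|s t st].
- by rewrite linearB linearP /= !fglift_gen (wfun_op f i j w c a b) subrr.
- by rewrite linearB linearP /= !fglift_gen (wfun_cl f w c x y) subrr.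
- by rewrite linearB /= !fglift_gen (wfun_perm f st) subrr.
Qed.

Lemma word_lift_linear (M : lmodType k) (f : word_map M) :
  linear (word_lift f).
Proof. exact: plift_linear (@word_map_rel M f). Qed.
HB.instance Definition _ (M : lmodType k) (f : word_map M) :=
  GRing.isLinear.Build k Q M _ (word_lift f) (@word_lift_linear M f).

Lemma word_liftE (M : lmodType k) (f : word_map M) w :
  word_lift f (word w) = f w.
Proof. exact: plift_gen (@word_map_rel M f) w. Qed.

Lemma word_ext (M : lmodType k) (f g : Q -> M) : linear f -> linear g ->
  (forall w, f (word w) = g (word w)) -> f =1 g.
Proof. exact: presented_ext. Qed.

Lemma word_op i j w : linear (fun a => word (op i j a :: w)).
Proof.
move=> c a b; rewrite [LHS]/word /pgen (qproj_rel (WordOp c i j a b w)).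
by rewrite qproj_linear.
Qed.

Lemma word_cl w : linear (fun x => word (cl x :: w)).
Proof.
move=> c a b; rewrite [LHS]/word /pgen (qproj_rel (WordCl c a b w)).
by rewrite qproj_linear.
Qed.

Lemma word_perm s t : perm_eq s t -> word s = word t.
Proof. by move=> st; rewrite /word /pgen (qproj_rel (WordPerm st)). Qed.

(** Closed by [Defined], since later proofs unfold the underlying function with [/=]. *)
Definition word_cat (s : seq letter) : word_map Q.
Proof.
exists (fun t => word (s ++ t)) => [i j w c a b|w c a b|t t' tt'].
- rewrite -!cat_rcons.
  have E a' : word (rcons s (op i j a') ++ w) = word (op i j a' :: s ++ w).
    by apply: word_perm; rewrite -cat_cons perm_cat2r perm_rcons.
  by rewrite !E word_op.
- rewrite -!cat_rcons.
  have E a' : word (rcons s (cl a') ++ w) = word (cl a' :: s ++ w).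
    by apply: word_perm; rewrite -cat_cons perm_cat2r perm_rcons.
  by rewrite !E word_cl.
- by apply: word_perm; rewrite perm_cat2l.
Defined.

Definition word_mul (y : Q) : word_map Q.
Proof.
exists (fun s => word_lift (word_cat s) y) => [i j w|w|s t st] /=.
- move=> c a b; move: y; apply: word_ext.
  + exact: word_lift_linear.
  + by apply: linear_combination; exact: word_lift_linear.
  + by move=> v; rewrite !word_liftE /= word_op.
- move=> c a b; move: y; apply: word_ext.
  + exact: word_lift_linear.
  + by apply: linear_combination; exact: word_lift_linear.
  + by move=> v; rewrite !word_liftE /= word_cl.
- move: y; apply: word_ext; try exact: word_lift_linear.
  by move=> v; rewrite !word_liftE /=; apply: word_perm; rewrite perm_cat2r.
Defined.

Definition qmul (x y : Q) : Q := word_lift (word_mul y) x.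

Lemma qmulE s t : qmul (word s) (word t) = word (s ++ t).
Proof. by rewrite /qmul word_liftE /= word_liftE. Qed.

Lemma qmul_linearl y : linear (qmul ^~ y).
Proof. exact: word_lift_linear. Qed.

Lemma qmul_linearr x : linear (qmul x).
Proof.
move=> c u v; move: x; apply: word_ext; first exact: qmul_linearl.
  by apply: linear_combination; exact: qmul_linearl.
by move=> w; rewrite /qmul !word_liftE /= linearP.
Qed.

Lemma qmulC : commutative qmul.
Proof.
move=> x y; move: x; apply: word_ext => [||s].
- exact: qmul_linearl.
- exact: qmul_linearr.
move: y; apply: word_ext => [||t].
- exact: qmul_linearr.
- exact: qmul_linearl.
by rewrite !qmulE; apply: word_perm; rewrite perm_catC.
Qed.

Lemma qmulA : associative qmul.
Proof.
move=> x y z; move: x; apply: word_ext => [||s].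
- exact: qmul_linearl.
- by move=> c u v; rewrite !qmul_linearl.
move: y; apply: word_ext => [||t].
- by move=> c u v; rewrite qmul_linearl qmul_linearr.
- by move=> c u v; rewrite qmul_linearr qmul_linearl.
move: z; apply: word_ext => [||r].
- by move=> c u v; rewrite !qmul_linearr.
- exact: qmul_linearr.
by rewrite !qmulE catA.
Qed.

Lemma qmul1 : left_id (word [::]) qmul.
Proof.
apply: word_ext => [||w]; [exact: qmul_linearr | by move=> ? |].
by rewrite qmulE.
Qed.

Lemma qmulDl : left_distributive qmul +%R.
Proof. by move=> x y z; have := qmul_linearl z 1 x y; rewrite !scale1r. Qed.

(** Separates $1$ from $0$ in $Q$, as the structure of a nonzero ring demands. *)
Definition constant_term : word_map k^o.
Proof.
refine (@WordMap k^o (fun w => (w == [::])%:R) _ _ _)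
  => [i j w c a b|w c a b|s t st] //=.
- by rewrite scaler0 addr0.
- by rewrite scaler0 addr0.
congr (_ %:R); congr (nat_of_bool _); apply/eqP/eqP => h.
  by apply/perm_nilP; rewrite perm_sym -h.
by apply/perm_nilP; rewrite -h.
Defined.

Lemma q1_neq0 : word [::] != 0.
Proof.
apply/eqP => /(congr1 (word_lift constant_term)).
by rewrite word_liftE linear0 /= => /eqP; rewrite oner_eq0.
Qed.

HB.instance Definition _ := GRing.Zmodule_isComNzRing.Build Q
  qmulA qmulC qmul1 qmulDl q1_neq0.

Lemma q_scaleAl c (x y : Q) : c *: (x * y) = c *: x * y.
Proof.
have h0 : qmul 0 y = 0 by exact: (mul0r y).
by have := qmul_linearl y c x 0; rewrite /= h0 !addr0.
Qed.
HB.instance Definition _ := GRing.Lmodule_isLalgebra.Build k Q q_scaleAl.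
HB.instance Definition _ := GRing.Lalgebra_isComAlgebra.Build k Q.

Definition lt (l : letter) : Q := word [:: l].

Lemma word_cons l w : word (l :: w) = lt l * word w.
Proof. by rewrite -[RHS]/(qmul _ _) qmulE. Qed.
Lemma word_nil : word [::] = 1. Proof. by []. Qed.
Lemma word_cat_mul s t : word (s ++ t) = word s * word t.
Proof. by rewrite -[RHS]/(qmul _ _) qmulE. Qed.
Lemma word_prod w : word w = \prod_(l <- w) lt l.
Proof.
by elim: w => [|l w ih]; rewrite ?big_nil ?big_cons // word_cons ih.
Qed.

Lemma lt_op_linear i j : linear (fun a => lt (op i j a)).
Proof. exact: word_op. Qed.
Lemma lt_cl_linear : linear (fun x => lt (cl x)).
Proof. exact: word_cl. Qed.

Lemma letter_ind (P : Q -> Prop) :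
  (forall c x y, P x -> P y -> P (c *: x + y)) -> P 1 ->
  (forall l u, P u -> P (lt l * u)) -> forall u, P u.
Proof.
move=> PD P1 Pl; elim/presented_ind => [|c w u ih].
  (* The case of $0$ comes from $0=(-1)\cdot 1+1$. *)
  by have := PD (-1) 1 1 P1 P1; rewrite scaleN1r addNr.
apply: PD ih; elim: w => [|l w ih]; first exact: P1.
by rewrite -[pgen _ _]/(word _) word_cons; exact: Pl.
Qed.

End LetterAlgebra.
Arguments op {k A} i j a.
Arguments cl {k A} x.

(** * Derivations, biderivations, second-order operators and relabellings of $Q$ *)

Section Operators.
Variables (k : fieldType) (A : assoc_algebra k).
Local Notation Q := (letter_alg A).

Record letter_map (M : lmodType k) := LetterMap {
  lfun :> letter A -> M;
  lfun_op : forall i j, linear (fun a => lfun (op i j a));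
  lfun_cl : linear (fun x => lfun (cl x))
}.

(** Adjacent swaps behind a common prefix suffice. The first premise also supplies [perm_eq s t],
    because the recursive operators below use [word s] next to their recursive value. *)
Lemma perm_invariant (M : Type) (f : seq (letter A) -> M) :
  (forall l s t, perm_eq s t -> f s = f t -> f (l :: s) = f (l :: t)) ->
  (forall l m s, f (l :: m :: s) = f (m :: l :: s)) ->
  forall s t, perm_eq s t -> f s = f t.
Proof.
move=> fc fs; elim=> [|l s ih] t st.
  by move: st; rewrite perm_sym => /perm_nilP ->.
have lt : l \in t by rewrite -(perm_mem st) mem_head.
case/splitPr: lt st => t1 t2 st.
have st' : perm_eq s (t1 ++ t2).
  by rewrite -(perm_cons l) (perm_trans st) // -cat1s perm_catCA.
rewrite (fc l _ _ st' (ih _ st')).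
elim: t1 {st st'} => //= m t1 iht; rewrite fs.
by apply: fc => //; rewrite -cat_cons -[l :: t2]cat1s perm_sym perm_catCA.
Qed.

Fixpoint der_word (d : letter_map Q) (w : seq (letter A)) : Q :=
  if w is l :: w then d l * word w + lt l * der_word d w else 0.

Definition der_map (d : letter_map Q) : word_map A Q.
Proof.
exists (der_word d) => [i j w c a b|w c a b|] /=.
- rewrite (lfun_op d) lt_op_linear !mulrDl -!scalerAl scalerDr; ring.
- rewrite (lfun_cl d) lt_cl_linear !mulrDl -!scalerAl scalerDr; ring.
- apply: perm_invariant => [l s t st|l m s] /=; last by rewrite !word_cons; ring.
  by move=> ->; rewrite (word_perm st).
Defined.

Definition der (d : letter_map Q) : Q -> Q := word_lift (der_map d).
HB.instance Definition _ (d : letter_map Q) := GRing.Linear.on (der d).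

Lemma der1 d : der d 1 = 0.
Proof. by rewrite -[1]/(word [::]) /der word_liftE. Qed.

Lemma der0 d : der d 0 = 0. Proof. exact: linear0. Qed.
Lemma derD d u v : der d (u + v) = der d u + der d v.
Proof. exact: linearD. Qed.

Lemma der_ltM d l u : der d (lt l * u) = d l * u + lt l * der d u.
Proof.
move: u; apply: word_ext => [||w].
- by move=> c x y; rewrite mulrDr -scalerAr linearP.
- move=> c x y; rewrite linearP /= !mulrDr -!scalerAr scalerDr; ring.
- by rewrite -word_cons /der !word_liftE.
Qed.

Lemma der_lt d l : der d (lt l) = d l.
Proof. by rewrite -[lt l]mulr1 der_ltM der1 mulr0 addr0 mulr1. Qed.

Lemma derM d u v : der d (u * v) = der d u * v + u * der d v.
Proof.
elim/letter_ind: u => [c x y hx hy||l u ih].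
- rewrite mulrDl -scalerAl !linearP /= hx hy !mulrDl -!scalerAl scalerDr; ring.
- by rewrite der1 !mul1r mul0r add0r.
- rewrite -mulrA !der_ltM ih; ring.
Qed.

Lemma der_linear_symbol c (d d1 d2 : letter_map Q) u :
  (forall l, d l = c *: d1 l + d2 l) -> der d u = c *: der d1 u + der d2 u.
Proof.
move=> dE; elim/letter_ind: u => [e x y hx hy||l u ih].
- rewrite !linearP /= hx hy !scalerDr !scalerA (mulrC e c).
  by rewrite addrACA.
- by rewrite !der1 scaler0 addr0.
- rewrite !der_ltM ih dE mulrDl mulrDr -!scalerAl -!scalerAr scalerDr; ring.
Qed.

Lemma der_eq0 (d : letter_map Q) u : (forall l, d l = 0) -> der d u = 0.
Proof.
move=> d0; elim/letter_ind: u => [c x y hx hy||l u ih].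
- by rewrite linearP /= hx hy scaler0 addr0.
- by rewrite der1.
- by rewrite der_ltM ih d0 mul0r mulr0 addr0.
Qed.

(** A bilinear function on pairs of letters; linearity in the second letter is part of
    [letter_map]. *)
Record symbol := Symbol {
  sym :> letter A -> letter_map Q;
  sym_op : forall i j c x y m,
    sym (op i j (c *: x + y)) m = c *: sym (op i j x) m + sym (op i j y) m;
  sym_cl : forall c x y m,
    sym (cl (c *: x + y)) m = c *: sym (cl x) m + sym (cl y) m
}.

Lemma bider_op (b : symbol) u i j : linear (fun a => der (b (op i j a)) u).
Proof. by move=> c x y; apply: der_linear_symbol => m; exact: sym_op. Qed.

Lemma bider_cl (b : symbol) u : linear (fun x => der (b (cl x)) u).
Proof. by move=> c x y; apply: der_linear_symbol => m; exact: sym_cl. Qed.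

Definition pair_map (b : symbol) (v : Q) : letter_map Q :=
  @LetterMap Q (fun l => der (b l) v) (@bider_op b v) (@bider_cl b v).

Definition bider (b : symbol) (u v : Q) : Q := der (pair_map b v) u.

Lemma bider_ltl b l v : bider b (lt l) v = der (b l) v.
Proof. exact: der_lt. Qed.

Lemma bider_lt b l m : bider b (lt l) (lt m) = b l m.
Proof. by rewrite bider_ltl der_lt. Qed.

Lemma bider1l b v : bider b 1 v = 0.
Proof. exact: der1. Qed.

Lemma biderMl b u1 u2 v :
  bider b (u1 * u2) v = bider b u1 v * u2 + u1 * bider b u2 v.
Proof. exact: derM. Qed.

Lemma bider_linearl b v : linear (bider b ^~ v).
Proof. exact: linearP. Qed.

Lemma bider_linearr b u : linear (bider b u).
Proof.
by move=> c x y; apply: der_linear_symbol => l; rewrite /= linearP.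
Qed.

Lemma bider1r b u : bider b u 1 = 0.
Proof. by apply: der_eq0 => l /=; rewrite der1. Qed.

(** By construction [bider] is a derivation in its first argument only. Induction on [u] reduces the
    second one to the derivations [der (b l)]. *)
Lemma biderMr b u v1 v2 :
  bider b u (v1 * v2) = bider b u v1 * v2 + v1 * bider b u v2.
Proof.
elim/letter_ind: u => [c x y hx hy||l u ih].
- rewrite !bider_linearl hx hy !mulrDl !mulrDr -!scalerAl -!scalerAr scalerDr; ring.
- by rewrite !bider1l mul0r mulr0 addr0.
- rewrite !biderMl ih !bider_ltl derM; ring.
Qed.

Record sym_symbol := SymSymbol {
  ssym :> symbol;
  ssymC : forall l m, ssym l m = ssym m l
}.

Lemma der_ssym (b : sym_symbol) l u : der (b l) u = bider b u (lt l).
Proof.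
elim/letter_ind: u => [c x y hx hy||m u ih].
- by rewrite linearP bider_linearl /= hx hy.
- by rewrite der1 bider1l.
- by rewrite der_ltM biderMl ih bider_lt ssymC.
Qed.

Fixpoint op2_word (d : letter_map Q) (b : sym_symbol) (w : seq (letter A)) : Q :=
  if w is l :: w
  then d l * word w + der (b l) (word w) + lt l * op2_word d b w else 0.

Definition op2_map (d : letter_map Q) (b : sym_symbol) : word_map A Q.
Proof.
exists (op2_word d b) => [i j w c x y|w c x y|] /=.
- rewrite (lfun_op d) lt_op_linear !mulrDl -!scalerAl !scalerDr.
  rewrite bider_op; ring.
- rewrite (lfun_cl d) lt_cl_linear !mulrDl -!scalerAl !scalerDr.
  rewrite bider_cl; ring.
- apply: perm_invariant => [l s t st|l m s] /=.
    by move=> ->; rewrite (word_perm st).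
  (* Swapping the two letters turns the term [b l m] into [b m l]; here the symmetry of the symbol
     is needed. *)
  rewrite !word_cons !der_ltM (ssymC b l m); ring.
Defined.

(* The second-order differential operator with values d on letters and
   symbol b. *)
Definition op2 (d : letter_map Q) (b : sym_symbol) : Q -> Q :=
  word_lift (op2_map d b).
HB.instance Definition _ (d : letter_map Q) (b : sym_symbol) :=
  GRing.Linear.on (op2 d b).

Lemma op2_1 d b : op2 d b 1 = 0.
Proof. by rewrite -[1]/(word [::]) /op2 word_liftE. Qed.

Lemma op2_ltM d b l u :
  op2 d b (lt l * u) = d l * u + der (b l) u + lt l * op2 d b u.
Proof.
move: u; apply: word_ext => [||w].
- by move=> c x y; rewrite mulrDr -scalerAr linearP.
- move=> c x y; rewrite !linearP /= !mulrDr -!scalerAr !scalerDr; ring.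
- by rewrite -word_cons /op2 !word_liftE.
Qed.

Lemma op2_lt d b l : op2 d b (lt l) = d l.
Proof. by rewrite -[lt l]mulr1 op2_ltM op2_1 der1 mulr0 !addr0 mulr1. Qed.

(** The failure of a second-order operator to be a derivation is the biderivation of its symbol. *)
Lemma op2M d b u v :
  op2 d b (u * v) = op2 d b u * v + u * op2 d b v + bider b u v.
Proof.
elim/letter_ind: u => [c x y hx hy||l u ih].
- rewrite mulrDl -scalerAl bider_linearl !linearP /= hx hy.
  rewrite !mulrDl -!scalerAl !scalerDr; ring.
- by rewrite op2_1 bider1l !mul1r mul0r add0r addr0.
- rewrite -mulrA !op2_ltM ih derM biderMl bider_ltl; ring.
Qed.

Definition relabel_letter (f g : nat -> nat) (l : letter A) : letter A :=
  match l with
  | inl (i, j, a) => op (f i) (g j) a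
  | inr x => cl x
  end.

Definition relabel_map (f g : nat -> nat) : word_map A Q.
Proof.
exists (fun w => word (map (relabel_letter f g) w)) => [i j w|w|s t st] /=.
- exact: word_op.
- exact: word_cl.
- exact: word_perm (perm_map _ st).
Defined.

Definition relabel f g : Q -> Q := word_lift (relabel_map f g).
HB.instance Definition _ f g := GRing.Linear.on (relabel f g).

Lemma relabel1 f g : relabel f g 1 = 1.
Proof. by rewrite -[1]/(word [::]) /relabel word_liftE. Qed.

Lemma relabel_ltM f g l u :
  relabel f g (lt l * u) = lt (relabel_letter f g l) * relabel f g u.
Proof.
move: u; apply: word_ext => [||w].
- by move=> c x y; rewrite mulrDr -scalerAr linearP.
- by move=> c x y; rewrite linearP mulrDr -scalerAr.
- by rewrite -word_cons /relabel !word_liftE -word_cons.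
Qed.

Lemma relabel_lt f g l : relabel f g (lt l) = lt (relabel_letter f g l).
Proof. by rewrite -[lt l]mulr1 relabel_ltM relabel1 mulr1. Qed.

Lemma relabelM f g u v : relabel f g (u * v) = relabel f g u * relabel f g v.
Proof.
elim/letter_ind: u => [c x y hx hy||l u ih].
- by rewrite mulrDl -scalerAl !linearP /= hx hy mulrDl -scalerAl.
- by rewrite relabel1 !mul1r.
- by rewrite -mulrA !relabel_ltM ih mulrA.
Qed.

Lemma relabel_comp f g f' g' u :
  relabel f g (relabel f' g' u) = relabel (f \o f') (g \o g') u.
Proof.
elim/letter_ind: u => [c x y hx hy||l u ih].
- by rewrite !linearP /= hx hy.
- by rewrite !relabel1.
- by rewrite !relabel_ltM ih; case: l => [[[]]|].
Qed.

Lemma relabel_id u : relabel id id u = u.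
Proof.
elim/letter_ind: u => [c x y hx hy||l u ih].
- by rewrite linearP /= hx hy.
- by rewrite relabel1.
- by rewrite relabel_ltM ih; case: l => [[[]]|].
Qed.

Lemma eq_relabel f g f' g' u : f =1 f' -> g =1 g' ->
  relabel f g u = relabel f' g' u.
Proof. by move=> /funext -> /funext ->. Qed.

Lemma relabel_prod f g I (r : seq I) (P : pred I) (F : I -> Q) :
  relabel f g (\prod_(i <- r | P i) F i) = \prod_(i <- r | P i) relabel f g (F i).
Proof. exact: (big_morph _ (relabelM f g) (relabel1 f g)). Qed.

Lemma der_relabel (d d' : letter_map Q) f g u :
  (forall l, d (relabel_letter f g l) = relabel f g (d' l)) ->
  der d (relabel f g u) = relabel f g (der d' u).
Proof.
move=> dd'; elim/letter_ind: u => [c x y hx hy||l u ih].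
- by rewrite !linearP /= hx hy.
- by rewrite !(relabel1, der1) linear0.
- by rewrite !(relabel_ltM, der_ltM) ih dd' linearD /= !relabelM relabel_lt.
Qed.

Lemma op2_relabel (d d' : letter_map Q) (b b' : sym_symbol) f g u :
  (forall l, d (relabel_letter f g l) = relabel f g (d' l)) ->
  (forall l m, b (relabel_letter f g l) (relabel_letter f g m) =
               relabel f g (b' l m)) ->
  op2 d b (relabel f g u) = relabel f g (op2 d' b' u).
Proof.
move=> dd' bb'; elim/letter_ind: u => [c x y hx hy||l u ih].
- by rewrite !linearP /= hx hy.
- by rewrite !(relabel1, op2_1) linear0.
- rewrite !(relabel_ltM, op2_ltM) ih dd' !linearD /= !relabelM relabel_lt.
  by rewrite (der_relabel u (bb' l)).
Qed.

End Operators.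

(** * Contraction of letters *)

Section Contraction.
Variables (k : fieldType) (A : assoc_algebra k).
Local Notation Q := (letter_alg A).

Lemma amulDl c (a b x : A) : amul (c *: a + b) x = c *: amul a x + amul b x.
Proof. exact: (amul_bilinear A).1. Qed.
Lemma amulDr c (a b x : A) : amul x (c *: a + b) = c *: amul x a + amul x b.
Proof. exact: (amul_bilinear A).2. Qed.

Lemma cycproj_linear : linear (@cycproj k A).
Proof. exact: qproj_linear. Qed.

Lemma cycprojC (a b : A) : cycproj (amul a b) = cycproj (amul b a).
Proof. by apply: qproj_rel; exact: CommRel. Qed.

Lemma cycproj_surj (x : Acyc A) : exists a, x = cycproj a.
Proof. exact: quotmod_surj. Qed.

Definition self_contr_fun (j i : nat) (l : letter A) : Q :=
  match l with
  | inl (o, n, a) => (o == j)%:R * (n == i)%:R * lt (cl (cycproj a))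
  | inr _ => 0
  end.

Lemma self_contr_op j i o n : linear (fun a => self_contr_fun j i (op o n a)).
Proof.
by move=> c a b; rewrite /= cycproj_linear lt_cl_linear mulrDr -scalerAr.
Qed.

Lemma self_contr_cl j i : linear (fun x => self_contr_fun j i (cl x)).
Proof. by move=> c x y; rewrite scaler0 addr0. Qed.

Definition self_contr (j i : nat) : letter_map A Q :=
  LetterMap (self_contr_op j i) (self_contr_cl j i).

(* The letter with input i is followed by the letter with output j; their
   entries get multiplied. *)
Definition merge_fun (j i : nat) (l m : letter A) : Q :=
  match l, m with
  | inl (o, n, a), inl (o', n', a') =>
      (n == i)%:R * (o' == j)%:R * lt (op o n' (amul a a')) +
      (n' == i)%:R * (o == j)%:R * lt (op o' n (amul a' a))
  | _, _ => 0
  end.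

Lemma merge_funC (j i : nat) (l m : letter A) :
  merge_fun j i l m = merge_fun j i m l.
Proof.
by case: l m => [[[o n] a]|x] [[[o' n'] a']|x'] //=; rewrite addrC.
Qed.

Lemma merge_fun_op j i l o n : linear (fun a => merge_fun j i l (op o n a)).
Proof.
case: l => [[[o' n'] a]|x] c b b' /=; last by rewrite scaler0 addr0.
rewrite amulDr amulDl !lt_op_linear !mulrDr -!scalerAr scalerDr; ring.
Qed.

Lemma merge_fun_cl j i l : linear (fun x => merge_fun j i l (cl x)).
Proof. by case: l => [[[o n] a]|x] c y y' /=; rewrite scaler0 addr0. Qed.

Definition merge_map j i (l : letter A) : letter_map A Q :=
  LetterMap (merge_fun_op j i l) (merge_fun_cl j i l).

Lemma merge_map_op j i o n c x y m : merge_map j i (op o n (c *: x + y)) m =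
  c *: merge_map j i (op o n x) m + merge_map j i (op o n y) m.
Proof.
have C l : merge_map j i l m = merge_map j i m l by exact: merge_funC.
by rewrite !C; exact: (lfun_op (merge_map j i m)).
Qed.

Lemma merge_map_cl j i c x y m : merge_map j i (cl (c *: x + y)) m =
  c *: merge_map j i (cl x) m + merge_map j i (cl y) m.
Proof. by rewrite /= scaler0 addr0. Qed.

Definition merge_symbol j i : sym_symbol A :=
  @SymSymbol _ _ (Symbol (merge_map_op j i) (merge_map_cl j i))
    (merge_funC j i).

Lemma mergeE j i l m : merge_symbol j i l m = merge_fun j i l m.
Proof. by []. Qed.

Lemma merge_op j i o n a o' n' a' :
  merge_symbol j i (op o n a) (op o' n' a') =
  (n == i)%:R * (o' == j)%:R * lt (op o n' (amul a a')) +
  (n' == i)%:R * (o == j)%:R * lt (op o' n (amul a' a)).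
Proof. by []. Qed.

Lemma letter_case (P : letter A -> Prop) : (forall i j a, P (op i j a)) ->
  (forall x, P (cl x)) -> forall l, P l.
Proof. by move=> Po Pc [[[i j] a]|x]; [exact: Po | exact: Pc]. Qed.

Definition contr (j i : nat) : Q -> Q := op2 (self_contr j i) (merge_symbol j i).
HB.instance Definition _ j i := GRing.Linear.on (contr j i).

Lemma contr1 j i : contr j i 1 = 0. Proof. exact: op2_1. Qed.
Lemma contr_ltM j i l u : contr j i (lt l * u) =
  self_contr j i l * u + der (merge_symbol j i l) u + lt l * contr j i u.
Proof. exact: op2_ltM. Qed.
Lemma contr_lt j i l : contr j i (lt l) = self_contr j i l.
Proof. exact: op2_lt. Qed.
Lemma contr0 j i : contr j i 0 = 0. Proof. exact: linear0. Qed.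
Lemma contrD j i u v : contr j i (u + v) = contr j i u + contr j i v.
Proof. exact: linearD. Qed.
Lemma contrM j i u v : contr j i (u * v) =
  contr j i u * v + u * contr j i v + bider (merge_symbol j i) u v.
Proof. exact: op2M. Qed.

Lemma natr_linear (F : {linear Q -> Q}) n u : F (n%:R * u) = n%:R * F u.
Proof. by rewrite !mulr_natl raddfMn. Qed.

Lemma der_natr (d : letter_map A Q) n u : der d (n%:R * u) = n%:R * der d u.
Proof. exact: natr_linear. Qed.

Lemma contr_natr j i n u : contr j i (n%:R * u) = n%:R * contr j i u.
Proof. exact: natr_linear. Qed.

(** Lets [ring] prove an identity modulo two known equations, with cofactors [u] and [v]. *)
Lemma eq_combination (R : pzRingType) (p q x y x' y' u v : R) :
  x = y -> x' = y' -> p - q = (x - y) * u + v * (x' - y') -> p = q.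
Proof.
by move=> -> ->; rewrite !subrr mul0r mulr0 addr0 => /eqP;
  rewrite subr_eq0 => /eqP.
Qed.

Lemma relabel_natr f g n (u : Q) :
  relabel f g (n%:R * u) = n%:R * relabel f g u.
Proof. exact: natr_linear. Qed.

Section TwoContractions.
Variables j1 i1 j2 i2 : nat.
Local Notation b1 := (merge_symbol j1 i1).
Local Notation b2 := (merge_symbol j2 i2).

(* Both sides sum over the chains of three letters joined once at (j1, i1)
   and once at (j2, i2). *)
Lemma merge_assoc l m n :
  bider b1 (b2 l m) (lt n) + der (b1 m) (b2 l n) + der (b1 l) (b2 m n) =
  bider b2 (b1 l m) (lt n) + der (b2 m) (b1 l n) + der (b2 l) (b1 m n).
Proof.
have bid0 (b : symbol A) v : bider b 0 v = 0 by exact: linear0.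
have bidD (b : symbol A) u1 u2 v : bider b (u1 + u2) v = bider b u1 v + bider b u2 v.
  exact: linearD.
have bidN (b : symbol A) q u v : bider b (q%:R * u) v = q%:R * bider b u v.
  exact: natr_linear.
rewrite !mergeE.
case: l m n => [[[ol il] a]|x] [[[om im] b]|y] [[[on' in'] c]|z] /=;
  rewrite ?bid0 ?(linear0 (der _)) ?addr0 //.
all: rewrite ?bidD ?(linearD (der _)) /= -?mulrA.
all: rewrite ?bidN ?der_natr ?bider_lt ?der_lt ?mergeE /=.
all: rewrite ?mulr0 ?addr0 //.
rewrite !amulA; ring.
Qed.

(** The cross terms of the product rule agree on both sides, so the difference of the sides is a
    derivation in [u]; on letters it vanishes by [merge_assoc]. *)
Lemma merge_der_comm l m u :
  bider b1 (b2 l m) u + der (b1 m) (der (b2 l) u) + der (b1 l) (der (b2 m) u) =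
  bider b2 (b1 l m) u + der (b2 m) (der (b1 l) u) + der (b2 l) (der (b1 m) u).
Proof.
elim/letter_ind: u => [c x y hx hy||n u ih].
- rewrite !bider_linearr !linearP /=.
  have -> : forall p q r p' q' r' : Q, c *: p + p' + (c *: q + q') + (c *: r + r')
    = c *: (p + q + r) + (p' + q' + r') by move=> *; rewrite !scalerDr; ring.
  rewrite hx hy !scalerDr; ring.
- by rewrite !bider1r !der1 !linear0.
- rewrite !biderMr !der_ltM !derD !derM !der_lt.
  apply: (eq_combination (u := u) (v := lt n) (merge_assoc l m n) ih); ring.
Qed.

(** Multiplying [u] by a letter [m] leaves [merge_der_comm l m u] as the only new condition. *)
Lemma contr_der_comm l u :
  contr j1 i1 (der (b2 l) u) + der (b1 l) (contr j2 i2 u) =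
  contr j2 i2 (der (b1 l) u) + der (b2 l) (contr j1 i1 u).
Proof.
(* Two letters joined by both contractions close up to a loop, opened at two different places: the
   entries are $ab$ and $ba$, equal in $A_{\mathrm{cyc}}$. *)
have c12 m : contr j1 i1 (b2 l m) = contr j2 i2 (b1 l m).
  rewrite !mergeE.
  case: l m => [[[ol il] a]|x] [[[om im] b]|y] /=; rewrite ?linear0 //.
  rewrite !linearD /= -!mulrA !contr_natr !contr_lt /=.
  rewrite (cycprojC a b); ring.
(* A self-contraction produces a closed letter, and closed letters merge with nothing. *)
have dself j i j' i' m : der (merge_symbol j i l) (self_contr j' i' m) = 0.
  case: m => [[[om im] b]|y] /=; rewrite ?linear0 //.
  rewrite -!mulrA !der_natr der_lt mergeE.
  by case: l {c12} => [[[]]|]; rewrite /= !mulr0.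
elim/letter_ind: u => [c x y hx hy||m u ih].
- rewrite !linearP /=.
  have -> : forall p q p' q' : Q, c *: p + p' + (c *: q + q')
    = c *: (p + q) + (p' + q') by move=> *; rewrite !scalerDr; ring.
  rewrite hx hy !scalerDr; ring.
- by rewrite !der1 !contr1 !linear0.
- rewrite !der_ltM !contr_ltM !derD !contrD !contr_ltM !contrM !derM !dself !der_lt.
  rewrite c12.
  apply: (eq_combination (u := 1) (v := lt m) (merge_der_comm l m u) ih); ring.
Qed.

(** The commutator of two second-order operators, lowered in order one letter at a time: the
    remainders are [contr_der_comm], then [merge_der_comm], then [merge_assoc]. This is (W2) before
    renumbering. *)
Lemma contr_comm u :
  contr j1 i1 (contr j2 i2 u) = contr j2 i2 (contr j1 i1 u).
Proof.
have selfM j i j' i' l v :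
  contr j i (self_contr j' i' l * v) = self_contr j' i' l * contr j i v.
  case: l => [[[ol il] a]|x] /=; last by rewrite !mul0r linear0.
  rewrite -!mulrA !contr_natr contr_ltM /= mul0r add0r der_eq0 ?add0r //.
elim/letter_ind: u => [c x y hx hy||l u ih].
- by rewrite !linearP /= hx hy.
- by rewrite !contr1 !linear0.
- rewrite !contr_ltM !contrD !contr_ltM !selfM ih.
  apply: (eq_combination (u := 0) (v := 1) (erefl 0) (contr_der_comm l u)); ring.
Qed.
End TwoContractions.

Lemma contr_relabel f g j i u : injective f -> injective g ->
  contr (f j) (g i) (relabel f g u) = relabel f g (contr j i u).
Proof.
move=> fi gi; apply: op2_relabel => [l|l m].
- case: l => [[[o n] a]|x] /=; last by rewrite linear0.
  by rewrite -!mulrA !relabel_natr relabel_lt /= !inj_eq.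
- rewrite !mergeE.
  case: l m => [[[ol il] a]|x] [[[om im] b]|y] /=; rewrite ?linear0 //.
  by rewrite linearD /= -!mulrA !relabel_natr !relabel_lt /= !inj_eq.
Qed.

Lemma contr_relabel_at f g j i j' i' u : injective f -> injective g ->
  f j' = j -> g i' = i ->
  contr j i (relabel f g u) = relabel f g (contr j' i' u).
Proof. by move=> fi gi <- <-; exact: contr_relabel. Qed.

Section Avoid.
Variables (f g : nat -> nat) (j i : nat).
Hypotheses (fj : forall x, f x != j) (gi : forall x, g x != i).

(** That an element lacks the output [j] and the input [i] is expressed by its being in the image of
    a relabelling that misses them. In applications [f] and [g] fix the labels that do occur. Such
    an element behaves as a scalar for the contraction ([contr_mulr], [contr_mull]). *)
Lemma merge_relabel0 l m : merge_symbol j i l (relabel_letter f g m) = 0.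
Proof.
rewrite mergeE; case: l m => [[[ol il] a]|x] [[[om im] b]|y] //=.
by rewrite (negbTE (fj _)) (negbTE (gi _)) !mulr0 !mul0r addr0.
Qed.

Lemma bider_merge_relabel0 u v :
  bider (merge_symbol j i) u (relabel f g v) = 0.
Proof.
apply: der_eq0 => l /=; elim/letter_ind: v => [c x y hx hy||m v ih].
- by rewrite !linearP /= hx hy scaler0 addr0.
- by rewrite relabel1 der1.
- by rewrite relabel_ltM der_ltM ih merge_relabel0 mul0r mulr0 addr0.
Qed.

Lemma contr_relabel0 v : contr j i (relabel f g v) = 0.
Proof.
elim/letter_ind: v => [c x y hx hy||m v ih].
- by rewrite !linearP /= hx hy scaler0 addr0.
- by rewrite relabel1 contr1.
- rewrite relabel_ltM contr_ltM ih mulr0 addr0 -bider_ltl bider_merge_relabel0.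
  case: m => [[[o n] a]|x] /=; rewrite ?mul0r ?addr0 //.
  by rewrite (negbTE (fj _)) !mul0r.
Qed.

Lemma contr_mulr u v :
  contr j i (u * relabel f g v) = contr j i u * relabel f g v.
Proof.
by rewrite contrM contr_relabel0 bider_merge_relabel0 mulr0 !addr0.
Qed.

Lemma contr_mull u v :
  contr j i (relabel f g v * u) = relabel f g v * contr j i u.
Proof. by rewrite mulrC contr_mulr mulrC. Qed.
End Avoid.

End Contraction.

(** * Multilinear maps, permutations and concatenation on tensor powers *)

Section Tensors.
Variables (k : fieldType) (V : lmodType k).

Definition multilinear n (M : lmodType k) (f : n.-tuple V -> M) : Prop :=
  forall a i, linear (fun x => f (tset a i x)).

Section Lift.
Variables (n : nat) (M : lmodType k) (f : n.-tuple V -> M).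
Hypothesis fM : multilinear f.

Lemma tlift_linear : linear (tlift f).
Proof. by apply: (tliftP _).1 => a i c x y; exact: fM. Qed.

Lemma tliftE a : tlift f (pure a) = f a.
Proof. by apply: (tliftP _).2 => b i c x y; exact: fM. Qed.
End Lift.

Lemma pure_multilinear n : multilinear (@pure k V n).
Proof.
move=> a i c x y; rewrite [LHS]/pure /pgen (qproj_rel (TpowLin a i c x y)).
by rewrite qproj_linear.
Qed.

Lemma tpow_ind n (P : tpow V n -> Prop) : P 0 ->
  (forall c a u, P u -> P (c *: pure a + u)) -> forall u, P u.
Proof. exact: presented_ind. Qed.

Lemma tpow_ext n (M : lmodType k) (f g : tpow V n -> M) :
  linear f -> linear g -> (forall a, f (pure a) = g (pure a)) -> f =1 g.
Proof. exact: presented_ext. Qed.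

Lemma tlift_combination n (M : lmodType k) c (f f1 f2 : n.-tuple V -> M) t :
  multilinear f -> multilinear f1 -> multilinear f2 ->
  (forall a, f a = c *: f1 a + f2 a) ->
  tlift f t = c *: tlift f1 t + tlift f2 t.
Proof.
move=> hf h1 h2 E; move: t; apply: tpow_ext.
- exact: tlift_linear.
- by apply: linear_combination; exact: tlift_linear.
- by move=> a; rewrite !tliftE.
Qed.

Lemma tnth_tset n (a : n.-tuple V) i x j :
  tnth (tset a i x) j = if j == i then x else tnth a j.
Proof. by rewrite tnth_mktuple. Qed.

Lemma multilinear2 (M : lmodType k) (h : V -> V -> M) : bilinear_map h ->
  multilinear (fun t : 2.-tuple V => h (tnth t 0) (tnth t 1)).
Proof.
move=> [hl hr] a i c x y; rewrite !tnth_tset.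
by case: i => -[|[|[]]] // p /=; [exact: hl | exact: hr].
Qed.

Lemma pure2_bilinear : bilinear_map (fun x y => pure [tuple x; y] : tpow V 2).
Proof.
split=> [y|x].
- have E (x : V) : [tuple x; y] = tset [tuple 0; y] 0 x.
    by apply: eq_from_tnth => -[[|[|]] // p]; rewrite tnth_tset !(tnth_nth 0).
  move=> c u v; have := pure_multilinear [tuple 0; y] 0 c u v.
  by rewrite -!E.
- have E (y : V) : [tuple x; y] = tset [tuple x; 0] 1 y.
    by apply: eq_from_tnth => -[[|[|]] // p]; rewrite tnth_tset !(tnth_nth 0).
  move=> c u v; have := pure_multilinear [tuple x; 0] 1 c u v.
  by rewrite -!E.
Qed.

Lemma pure1_linear : linear (fun x => pure [tuple x] : tpow V 1).
Proof.
have E (x : V) : [tuple x] = tset [tuple 0] 0 x.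
  apply: eq_from_tnth => j; rewrite (ord1 j).
  by rewrite tnth_tset.
move=> c u v; have := pure_multilinear [tuple 0] 0 c u v.
  by rewrite -!E.
Qed.

Lemma tuple2E (t : 2.-tuple V) : t = [tuple tnth t 0; tnth t 1].
Proof.
by apply: eq_from_tnth => -[[|[|]] // p];
  rewrite !(tnth_nth 0).
Qed.

Lemma permute_tset n (s : 'S_n) a i x :
  permute_tuple s (tset a i x) = tset (permute_tuple s a) (s^-1%g i) x :> n.-tuple V.
Proof.
apply: eq_from_tnth => j; rewrite !(tnth_tset, tnth_mktuple).
by rewrite -(inj_eq (@perm_inj _ s) j) permKV.
Qed.

Lemma permute_multilinear n (s : 'S_n) :
  multilinear (fun a : n.-tuple V => pure (permute_tuple s^-1%g a)).
Proof. by move=> a i c x y; rewrite !permute_tset pure_multilinear. Qed.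

Lemma tensor_perm_linear n (s : 'S_n) : linear (@tensor_perm k V n s).
Proof. exact: tlift_linear (permute_multilinear s). Qed.

Lemma tensor_permE n (s : 'S_n) a :
  tensor_perm s (pure a) = pure (permute_tuple s^-1%g a) :> tpow V n.
Proof. exact: tliftE (permute_multilinear s) a. Qed.

Lemma tensor_perm1 n (t : tpow V n) : tensor_perm 1%g t = t.
Proof.
move: t; apply: tpow_ext => [||a]; [exact: tensor_perm_linear | by [] |].
rewrite tensor_permE; congr pure.
by apply: eq_from_tnth => j; rewrite tnth_mktuple invg1 perm1.
Qed.

Lemma catr_multilinear m n (a : m.-tuple V) :
  multilinear (fun b : n.-tuple V => pure [tuple of a ++ b]).
Proof.
move=> b i c x y.
have E (z : V) : [tuple of a ++ tset b i z] = tset [tuple of a ++ b] (rshift m i) z.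
  apply: eq_from_tnth => j; rewrite tnth_tset.
  case: (split_ordP j) => j' ->; rewrite ?tnth_lshift ?tnth_rshift.
    by rewrite eq_lrshift.
  by rewrite eq_rshift tnth_tset.
by rewrite !E pure_multilinear.
Qed.

Lemma catl_multilinear m n (b : n.-tuple V) :
  multilinear (fun a : m.-tuple V => pure [tuple of a ++ b]).
Proof.
move=> a i c x y.
have E (z : V) : [tuple of tset a i z ++ b] = tset [tuple of a ++ b] (lshift n i) z.
  apply: eq_from_tnth => j; rewrite tnth_tset.
  case: (split_ordP j) => j' ->; rewrite ?tnth_lshift ?tnth_rshift.
    by rewrite eq_lshift tnth_tset.
  by rewrite eq_rlshift.
by rewrite !E pure_multilinear.
Qed.

Lemma tcat_multilinear m n (y : tpow V n) :
  multilinear (fun a : m.-tuple V => tlift (fun b => pure [tuple of a ++ b]) y).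
Proof.
move=> a i c u v; apply: tlift_combination; try exact: catr_multilinear.
by move=> b; rewrite catl_multilinear.
Qed.

Lemma tcat_linearl m n (y : tpow V n) : linear (fun x : tpow V m => tcat x y).
Proof. exact: tlift_linear (tcat_multilinear y). Qed.

Lemma tcat_purel m n (a : m.-tuple V) (y : tpow V n) :
  tcat (pure a) y = tlift (fun b => pure [tuple of a ++ b]) y.
Proof. exact: tliftE (tcat_multilinear y) a. Qed.

Lemma tcat_linearr m n (x : tpow V m) : linear (@tcat k V m n x).
Proof.
move=> c u v; move: x; apply: tpow_ext => [||a].
- exact: tcat_linearl.
- by apply: linear_combination; exact: tcat_linearl.
- by rewrite !tcat_purel (tlift_linear (catr_multilinear a)).
Qed.

Lemma tcatE m n (a : m.-tuple V) (b : n.-tuple V) :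
  tcat (pure a) (pure b) = pure [tuple of a ++ b].
Proof. by rewrite tcat_purel (tliftE (catr_multilinear a)). Qed.

End Tensors.

(** * Tensors read as monomials in open letters *)

Section Monomials.
Variables (k : fieldType) (A : assoc_algebra k).
Local Notation Q := (letter_alg A).

Section Mono.
Variables (n : nat) (o i : 'I_n -> nat).

Lemma prod_multilinear :
  multilinear (fun a : n.-tuple A => \prod_x lt (op (o x) (i x) (tnth a x))).
Proof.
move=> a x c u v.
have E z : \prod_y lt (op (o y) (i y) (tnth (tset a x z) y)) =
    lt (op (o x) (i x) z) *
    \prod_(y | y != x) lt (op (o y) (i y) (tnth a y)).
  rewrite (bigD1 x) //= tnth_tset eqxx; congr (_ * _).
  by apply: eq_bigr => y yx; rewrite tnth_tset (negbTE yx).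
by rewrite !E lt_op_linear mulrDl -scalerAl.
Qed.

Definition mono : tpow A n -> Q :=
  tlift (fun a => \prod_x lt (op (o x) (i x) (tnth a x))).

Lemma mono_linear : linear mono.
Proof. exact: tlift_linear prod_multilinear. Qed.
HB.instance Definition _ := GRing.isLinear.Build k (tpow A n) Q _ mono mono_linear.

Lemma monoE a : mono (pure a) = \prod_x lt (op (o x) (i x) (tnth a x)).
Proof. exact: tliftE prod_multilinear a. Qed.
End Mono.

(** As letters commute, permuting the tensor factors amounts to permuting the labels attached to
    them. *)
Lemma mono_perm n (o i : 'I_n -> nat) (s : 'S_n) t :
  mono o i (tensor_perm s t) = mono (o \o s) (i \o s) t.
Proof.
move: t; apply: tpow_ext => [||a].
- by move=> c u v; rewrite tensor_perm_linear linearP.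
- exact: linearP.
rewrite tensor_permE !monoE (reindex_inj (@perm_inj _ s)) /=.
by apply: eq_bigr => x _; rewrite tnth_mktuple permK.
Qed.

Lemma eq_mono n (o i o' i' : 'I_n -> nat) t : o =1 o' -> i =1 i' ->
  mono o i t = mono o' i' t.
Proof. by move=> /funext -> /funext ->. Qed.

Lemma relabel_mono n (o i : 'I_n -> nat) f g t :
  relabel f g (mono o i t) = mono (f \o o) (g \o i) t.
Proof.
move: t; apply: tpow_ext => [||a].
- by move=> c u v; rewrite !linearP.
- exact: linearP.
- by rewrite !monoE relabel_prod; apply: eq_bigr => x _; rewrite relabel_lt.
Qed.

Definition mono2 o1 i1 o2 i2 : tpow A 2 -> Q :=
  mono (tnth [tuple o1; o2]) (tnth [tuple i1; i2]).

Lemma mono2E o1 i1 o2 i2 a : mono2 o1 i1 o2 i2 (pure a) =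
  lt (op o1 i1 (tnth a 0)) * lt (op o2 i2 (tnth a 1)).
Proof.
rewrite /mono2 monoE big_ord_recl big_ord1 /=.
congr (lt (op _ _ _) * lt (op _ _ (tnth _ _))); exact: val_inj.
Qed.

Lemma mono2_linear o1 i1 o2 i2 : linear (mono2 o1 i1 o2 i2).
Proof. exact: mono_linear. Qed.
HB.instance Definition _ o1 i1 o2 i2 :=
  GRing.isLinear.Build k (tpow A 2) Q _ (mono2 o1 i1 o2 i2)
    (mono2_linear o1 i1 o2 i2).

Lemma relabel_mono2 o1 i1 o2 i2 f g t :
  relabel f g (mono2 o1 i1 o2 i2 t) = mono2 (f o1) (g i1) (f o2) (g i2) t.
Proof.
by rewrite /mono2 relabel_mono; apply: eq_mono => -[[|[|]] // p];
  rewrite /= !(tnth_nth 0%N).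
Qed.

Lemma cyc2E (x : 'I_2) : cyc 2 0 1 x = if x == 0 then 1 else 0.
Proof. by apply: val_inj; rewrite /= cycE //; case: x => -[|[|[]]]. Qed.

Lemma cyc2V : ((cyc 2 0 1)^-1 = cyc 2 0 1)%g.
Proof.
apply/eqP; rewrite eq_invg_mul; apply/eqP/permP => x.
by rewrite perm1 permM !cyc2E; case: x => -[|[|[]]] // p; apply: val_inj.
Qed.

Lemma mono2_flip o1 i1 o2 i2 t :
  mono2 o1 i1 o2 i2 (tensor_perm (cyc 2 0 1) t) = mono2 o2 i2 o1 i1 t.
Proof.
rewrite /mono2 mono_perm; apply: eq_mono => x /=; rewrite cyc2E;
  by case: x => -[|[|[]]].
Qed.

Definition tmul : tpow A 2 -> A := tlift (fun t => amul (tnth t 0) (tnth t 1)).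
Lemma tmul_multilinear :
  multilinear (fun t : 2.-tuple A => amul (tnth t 0) (tnth t 1)).
Proof. by apply: multilinear2; exact: amul_bilinear. Qed.
Lemma tmul_linear : linear tmul.
Proof. exact: tlift_linear tmul_multilinear. Qed.
HB.instance Definition _ := GRing.isLinear.Build k (tpow A 2) A _ tmul tmul_linear.
Lemma tmulE a : tmul (pure a) = amul (tnth a 0) (tnth a 1).
Proof. exact: tliftE tmul_multilinear a. Qed.

(** The map $f\otimes g$. Both outer multiplications of the double bracket are instances by
    conversion, and so are the inner ones of [dbr_leibnizl]. *)
Definition tmap2 (f g : A -> A) : tpow A 2 -> tpow A 2 :=
  tlift (fun t => pure [tuple f (tnth t 0); g (tnth t 1)]).

Section Tmap2.
Variables (f g : A -> A).
Hypotheses (lf : linear f) (lg : linear g).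
Lemma tmap2_multilinear : multilinear (fun t : 2.-tuple A =>
  pure [tuple f (tnth t 0); g (tnth t 1)]).
Proof.
apply: (@multilinear2 _ _ _ (fun x y => pure [tuple f x; g y])).
split=> x; [exact: linear_compose ((pure2_bilinear _).1 _) lf|].
exact: (linear_compose ((pure2_bilinear _).2 (f x)) lg).
Qed.
Lemma tmap2_linear : linear (tmap2 f g).
Proof. exact: tlift_linear tmap2_multilinear. Qed.
Lemma tmap2E a : tmap2 f g (pure a) = pure [tuple f (tnth a 0); g (tnth a 1)].
Proof. exact: tliftE tmap2_multilinear a. Qed.
End Tmap2.

Lemma linear_id : linear (fun x : A => x). Proof. by []. Qed.
Lemma amull_linear (x : A) : linear (amul x).
Proof. by move=> c u v; rewrite amulDr. Qed.
Lemma amulr_linear (x : A) : linear (fun y => amul y x).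
Proof. by move=> c u v; rewrite /= amulDl. Qed.

End Monomials.

(** * The bracket of letters *)

Section Bracket.
Variables (k : fieldType) (A : assoc_algebra k).
Variable (D : {linear tpow A 2 -> tpow A 2}).
Hypothesis hD : is_double_bracket D.
Local Notation Q := (letter_alg A).
Local Notation flip := (tensor_perm (cyc 2 0 1)).

Lemma dbr_linearl b : linear (fun a => dbr D a b).
Proof.
move=> c u v; rewrite /dbr -linearP; congr (D _).
exact: (pure2_bilinear _).1.
Qed.

Lemma dbr_linearr a : linear (dbr D a).
Proof.
move=> c u v; rewrite /dbr -linearP; congr (D _).
exact: (pure2_bilinear _).2.
Qed.

Lemma flipE (a : 2.-tuple A) : flip (pure a) = pure [tuple tnth a 1; tnth a 0].
Proof.
rewrite tensor_permE cyc2V; congr pure.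
apply: eq_from_tnth => j; rewrite tnth_mktuple cyc2E.
by case: j => -[|[|[]]].
Qed.

Lemma flip_tmap2 (f g : A -> A) t : linear f -> linear g ->
  flip (tmap2 f g t) = tmap2 g f (flip t).
Proof.
move=> lf lg; move: t; apply: tpow_ext => [||a].
- exact: linear_compose (tensor_perm_linear _) (tmap2_linear lf lg).
- exact: linear_compose (tmap2_linear lg lf) (tensor_perm_linear _).
- by rewrite tmap2E // !flipE tmap2E.
Qed.

Lemma dbr_flip a b : flip (dbr D a b) = - dbr D b a.
Proof. by rewrite (dbr_antisym hD a b) opprK. Qed.

Lemma dbr_leibnizr a b c : dbr D a (amul b c) =
  tmap2 id (fun y => amul y c) (dbr D a b) + tmap2 (amul b) id (dbr D a c).
Proof. exact: dbr_leibniz hD a b c. Qed.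

(** Antisymmetry transports the rule for the second argument; the flip turns the outer
    multiplications into inner ones. *)
Lemma dbr_leibnizl a b c : dbr D (amul a b) c =
  tmap2 (fun y => amul y b) id (dbr D a c) + tmap2 id (amul a) (dbr D b c).
Proof.
have la := amull_linear a; have lb := amulr_linear b; have li := @linear_id k A.
rewrite -[LHS]opprK -dbr_flip dbr_leibnizr (linear_propD (tensor_perm_linear _)).
rewrite !flip_tmap2 // !dbr_flip opprD.
by rewrite !(linear_propN (tmap2_linear _ _)) // !opprK.
Qed.

Lemma dbr_mulE a b : dbr_mul D a b = tmul (dbr D a b).
Proof. by []. Qed.

Lemma dbr_mul_linearl b : linear (fun a => dbr_mul D a b).
Proof. exact: linear_compose (@tmul_linear k A) (dbr_linearl b). Qed.

Lemma dbr_mul_linearr a : linear (dbr_mul D a).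
Proof. exact: linear_compose (@tmul_linear k A) (dbr_linearr a). Qed.

Lemma tmul_tmap2 (f g f' g' h : A -> A) t :
  linear f -> linear g -> linear f' -> linear g' -> linear h ->
  (forall p q, amul (f p) (g q) = h (amul (f' p) (g' q))) ->
  tmul (tmap2 f g t) = h (tmul (tmap2 f' g' t)).
Proof.
move=> lf lg lf' lg' lh E; move: t; apply: tpow_ext => [||a].
- exact: linear_compose (@tmul_linear k A) (tmap2_linear lf lg).
- exact: linear_compose lh (linear_compose (@tmul_linear k A)
    (tmap2_linear lf' lg')).
- by rewrite !tmap2E // !tmulE; exact: E.
Qed.

Lemma tmap2_id (t : tpow A 2) : tmap2 id id t = t.
Proof.
move: t; apply: tpow_ext => [||a]; first exact: tmap2_linear.
  by [].
by rewrite tmap2E //; congr pure; rewrite [RHS]tuple2E.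
Qed.

Lemma dbr_mul_leibniz a b c :
  dbr_mul D a (amul b c) = amul (dbr_mul D a b) c + amul b (dbr_mul D a c).
Proof.
rewrite dbr_mulE dbr_leibnizr linearD /=; congr (_ + _).
- rewrite (tmul_tmap2 (f' := id) (g' := id) (h := fun y => amul y c)) ?tmap2_id //.
  + exact: amulr_linear.
  + exact: amulr_linear.
  + by move=> p q; rewrite amulA.
- rewrite (tmul_tmap2 (f' := id) (g' := id) (h := amul b)) ?tmap2_id //.
  + exact: amull_linear.
  + exact: amull_linear.
  + by move=> p q; rewrite amulA.
Qed.

(** By the inner Leibniz rule, $\{ab,c\}_A$ is the sum of the $pbq$ over $\{\!\{a,c\}\!\}=\sum
    p\otimes q$ and of the $paq$ over $\{\!\{b,c\}\!\}=\sum p\otimes q$, which is symmetric in $a$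
    and $b$. Hence $\{-,c\}_A$ descends to $A_{\mathrm{cyc}}$. *)
Lemma dbr_mul_comm a b c : dbr_mul D (amul a b) c = dbr_mul D (amul b a) c.
Proof.
rewrite !dbr_mulE !dbr_leibnizl !linearD /= [RHS]addrC; congr (_ + _).
- rewrite (tmul_tmap2 (f' := id) (g' := amul b) (h := id)) //.
  + exact: amulr_linear.
  + exact: amull_linear.
  + by move=> p q; rewrite amulA.
- rewrite (tmul_tmap2 (f' := fun y => amul y a) (g' := id) (h := id)) //.
  + exact: amull_linear.
  + exact: amulr_linear.
  + by move=> p q; rewrite amulA.
Qed.

(** Since $\pi(pq)=\pi(qp)$, the flip in the antisymmetry of the double bracket becomes
    invisible. *)
Lemma cycproj_dbr_mulC a b :
  cycproj (dbr_mul D a b) = - cycproj (dbr_mul D b a).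
Proof.
pose N := fun t : tpow A 2 => cycproj (tmul t).
have lN : linear N by exact: linear_compose (@cycproj_linear k A) (@tmul_linear k A).
have N_flip t : N (flip t) = N t.
  move: t; apply: tpow_ext => [||t] //.
  - exact: linear_compose lN (tensor_perm_linear _).
  - by rewrite /N flipE !tmulE cycprojC.
rewrite -[LHS]/(N _) -[X in - X]/(N _) -N_flip dbr_flip.
exact: linear_propN.
Qed.
End Bracket.

(** * The induced brackets on $A_{\mathrm{cyc}}$ and the biderivation on $Q$ *)

Section LetterBracket.
Variables (k : fieldType) (A : assoc_algebra k).
Variable (D : {linear tpow A 2 -> tpow A 2}).
Hypothesis hD : is_double_bracket D.
Local Notation Q := (letter_alg A).
Local Notation flip := (tensor_perm (cyc 2 0 1)).

Section Descend.
Variables (M : lmodType k) (f : A -> M).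
Hypotheses (lf : linear f) (fC : forall a b, f (amul a b) = f (amul b a)).

Let fL : {linear A -> M} :=
  HB.pack f (GRing.isLinear.Build k A M _ f lf).

Definition cyc_lift : Acyc A -> M := qlift f.

Lemma cyc_liftE a : cyc_lift (cycproj a) = f a.
Proof.
apply: (@qliftE _ _ _ _ fL) => r [b c].
by rewrite linearB /= fC subrr.
Qed.

Lemma cyc_lift_linear : linear cyc_lift.
Proof.
move=> c x y; have [[a ->] [b ->]] := (cycproj_surj x, cycproj_surj y).
by rewrite -cycproj_linear !cyc_liftE lf.
Qed.
End Descend.

(* {x, b}_A for x in A_cyc *)
Definition cyc_act (x : Acyc A) (b : A) : A := cyc_lift (fun a => dbr_mul D a b) x.

Lemma cyc_actE a b : cyc_act (cycproj a) b = dbr_mul D a b.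
Proof.
apply: (cyc_liftE (f := fun a => dbr_mul D a b)).
- exact: dbr_mul_linearl.
- by move=> c d; exact: dbr_mul_comm.
Qed.

Lemma cyc_act_linearl b : linear (fun x => cyc_act x b).
Proof.
apply: (cyc_lift_linear (f := fun a => dbr_mul D a b)).
- exact: dbr_mul_linearl.
- by move=> c d; exact: dbr_mul_comm.
Qed.

Lemma cyc_act_linearr x : linear (cyc_act x).
Proof.
have [a ->] := cycproj_surj x.
by move=> c u v; rewrite !cyc_actE dbr_mul_linearr.
Qed.

Lemma cyc_act_leibniz x a b :
  cyc_act x (amul a b) = amul (cyc_act x a) b + amul a (cyc_act x b).
Proof. by have [c ->] := cycproj_surj x; rewrite !cyc_actE dbr_mul_leibniz. Qed.

Definition cyc_bracket (x y : Acyc A) : Acyc A :=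
  cyc_lift (fun b => cycproj (cyc_act x b)) y.

Let cyc_act_comm x a b :
  cycproj (cyc_act x (amul a b)) = cycproj (cyc_act x (amul b a)).
Proof.
rewrite !cyc_act_leibniz !(linear_propD (@cycproj_linear k A)) addrC.
by congr (_ + _); rewrite cycprojC.
Qed.

Lemma cyc_bracketE x b : cyc_bracket x (cycproj b) = cycproj (cyc_act x b).
Proof.
apply: (cyc_liftE (f := fun b => cycproj (cyc_act x b))) => //.
exact: linear_compose (@cycproj_linear k A) (cyc_act_linearr x).
Qed.

Lemma cyc_bracket_linearr x : linear (cyc_bracket x).
Proof.
apply: (cyc_lift_linear (f := fun b => cycproj (cyc_act x b))) => //.
exact: linear_compose (@cycproj_linear k A) (cyc_act_linearr x).
Qed.

Lemma cyc_bracketC x y : cyc_bracket x y = - cyc_bracket y x.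
Proof.
have [[a ->] [b ->]] := (cycproj_surj x, cycproj_surj y).
by rewrite !cyc_bracketE !cyc_actE cycproj_dbr_mulC.
Qed.

(* On open letters this is Van den Bergh's formula
   {a_ij, b_pq} = {{a, b}}'_pj {{a, b}}''_iq. *)
Definition pbr_fun (l m : letter A) : Q :=
  match l, m with
  | inl (i, j, a), inl (p, q, b) => mono2 p j i q (dbr D a b)
  | inl (i, j, a), inr y => - lt (op i j (cyc_act y a))
  | inr x, inl (p, q, b) => lt (op p q (cyc_act x b))
  | inr x, inr y => lt (cl (cyc_bracket x y))
  end.

Lemma pbr_op_op i j a p q b :
  pbr_fun (op i j a) (op p q b) = mono2 p j i q (dbr D a b).
Proof. by []. Qed.
Lemma pbr_op_cl i j a y : pbr_fun (op i j a) (cl y) = - lt (op i j (cyc_act y a)).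
Proof. by []. Qed.
Lemma pbr_cl_op x p q b : pbr_fun (cl x) (op p q b) = lt (op p q (cyc_act x b)).
Proof. by []. Qed.

Lemma pbr_cl_cl x y : pbr_fun (cl x) (cl y) = lt (cl (cyc_bracket x y)).
Proof. by []. Qed.

Lemma pbr_funC l m : pbr_fun l m = - pbr_fun m l.
Proof.
case: l m => [[[i j] a]|x] [[[p q] b]|y] //=; rewrite ?opprK //.
- have -> : dbr D b a = - flip (dbr D a b) by rewrite dbr_flip // opprK.
  by rewrite (linear_propN (mono2_linear _ _ _ _)) opprK mono2_flip.
- rewrite cyc_bracketC; exact: (linear_propN (@lt_cl_linear k A)).
Qed.

Lemma pbr_fun_op l i j : linear (fun a => pbr_fun l (op i j a)).
Proof.
case: l => [[[p q] a]|x] c u v /=.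
- by rewrite dbr_linearr linearP.
- by rewrite cyc_act_linearr lt_op_linear.
Qed.

Lemma pbr_fun_cl l : linear (fun x => pbr_fun l (cl x)).
Proof.
case: l => [[[p q] a]|x] c u v /=.
- by rewrite cyc_act_linearl lt_op_linear opprD scalerN.
- by rewrite cyc_bracket_linearr lt_cl_linear.
Qed.

Definition pbr_map (l : letter A) : letter_map A Q :=
  LetterMap (pbr_fun_op l) (pbr_fun_cl l).

Lemma pbr_map_op i j c x y m : pbr_map (op i j (c *: x + y)) m =
  c *: pbr_map (op i j x) m + pbr_map (op i j y) m.
Proof.
have C l : pbr_map l m = - pbr_map m l by exact: pbr_funC.
by rewrite !C (lfun_op (pbr_map m)) opprD scalerN.
Qed.

Lemma pbr_map_cl c x y m : pbr_map (cl (c *: x + y)) m =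
  c *: pbr_map (cl x) m + pbr_map (cl y) m.
Proof.
have C l : pbr_map l m = - pbr_map m l by exact: pbr_funC.
by rewrite !C (lfun_cl (pbr_map m)) opprD scalerN.
Qed.

Definition pbr_symbol : symbol A := Symbol pbr_map_op pbr_map_cl.
Local Notation B := pbr_symbol.

Definition pbr : Q -> Q -> Q := bider B.

Lemma pbr_linearl v : linear (pbr ^~ v).
Proof. exact: bider_linearl. Qed.
Lemma pbr_linearr u : linear (pbr u).
Proof. exact: bider_linearr. Qed.
Lemma pbrMl u1 u2 v : pbr (u1 * u2) v = pbr u1 v * u2 + u1 * pbr u2 v.
Proof. exact: biderMl. Qed.
Lemma pbrMr u v1 v2 : pbr u (v1 * v2) = pbr u v1 * v2 + v1 * pbr u v2.
Proof. exact: biderMr. Qed.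
Lemma pbr1l v : pbr 1 v = 0. Proof. exact: bider1l. Qed.
Lemma pbr1r v : pbr v 1 = 0. Proof. exact: bider1r. Qed.
Lemma pbr_lt l m : pbr (lt l) (lt m) = pbr_fun l m.
Proof. exact: bider_lt. Qed.

Lemma pbrC u v : pbr u v = - pbr v u.
Proof.
elim/letter_ind: u => [c x y hx hy||l u ih].
- by rewrite pbr_linearl pbr_linearr hx hy opprD scalerN.
- by rewrite pbr1l pbr1r oppr0.
- suff e : pbr (lt l) v = - pbr v (lt l) by rewrite pbrMl pbrMr ih e; ring.
  elim/letter_ind: v {ih} => [c x y hx hy||m v ih].
  + by rewrite pbr_linearl pbr_linearr hx hy opprD scalerN.
  + by rewrite pbr1l pbr1r oppr0.
  + by rewrite pbrMl pbrMr ih !pbr_lt pbr_funC mulNr mulrN opprD.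
Qed.

Lemma relabel_pbr_fun f g l m :
  relabel f g (pbr_fun l m) =
  pbr_fun (relabel_letter f g l) (relabel_letter f g m).
Proof.
case: l m => [[[i j] a]|x] [[[p q] b]|y] /=.
- by rewrite relabel_mono2.
- by rewrite linearN /= relabel_lt.
- by rewrite relabel_lt.
- by rewrite relabel_lt.
Qed.

(** No injectivity is required, unlike for [contr_relabel]: the bracket redistributes labels but
    never compares them. *)
Lemma relabel_pbr f g u v :
  relabel f g (pbr u v) = pbr (relabel f g u) (relabel f g v).
Proof.
rewrite /pbr /bider -(der_relabel (d := pair_map B (relabel f g v)) u) // => l /=.
by rewrite (der_relabel (d' := pbr_map l)) // => m; rewrite relabel_pbr_fun.
Qed.

End LetterBracket.

(** * Compatibility of the bracket with contractions *)

Section BracketContraction.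
Variables (k : fieldType) (A : assoc_algebra k).
Variable (D : {linear tpow A 2 -> tpow A 2}).
Hypothesis hD : is_double_bracket D.
Local Notation Q := (letter_alg A).
Local Notation pbr := (pbr hD).

(** In the bracket of two open letters, [o1] and [i2] are the labels of the second one, here assumed
    to avoid [j] and [i]. Only the labels of the first letter can then be joined to the new one,
    whose entry multiplies an inner side of the tensor, as in [dbr_leibnizl]. *)
Lemma merge_mono2 j i o1 i1 o2 i2 o n (a : A) t : o1 != j -> i2 != i ->
  bider (merge_symbol A j i) (mono2 o1 i1 o2 i2 t) (lt (op o n a)) =
  (i1 == i)%:R * (o == j)%:R *
    mono2 o1 n o2 i2 (tmap2 (fun x => amul x a) id t) +
  (n == i)%:R * (o2 == j)%:R *
    mono2 o1 i1 o i2 (tmap2 id (amul a) t).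
Proof.
move=> /negbTE o1j /negbTE i2i.
have la := amull_linear a; have ra := amulr_linear a; have li := @linear_id k A.
move: t; apply: tpow_ext => [||t].
- exact: linear_compose (bider_linearl _ _) (mono2_linear _ _ _ _).
- by apply: linear_add; apply: linear_mul;
    apply: (linear_compose (mono2_linear _ _ _ _)); exact: tmap2_linear.
rewrite !tmap2E // !mono2E biderMl !bider_lt !mergeE /= o1j i2i /=; ring.
Qed.

Lemma contr_mono2 j i o1 i1 o2 i2 (t : tpow A 2) : o1 != j -> i2 != i ->
  contr j i (mono2 o1 i1 o2 i2 t) =
  (i1 == i)%:R * (o2 == j)%:R * lt (op o1 i2 (tmul t)).
Proof.
move=> /negbTE o1j /negbTE i2i; move: t; apply: tpow_ext => [||t].
- exact: linear_compose (@linearP _ _ _ _ (contr j i)) (mono2_linear _ _ _ _).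
- apply: linear_mul.
  exact: linear_compose (@lt_op_linear _ _ _ _) (@tmul_linear k A).
by rewrite mono2E contrM !contr_lt bider_lt mergeE /= o1j i2i tmulE /=; ring.
Qed.

Lemma pbr_natr n u v : pbr (n%:R * u) v = n%:R * pbr u v.
Proof. by rewrite !mulr_natl; exact: raddfMn. Qed.

Section Avoiding.
Variables (f g : nat -> nat) (j i : nat).
Hypotheses (fj : forall x, f x != j) (gi : forall x, g x != i).
Local Notation b := (merge_symbol A j i).
Local Notation R := (relabel_letter f g).

(** This forces the bracket on closed letters: an open letter closed on itself is $\pi(a)$, and the
    same closure in Van den Bergh's formula multiplies the two factors of $\{\!\{a,c\}\!\}$, giving
    $\{a,c\}_A$. *)
Lemma contr_pbr_fun l m :
  contr j i (pbr_fun D l (R m)) = pbr (self_contr A j i l) (lt (R m)).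
Proof.
case: m => [[[p q] c]|y]; case: l => [[[o n] a]|x] /=.
- rewrite contr_mono2 // -!mulrA !pbr_natr pbr_lt /= (cyc_actE hD) dbr_mulE; ring.
- rewrite (linear_prop0 (pbr_linearl _ _)) contr_lt /= (negbTE (fj _)).
  by rewrite !mul0r.
- rewrite linearN /= contr_lt /= -!mulrA !pbr_natr pbr_lt /= (cyc_bracketC hD).
  have [d ->] := cycproj_surj y.
  rewrite (cyc_bracketE hD) (linear_propN (@lt_cl_linear k A)); ring.
- by rewrite (linear_prop0 (pbr_linearl _ _)) contr_lt.
Qed.

(** For three open letters this is the Leibniz rule in the first argument of the double bracket; for
    [m] closed it is the Leibniz rule of [cyc_act]. If [l] or [n] is closed, every term vanishes. *)
Lemma merge_pbr_fun l m n :
  bider b (pbr_fun D l (R m)) (lt n) + der (b l) (pbr_fun D n (R m)) =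
  pbr (b l n) (lt (R m)).
Proof.
have merge0 l' m' : b l' (R m') = 0 by exact: merge_relabel0.
have mergecl x l' : b (cl x) l' = 0 by elim/letter_case: l'.
have pbr0 v : pbr 0 v = 0 by exact: (linear_prop0 (pbr_linearl _ _)).
have dercl x u : der (b (cl x)) u = 0 by exact: der_eq0.
have derpbr x l' : der (b l') (pbr_fun D (cl x) (R m)) = 0.
  elim/letter_case: m => [p q c|y].
    by rewrite pbr_cl_op der_lt; exact: (merge0 _ (op p q _)).
  by rewrite pbr_cl_cl der_lt ssymC.
elim/letter_case: l => [o e a|x]; last first.
  by rewrite -der_ssym derpbr dercl mergecl pbr0 addr0.
elim/letter_case: n => [o' e' a'|x]; last first.
  by rewrite -der_ssym derpbr dercl ssymC mergecl pbr0 addr0.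
rewrite der_ssym merge_op (linear_propD (pbr_linearl _ _)) -!mulrA !pbr_natr.
elim/letter_case: m {derpbr} => [p q c|y].
- rewrite [R _]/= !pbr_lt !pbr_op_op !merge_mono2 // !dbr_leibnizl //.
  rewrite !linearD /= -?mulrA; ring.
- rewrite [R _]/= !pbr_lt !pbr_op_cl !(linear_propN (bider_linearl _ _)).
  rewrite !bider_lt !merge_op !(cyc_act_leibniz hD).
  rewrite !(linear_propD (@lt_op_linear k A _ _)); ring.
Qed.

Lemma merge_pbr l m u :
  bider b (pbr_fun D l (R m)) u + der (b l) (pbr u (lt (R m))) =
  pbr (der (b l) u) (lt (R m)).
Proof.
elim/letter_ind: u => [c x y hx hy||n u ih].
- rewrite bider_linearr !pbr_linearl !linearP pbr_linearl -hx -hy /= !scalerDr; ring.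
- by rewrite der1 pbr1l (linear_prop0 (pbr_linearl _ _)) der0 bider1r addr0.
- rewrite biderMr pbrMl !der_ltM !derD !derM der_lt pbr_lt.
  rewrite (linear_propD (pbr_linearl _ _)) !pbrMl -ih pbr_lt -merge_pbr_fun.
  ring.
Qed.

Lemma contr_pbr_lt m u :
  contr j i (pbr u (lt (R m))) = pbr (contr j i u) (lt (R m)).
Proof.
elim/letter_ind: u => [c x y hx hy||l u ih].
- by rewrite pbr_linearl !linearP /= pbr_linearl hx hy.
- by rewrite pbr1l !(contr1, contr0) (linear_prop0 (pbr_linearl _ _)).
- rewrite pbrMl contrD contrM !contr_ltM !(linear_propD (pbr_linearl _ _)).
  rewrite !pbrMl ih pbr_lt contr_pbr_fun -merge_pbr; ring.
Qed.

(** The letters of [relabel f g v] avoid the contracted labels, so they can be split off one by one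
    as scalars; a single letter is [contr_pbr_lt]. *)
Lemma contr_pbrr u v :
  contr j i (pbr u (relabel f g v)) = pbr (contr j i u) (relabel f g v).
Proof.
elim/letter_ind: v u => [c x y hx hy||m v ih] u.
- by rewrite [relabel _ _ _]linearP /= !pbr_linearr linearP /= hx hy.
- by rewrite relabel1 !pbr1r contr0.
- by rewrite relabel_ltM !pbrMr contrD -relabel_lt contr_mulr // contr_mull //
    relabel_lt contr_pbr_lt ih.
Qed.

Lemma contr_pbrl u v :
  contr j i (pbr (relabel f g v) u) = pbr (relabel f g v) (contr j i u).
Proof.
by rewrite pbrC [RHS]pbrC -contr_pbrr; exact: linearN.
Qed.
End Avoiding.
End BracketContraction.

(** * The Jacobi identity on $Q$ *)

Section Jacobi.
Variables (k : fieldType) (A : assoc_algebra k).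
Variable (D : {linear tpow A 2 -> tpow A 2}).
Hypothesis hDP : is_double_poisson D.
Let hD : is_double_bracket D := hDP.1.
Local Notation Q := (letter_alg A).
Local Notation pbr := (pbr hD).
Local Notation flip := (tensor_perm (cyc 2 0 1)).

Lemma multilinear3 (M : lmodType k) (h : A -> A -> A -> M) :
  (forall y z, linear (fun x => h x y z)) ->
  (forall x z, linear (fun y => h x y z)) -> (forall x y, linear (h x y)) ->
  multilinear (fun t : 3.-tuple A => h (tnth t 0) (tnth t 1) (tnth t (inord 2))).
Proof.
move=> h1 h2 h3 a i c x y; rewrite !tnth_tset.
have e2 : inord 2 = Ordinal (isT : 2 < 3)%N by apply: val_inj; rewrite /= inordK.
rewrite e2; case: i => -[|[|[|[]]]] // p /=;
  [exact: h1 | exact: h2 | exact: h3].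
Qed.

Lemma ord3_2 : 2 = inord 2 :> 'I_3.
Proof. by apply: val_inj; rewrite /= inordK. Qed.

Lemma id_dbrE a b c :
  id_dbr D (pure [tuple a; b; c]) = tcat (pure [tuple a]) (dbr D b c).
Proof.
rewrite /id_dbr ord3_2 tliftE.
  by rewrite -ord3_2 !(tnth_nth 0).
apply: (@multilinear3 _ (fun x y z => tcat (pure [tuple x]) (dbr D y z))).
- move=> y z; exact: linear_compose (tcat_linearl _) (@pure1_linear _ _).
- move=> x z; exact: linear_compose (tcat_linearr _) (dbr_linearl _ _).
- move=> x y; exact: linear_compose (tcat_linearr _) (dbr_linearr _ _).
Qed.

Let dbr_id_multilinear : multilinear (fun a : 3.-tuple A =>
  tcat (dbr D (tnth a 0) (tnth a 1)) (pure [tuple tnth a 2])).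
Proof.
rewrite ord3_2.
apply: (@multilinear3 _ (fun x y z => tcat (dbr D x y) (pure [tuple z]))).
- move=> y z; exact: linear_compose (tcat_linearl _) (dbr_linearl _ _).
- move=> x z; exact: linear_compose (tcat_linearl _) (dbr_linearr _ _).
- move=> x y; exact: linear_compose (tcat_linearr _) (@pure1_linear _ _).
Qed.

Let dbr_id_linear : linear (dbr_id D).
Proof. exact: tlift_linear dbr_id_multilinear. Qed.

(** Van den Bergh's left extension $\{\!\{a,b\otimes c\}\!\}_L=\{\!\{a,b\}\!\}\otimes c$. *)
Definition dbr_left (a : A) : tpow A 2 -> tpow A 3 :=
  tlift (fun t => tcat (dbr D a (tnth t 0)) (pure [tuple tnth t 1])).

Lemma dbr_left_multilinear a : multilinear (fun t : 2.-tuple A =>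
  tcat (dbr D a (tnth t 0)) (pure [tuple tnth t 1])).
Proof.
apply: (@multilinear2 _ _ _ (fun x y => tcat (dbr D a x) (pure [tuple y]))).
split=> x; first exact: linear_compose (tcat_linearl _) (dbr_linearr _ _).
exact: linear_compose (tcat_linearr _) (@pure1_linear _ _).
Qed.
Lemma dbr_left_linear a : linear (dbr_left a).
Proof. exact: tlift_linear (dbr_left_multilinear a). Qed.
Lemma dbr_leftE a t : dbr_left a (pure t) =
  tcat (dbr D a (tnth t 0)) (pure [tuple tnth t 1]).
Proof. exact: tliftE (dbr_left_multilinear a) t. Qed.

Lemma dbr_id_tcat a t : dbr_id D (tcat (pure [tuple a]) t) = dbr_left a t.
Proof.
move: t; apply: tpow_ext => [||t].
- have L : linear (fun t : tpow A 2 => tcat (pure [tuple a]) t : tpow A 3).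
    exact: (@tcat_linearr _ _ 1 2).
  exact: (linear_compose dbr_id_linear L).
- exact: dbr_left_linear.
rewrite tcatE /dbr_id (tliftE dbr_id_multilinear) dbr_leftE.
by rewrite !(tnth_nth 0).
Qed.

Definition mono3 o1 i1 o2 i2 o3 i3 : tpow A 3 -> Q :=
  mono (tnth [tuple o1; o2; o3]) (tnth [tuple i1; i2; i3]).

Lemma mono3_linear o1 i1 o2 i2 o3 i3 : linear (mono3 o1 i1 o2 i2 o3 i3).
Proof. exact: mono_linear. Qed.

Lemma mono3_tcat o1 i1 o2 i2 o3 i3 (t : tpow A 2) (a : A) :
  mono3 o1 i1 o2 i2 o3 i3 (tcat t (pure [tuple a])) =
  mono2 o1 i1 o2 i2 t * lt (op o3 i3 a).
Proof.
move: t; apply: tpow_ext => [||t].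
- have L : linear (fun t : tpow A 2 => tcat t (pure [tuple a]) : tpow A 3).
    exact: (@tcat_linearl _ _ 2 1).
  exact: (linear_compose (mono3_linear _ _ _ _ _ _) L).
- by move=> c u v; rewrite linearP mulrDl -scalerAl.
rewrite tcatE mono2E /mono3 monoE !big_ord_recl big_ord0 mulr1 mulrA.
by rewrite !(tnth_nth 0%N) !(tnth_nth (0 : A)) [t]tuple2E.
Qed.

(** The bracket hits either letter of the monomial. As [dbr_left] acts on the first tensor factor
    only, the second case passes through the flip. *)
Lemma pbr_mono2 i j a o1 i1 o2 i2 t :
  pbr (lt (op i j a)) (mono2 o1 i1 o2 i2 t) =
  mono3 o1 j i i1 o2 i2 (dbr_left a t) +
  mono3 o2 j i i2 o1 i1 (dbr_left a (flip t)).
Proof.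
move: t; apply: tpow_ext => [||t].
- exact: linear_compose (pbr_linearr _ _) (mono2_linear _ _ _ _).
- apply: linear_add.
    exact: linear_compose (mono3_linear _ _ _ _ _ _) (dbr_left_linear a).
  exact: linear_compose (mono3_linear _ _ _ _ _ _)
    (linear_compose (dbr_left_linear a) (tensor_perm_linear _)).
rewrite mono2E pbrMr !pbr_lt !pbr_op_op flipE !dbr_leftE !mono3_tcat.
by rewrite [X in _ + X]mulrC.
Qed.

Definition dbr3 a b c := dbr_left a (dbr D b c).

Lemma pbr_op3 i j a o1 i1 b o2 i2 c :
  pbr (lt (op i j a)) (pbr (lt (op o1 i1 b)) (lt (op o2 i2 c))) =
  mono3 o2 j i i1 o1 i2 (dbr3 a b c) - mono3 o1 j i i2 o2 i1 (dbr3 a c b).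
Proof.
rewrite [pbr (lt (op o1 i1 b)) _]pbr_lt pbr_op_op pbr_mono2 dbr_flip //.
rewrite (linear_propN (dbr_left_linear a)).
by rewrite (linear_propN (mono3_linear _ _ _ _ _ _)).
Qed.

Let r : 'S_3 := cyc 3 0 2.

Lemma cyc3E (x : 'I_3) : r x = if x == 0 then 1 else if x == 1 then 2 else 0.
Proof. by apply: val_inj; rewrite /= cycE //; case: x => -[|[|[|[]]]]. Qed.

Lemma cyc3_rel : (r * r * r = 1)%g.
Proof.
apply/permP => x; rewrite !permM perm1 !cyc3E.
by case: x => -[|[|[|[]]]] // p; apply: val_inj.
Qed.

Lemma big_cyc3 (M : nmodType) (F : 'S_3 -> M) :
  \sum_(s in <[r]>%g) F s = F 1%g + F r + F (r * r)%g.
Proof.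
have r1 : r != 1%g.
  by apply/eqP => /permP /(_ 0); rewrite cyc3E perm1.
have rr1 : (r * r)%g != 1%g.
  by apply/eqP => /permP /(_ 0); rewrite permM !cyc3E perm1.
have rrr : (r * r)%g != r by rewrite -[X in _ != X]mulg1 (inj_eq (mulgI r)).
have -> : <[r]>%g = 1%g |: (r |: [set (r * r)%g]).
  apply/setP => x; rewrite !inE; apply/idP/idP.
    have r3 : (r ^+ 3 = 1)%g by rewrite !expgS expg0 mulg1 mulgA cyc3_rel.
    case/cycleP => m ->; rewrite -(expg_mod m r3).
    have := ltn_pmod m (isT : 0 < 3)%N; case: (m %% 3)%N => [|[|[|]]] // _.
    - by rewrite expg0 eqxx.
    - by rewrite expg1 eqxx orbT.
    - by rewrite !expgS expg0 mulg1 eqxx !orbT.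
  case/or3P => /eqP ->; rewrite ?group1 ?cycle_id //.
  by rewrite groupM ?cycle_id.
have n1 : 1%g \notin r |: [set (r * r)%g].
  by rewrite !inE negb_or ![1%g == _]eq_sym r1 rr1.
have n2 : r \notin [set (r * r)%g] by rewrite inE eq_sym.
by rewrite (big_setU1 _ n1) (big_setU1 _ n2) big_set1 /= addrA.
Qed.

Lemma double_jacobi a b c :
  dbr3 a b c + tensor_perm r (dbr3 b c a) + tensor_perm (r * r)%g (dbr3 c a b) = 0.
Proof.
have := hDP.2 (pure [tuple a; b; c]); rewrite -/r big_cyc3.
rewrite invg1 !tensor_perm1 !tensor_permE !invgK.
have -> : permute_tuple r [tuple a; b; c] = [tuple b; c; a].
  apply: eq_from_tnth => j; rewrite tnth_mktuple cyc3E !(tnth_nth (0 : A)).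
  by case: j => -[|[|[|[]]]].
have -> : permute_tuple (r * r)%g [tuple a; b; c] = [tuple c; a; b].
  apply: eq_from_tnth => j.
  rewrite tnth_mktuple permM !cyc3E !(tnth_nth (0 : A)).
  by case: j => -[|[|[|[]]]].
by rewrite !id_dbrE !dbr_id_tcat.
Qed.

Lemma mono3_cyc o1 i1 o2 i2 o3 i3 t :
  mono3 o1 i1 o2 i2 o3 i3 (tensor_perm r t) = mono3 o2 i2 o3 i3 o1 i1 t.
Proof.
rewrite /mono3 mono_perm; apply: eq_mono => x /=; rewrite cyc3E;
  by case: x => -[|[|[|[]]]].
Qed.

Lemma mono3_jacobi o1 i1 o2 i2 o3 i3 a b c :
  mono3 o1 i1 o2 i2 o3 i3 (dbr3 a b c) + mono3 o2 i2 o3 i3 o1 i1 (dbr3 b c a) +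
  mono3 o3 i3 o1 i1 o2 i2 (dbr3 c a b) = 0.
Proof.
have E (t : tpow A 3) : tensor_perm r (tensor_perm r t) = tensor_perm (r * r)%g t.
  move: t; apply: tpow_ext => [||t].
  - exact: linear_compose (tensor_perm_linear _) (tensor_perm_linear _).
  - exact: tensor_perm_linear.
  - rewrite !tensor_permE; congr pure; apply: eq_from_tnth => j.
    by rewrite !tnth_mktuple invMg permM.
have L := mono3_linear o1 i1 o2 i2 o3 i3.
have := congr1 (mono3 o1 i1 o2 i2 o3 i3) (double_jacobi a b c).
by rewrite (linear_prop0 L) !(linear_propD L) -E !mono3_cyc.
Qed.

Definition jacobiator u v w := pbr u (pbr v w) + pbr v (pbr w u) + pbr w (pbr u v).

Lemma jacobiatorC u v w : jacobiator u v w = jacobiator v w u.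
Proof. by rewrite /jacobiator -addrA addrC. Qed.

(** Of the six terms given by [pbr_op3], the three with the cyclic order $a,b,c$ and the three with
    the order $a,c,b$ cancel separately, each by one double Jacobi identity. The cofactor $-1$ is
    the sign of the antisymmetry in [pbr_op3]. *)
Lemma jacobi_op i1 j1 a i2 j2 b i3 j3 c :
  jacobiator (lt (op i1 j1 a)) (lt (op i2 j2 b)) (lt (op i3 j3 c)) = 0.
Proof.
rewrite /jacobiator !pbr_op3.
have h1 := mono3_jacobi i3 j1 i1 j2 i2 j3 a b c.
have h2 := mono3_jacobi i2 j1 i1 j3 i3 j2 a c b.
apply: (@eq_combination _ _ _ _ _ _ _ 1 (-1) h1 h2); ring.
Qed.

(** Expanding both brackets leaves mixed products of two brackets, which cancel in pairs by
    antisymmetry. *)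
Lemma jacobiatorMl u1 u2 v w : jacobiator (u1 * u2) v w =
  jacobiator u1 v w * u2 + u1 * jacobiator u2 v w.
Proof.
rewrite /jacobiator !(pbrMl, pbrMr, linear_propD (pbr_linearl _ _),
  linear_propD (pbr_linearr _ _)).
rewrite (pbrC hD w u1) (pbrC hD w u2) (pbrC hD u1 v) (pbrC hD u2 v).
rewrite !(linear_propN (pbr_linearr _ _)); ring.
Qed.

Lemma jacobiator_linear v w : linear (fun u => jacobiator u v w).
Proof.
apply: linear_add; first apply: linear_add.
- exact: pbr_linearl.
- exact: linear_compose (pbr_linearr _ _) (pbr_linearr _ _).
- exact: linear_compose (pbr_linearr _ _) (pbr_linearl _ _).
Qed.

Lemma jacobiator1 v w : jacobiator 1 v w = 0.
Proof.
by rewrite /jacobiator !(pbr1l, pbr1r) !(linear_prop0 (pbr_linearr _ _)) !addr0.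
Qed.

Lemma jacobiator_letter (v w : Q) :
  (forall l, jacobiator (lt l) v w = 0) -> forall u, jacobiator u v w = 0.
Proof.
move=> h; elim/letter_ind => [c x y hx hy||l u ih].
- by rewrite jacobiator_linear hx hy scaler0 addr0.
- exact: jacobiator1.
- by rewrite jacobiatorMl h ih mul0r mulr0 addr0.
Qed.

(* A closed letter is the contraction of an open one with fresh labels. *)
Lemma jacobi_close (v w : Q) f : (exists N, forall x, f x <= N)%N ->
  relabel f f v = v -> relabel f f w = w ->
  (forall i j a, jacobiator (lt (op i j a)) v w = 0) ->
  forall l, jacobiator (lt l) v w = 0.
Proof.
move=> [N fN] fv fw h; elim/letter_case => [i j a|x]; first exact: h.
have [a ->] := cycproj_surj x.
have av y : f y != N.+1 by rewrite neq_ltn ltnS fN.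
pose C : Q -> Q := contr N.+1 N.+1.
have <- : C (lt (op N.+1 N.+1 a)) = lt (cl (cycproj a)).
  by rewrite /C contr_lt /= eqxx !mul1r.
have Cr u t : relabel f f t = t -> C (pbr u t) = pbr (C u) t.
  by move=> ft; rewrite -ft; exact: contr_pbrr.
have Cl u t : relabel f f t = t -> C (pbr t u) = pbr t (C u).
  by move=> ft; rewrite -ft; exact: contr_pbrl.
have fvw : relabel f f (pbr v w) = pbr v w by rewrite relabel_pbr fv fw.
(* The contraction at the fresh labels passes through every bracket, since [v], [w] and their
   bracket are fixed by a relabelling that misses these labels. *)
have := congr1 C (h N.+1 N.+1 a).
rewrite /jacobiator /C contr0 !contrD -/C.
by rewrite (Cr _ _ fvw) (Cl _ _ fv) (Cl _ _ fw) (Cl _ _ fw) (Cr _ _ fv).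
Qed.

(** Truncation of labels at a large [M] has the bounded image that [jacobi_close] asks for. It is
    not injective, which [relabel_pbr] permits. *)
Lemma relabel_bounded (l : letter A) :
  exists N, forall M, (N <= M)%N -> relabel (minn M) (minn M) (lt l) = lt l.
Proof.
elim/letter_case: l => [i j a|x].
  exists (maxn i j) => M; rewrite geq_max => /andP[iM jM].
  by rewrite relabel_lt /= (minn_idPr iM) (minn_idPr jM).
by exists 0%N => M _; rewrite relabel_lt.
Qed.

(** Cyclic symmetry brings each slot to the front in turn, where [jacobi_close] replaces its letter
    by an open one. *)
Lemma jacobi_letter l m n : jacobiator (lt l) (lt m) (lt n) = 0.
Proof.
have close (m' n' : letter A) :
    (forall i j a, jacobiator (lt (op i j a)) (lt m') (lt n') = 0) ->
    forall l, jacobiator (lt l) (lt m') (lt n') = 0.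
  have [[M hM] [N hN]] := (relabel_bounded m', relabel_bounded n').
  apply: (@jacobi_close _ _ (minn (maxn M N))).
  - by exists (maxn M N) => x; exact: geq_minl.
  - by apply: hM; exact: leq_maxl.
  - by apply: hN; exact: leq_maxr.
move: l; apply: (close _ _) => i1 j1 a.
rewrite jacobiatorC; move: m; apply: (close _ _) => i2 j2 b.
rewrite jacobiatorC; move: n; apply: (close _ _) => i3 j3 c.
exact: jacobi_op.
Qed.

Lemma jacobi u v w : jacobiator u v w = 0.
Proof.
move: u; apply: jacobiator_letter => l.
rewrite jacobiatorC; move: v; apply: jacobiator_letter => m.
rewrite jacobiatorC; move: w; apply: jacobiator_letter => n.
exact: jacobi_letter.
Qed.
End Jacobi.

(** * The Fock wheelgebra inside the algebra of letters *)

Section Embedding.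
Variables (k : fieldType) (A : assoc_algebra k).
Local Notation Q := (letter_alg A).

Definition open_part (w : seq (letter A)) : seq (nat * nat * A) :=
  pmap (fun l => if l is inl x then Some x else None) w.
Definition closed_part (w : seq (letter A)) : seq (Acyc A) :=
  pmap (fun l => if l is inr x then Some x else None) w.
Definition outs (w : seq (letter A)) := [seq l.1.1 | l <- open_part w].
Definition ins (w : seq (letter A)) := [seq l.1.2 | l <- open_part w].

Lemma perm_open w w' : perm_eq w w' -> perm_eq (open_part w) (open_part w').
Proof. exact: perm_pmap. Qed.
Lemma perm_closed w w' :
  perm_eq w w' -> perm_eq (closed_part w) (closed_part w').
Proof. exact: perm_pmap. Qed.
Lemma perm_outs w w' : perm_eq w w' -> perm_eq (outs w) (outs w').
Proof. by move/perm_open; exact: perm_map. Qed.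
Lemma perm_ins w w' : perm_eq w w' -> perm_eq (ins w) (ins w').
Proof. by move/perm_open; exact: perm_map. Qed.

Section Weight.
Variable n : nat.

Definition balanced (w : seq (letter A)) : bool :=
  perm_eq (outs w) (iota 0 n) && perm_eq (ins w) (iota 0 n).

(** In a balanced word each of these sums has exactly one term: [entries] reads the entry at a given
    output, [strands] sends an input to its output. Sums keep both total and invariant under
    permutations of the word. *)
Definition entries (w : seq (letter A)) : n.-tuple A :=
  [tuple \sum_(l <- open_part w | l.1.1 == x) l.2 | x < n].

Definition strands (w : seq (letter A)) : 'S_n :=
  as_perm (fun i : 'I_n =>
    insubd i (\sum_(l <- open_part w | l.1.2 == i) l.1.1)%N).

(** A normal form: with the strands sorted by output, the left permutation is trivial. Unbalanced
    words go to $0$. *)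
Definition word_U (w : seq (letter A)) : Ubim A n :=
  if balanced w then U_mk 1%g (pure (entries w)) (strands w) else 0.

Lemma U_mk_linear s t : linear (fun x => U_mk s x t : Ubim A n).
Proof.
move=> c x y; rewrite [LHS]/U_mk /pgen (qproj_rel (URelLin s t c x y)).
by rewrite qproj_linear.
Qed.

Lemma U_mk_perm s t r (a : n.-tuple A) :
  U_mk (s \oS r^-1%g) (pure a) (r \oS t) = U_mk s (pure (permute_tuple r a)) t.
Proof. by apply: qproj_rel; exact: URelPerm. Qed.

Lemma balanced_perm w w' : perm_eq w w' -> balanced w = balanced w'.
Proof.
move=> e; rewrite /balanced.
by rewrite (permPl (perm_outs e)) (permPl (perm_ins e)).
Qed.

Lemma word_U_perm w w' : perm_eq w w' -> word_U w = word_U w'.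
Proof.
move=> e; rewrite /word_U (balanced_perm e); case: ifP => // _.
have eo := perm_open e; congr (U_mk _ (pure _) _).
  by apply: eq_from_tnth => x; rewrite !tnth_mktuple; exact: perm_big.
rewrite /strands; congr as_perm; apply/funext => i; congr insubd.
exact: perm_big.
Qed.

Lemma word_U_op i j w : linear (fun a => word_U (op i j a :: w)).
Proof.
move=> c x y; rewrite /word_U.
have E z : balanced (op i j z :: w) = balanced (op i j 0 :: w) by [].
have S z : strands (op i j z :: w) = strands (op i j 0 :: w).
  rewrite /strands; congr as_perm; apply/funext => e.
  by rewrite /= !big_cons.
rewrite (E (_ + _)) (E x) (E y) (S (_ + _)) (S x) (S y).
case: ifP => [/andP[bo _]|_]; last by rewrite scaler0 addr0.
have lt_in : (i < n)%N.
  by have : i \in iota 0 n; [rewrite -(perm_mem bo) mem_head | rewrite mem_iota].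
have T z : entries (op i j z :: w) = tset (entries w) (Ordinal lt_in) z.
  apply: eq_from_tnth => e; rewrite tnth_tset !tnth_mktuple big_cons /=.
  rewrite -(inj_eq val_inj) /= eq_sym; case: eqP => // ->.
  (* Outputs are distinct in a balanced word, so no other strand contributes to the entry at [i]. *)
  rewrite big_seq_cond big1 ?addr0 // => l /andP[lw /eqP li].
  have := perm_uniq bo; rewrite iota_uniq /= => /andP[/negP[]].
  by rewrite -li; exact: map_f.
by rewrite !T pure_multilinear U_mk_linear.
Qed.

End Weight.

Lemma sym_word_linear (w : seq (Acyc A)) : linear (fun x => sym_word (x :: w)).
Proof.
move=> c x y; rewrite [LHS]/sym_word /pgen (qproj_rel (SymLin c x y w)).
by rewrite qproj_linear.
Qed.

Lemma sym_word_perm (s t : seq (Acyc A)) : perm_eq s t -> sym_word s = sym_word t.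
Proof. by move=> st; apply: qproj_rel; exact: SymPerm. Qed.

Lemma tens_mk_linearl (V W : lmodType k) (w : W) :
  linear (fun v : V => tens_mk v w).
Proof.
move=> c x y; rewrite [LHS]/tens_mk /pgen (qproj_rel (TensL c x y w)).
by rewrite qproj_linear.
Qed.

Lemma tens_mk_linearr (V W : lmodType k) (v : V) :
  linear (fun w : W => tens_mk v w).
Proof.
move=> c x y; rewrite [LHS]/tens_mk /pgen (qproj_rel (TensR c v x y)).
by rewrite qproj_linear.
Qed.

Lemma tens_ext (V W M : lmodType k) (f g : tens V W -> M) :
  linear f -> linear g ->
  (forall v w, f (tens_mk v w) = g (tens_mk v w)) -> f =1 g.
Proof. by move=> lf lg fg; apply: presented_ext => // -[v w]; exact: fg. Qed.

Lemma U_ext n (M : lmodType k) (f g : Ubim A n -> M) : linear f -> linear g ->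
  (forall s a t, f (U_mk s (pure a) t) = g (U_mk s (pure a) t)) -> f =1 g.
Proof.
move=> lf lg fg; apply: presented_ext => // -[[s x] t].
rewrite -[pgen _ _]/(U_mk s x t).
move: x; apply: tpow_ext => // c x y; by rewrite U_mk_linear ?lf ?lg.
Qed.

Lemma sym_ext (M : lmodType k) (f g : SymAlg (Acyc A) -> M) :
  linear f -> linear g -> (forall w, f (sym_word w) = g (sym_word w)) -> f =1 g.
Proof. exact: presented_ext. Qed.

Definition fock_word n (w : seq (letter A)) : fock_car A n :=
  tens_mk (word_U n w) (sym_word (closed_part w)).

Definition fock_map n : word_map A (fock_car A n).
Proof.
exists (@fock_word n) => [i j w c x y|w c x y|w w' e].
- by rewrite /fock_word word_U_op tens_mk_linearl.
- by rewrite /fock_word [closed_part _]/= sym_word_linear tens_mk_linearr.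
- rewrite /fock_word (word_U_perm n e); congr tens_mk.
  by apply: sym_word_perm; exact: perm_closed.
Defined.

Definition of_letters n : Q -> fock_car A n := word_lift (fock_map n).

Definition U_letters n : Ubim A n -> Q :=
  U_lift (fun s x t => mono (fun i => s i) (fun i => t^-1%g i) x).

Lemma U_lettersP n : linear (@U_letters n) /\ forall s x t,
  U_letters (U_mk s x t) = mono (fun i : 'I_n => s i) (fun i => t^-1%g i) x.
Proof.
apply: U_liftP => [s t|s t r a]; first exact: mono_linear.
have -> : pure (permute_tuple r a) = tensor_perm r^-1%g (pure a).
  by rewrite tensor_permE invgK.
rewrite mono_perm; apply: eq_mono => i /=; first by rewrite permM.
by rewrite invMg permM.
Qed.

Lemma U_letters_linear n : linear (@U_letters n).
Proof. exact: (U_lettersP n).1. Qed.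
Lemma U_lettersE n s x t :
  U_letters (U_mk s x t) = mono (fun i : 'I_n => s i) (fun i => t^-1%g i) x.
Proof. exact: (U_lettersP n).2. Qed.

Definition sym_letters : SymAlg (Acyc A) -> Q :=
  sym_lift (fun w => word (map cl w)).

Lemma sym_lettersP :
  linear sym_letters /\ forall w, sym_letters (sym_word w) = word (map cl w).
Proof.
apply: sym_liftP => [s|s t st]; first exact: word_cl.
by apply: word_perm; exact: perm_map.
Qed.

Lemma sym_letters_linear : linear sym_letters.
Proof. exact: sym_lettersP.1. Qed.
Lemma sym_lettersE w : sym_letters (sym_word w) = word (map cl w).
Proof. exact: sym_lettersP.2. Qed.

Lemma relabel_sym f g x : relabel f g (sym_letters x) = sym_letters x.
Proof.
move: x; apply: sym_ext => [||w].
- exact: linear_compose (@linearP _ _ _ _ (relabel f g)) sym_letters_linear.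
- exact: sym_letters_linear.
- by rewrite sym_lettersE /relabel word_liftE /= -map_comp.
Qed.

Definition letters n : fock_car A n -> Q :=
  tens_lift (fun x w => U_letters x * sym_letters w).

Lemma lettersP n : linear (@letters n) /\
  forall (x : Ubim A n) w, letters (tens_mk x w) = U_letters x * sym_letters w.
Proof.
apply: tens_liftP; split=> [w|x] c u v /=.
- by rewrite U_letters_linear mulrDl scalerAl.
- by rewrite sym_letters_linear mulrDr scalerAr.
Qed.

Lemma letters_linear n : linear (@letters n).
Proof. exact: (lettersP n).1. Qed.
Lemma lettersE n x w :
  letters (tens_mk x w) = @U_letters n x * sym_letters w.
Proof. exact: (lettersP n).2. Qed.

Definition fock_gen n (s : 'S_n) (a : n.-tuple A) (t : 'S_n) (w : seq (Acyc A)) :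
  fock_car A n := tens_mk (U_mk s (pure a) t) (sym_word w).

Lemma fock_ind n (P : fock_car A n -> Prop) : P 0 ->
  (forall c u v, P u -> P v -> P (c *: u + v)) ->
  (forall s a t w, P (fock_gen s a t w)) -> forall v, P v.
Proof.
move=> P0 PD Pg; elim/presented_ind => [|c [x w] v]; [exact: P0 | apply: (PD _ _ _)].
rewrite -[pgen _ _]/(tens_mk x w).
elim/presented_ind: x => [|{}c [[s y] t] x ih].
  by rewrite (linear_prop0 (tens_mk_linearl w)).
rewrite tens_mk_linearl; apply: (PD _ _ _) ih; rewrite -[pgen _ _]/(U_mk s y t).
elim/tpow_ind: y => [|{}c a y ih].
  by rewrite (linear_prop0 (@U_mk_linear n s t)) (linear_prop0 (tens_mk_linearl w)).
rewrite U_mk_linear tens_mk_linearl; apply: (PD _ _ _) ih.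
elim/presented_ind: w => [|{}c w u ih].
  by rewrite (linear_prop0 (tens_mk_linearr _)).
by rewrite tens_mk_linearr; apply: (PD _ _ _) ih; exact: Pg.
Qed.

Lemma fock_ext n (M : lmodType k) (f g : fock_car A n -> M) :
  linear f -> linear g ->
  (forall s a t w, f (fock_gen s a t w) = g (fock_gen s a t w)) -> f =1 g.
Proof.
move=> lf lg fg; elim/fock_ind => [|c u v hu hv|s a t w]; last exact: fg.
- by rewrite !linear_prop0.
- by rewrite lf lg hu hv.
Qed.

Definition gen_word n (s : 'S_n) (a : n.-tuple A) (t : 'S_n) (w : seq (Acyc A)) :
    seq (letter A) :=
  [seq op (s i) (t^-1%g i) (tnth a i) | i <- enum 'I_n] ++ map cl w.

Lemma letters_gen n (s : 'S_n) a t w :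
  letters (fock_gen s a t w) = word (gen_word s a t w).
Proof.
rewrite lettersE U_lettersE sym_lettersE monoE word_cat_mul; congr (_ * _).
by rewrite word_prod big_map big_enum.
Qed.

Lemma open_gen n (s : 'S_n) a t w : open_part (gen_word s a t w) =
  [seq (s i : nat, t^-1%g i : nat, tnth a i) | i <- enum 'I_n].
Proof.
rewrite /gen_word; elim: (enum _) => [|i r ih] /=; last by rewrite ih.
by elim: w.
Qed.

Lemma closed_gen n (s : 'S_n) a t w : closed_part (gen_word s a t w) = w.
Proof.
rewrite /gen_word; elim: (enum _) => [|i r ih] //=.
by elim: w => //= x w ->.
Qed.

Lemma perm_enum_iota n (s : 'S_n) :
  perm_eq [seq (s i : nat) | i <- enum 'I_n] (iota 0 n).
Proof.
rewrite -val_enum_ord (map_comp val s); apply: perm_map.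
apply: uniq_perm; rewrite ?(map_inj_uniq (@perm_inj _ s)) ?enum_uniq //.
by move=> i; rewrite mem_enum -(permKV s i) map_f ?mem_enum.
Qed.

Lemma balanced_gen n (s : 'S_n) a t w : balanced n (gen_word s a t w).
Proof.
have eo : outs (gen_word s a t w) = [seq (s i : nat) | i <- enum 'I_n].
  by rewrite /outs open_gen -map_comp.
have ei : ins (gen_word s a t w) = [seq (t^-1%g i : nat) | i <- enum 'I_n].
  by rewrite /ins open_gen -map_comp.
rewrite /balanced eo ei.
by apply/andP; split; [exact: (perm_enum_iota s) | exact: (perm_enum_iota t^-1%g)].
Qed.

(** Sorting by output is the relation of $U_n$ with $r=s^{-1}$: it rewrites $s\cdot a\cdot t$ with
    left permutation $1$ and right permutation $s\circ t$. *)
Lemma word_U_gen n (s : 'S_n) a t w :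
  word_U n (gen_word s a t w) = U_mk s (pure a) t.
Proof.
rewrite /word_U balanced_gen.
have -> : entries n (gen_word s a t w) = permute_tuple s^-1%g a.
  apply: eq_from_tnth => x; rewrite !tnth_mktuple open_gen big_map big_enum_cond.
  rewrite (big_pred1 (s^-1%g x)) // => i /=.
  by rewrite (inj_eq val_inj) -(inj_eq (@perm_inj _ s)) permKV.
have -> : strands n (gen_word s a t w) = s \oS t.
  apply/permP => i; rewrite permM.
  have E (j : 'I_n) : s (t j) = insubd j
      (\sum_(l <- open_part (gen_word s a t w) | l.1.2 == j) l.1.1)%N.
    rewrite open_gen big_map big_enum_cond (big_pred1 (t j)) => [|x /=].
      by apply: val_inj; rewrite /= insubdK // -topredE /= ltn_ord.
    have := inj_eq (@perm_inj _ t) (t^-1%g x) j; rewrite permKV => ->.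
    exact: inj_eq val_inj _ _.
  rewrite /strands as_permE -?E // => j j'; rewrite -!E => /perm_inj.
  exact: perm_inj.
rewrite -U_mk_perm; congr (U_mk _ _ _); apply/permP => x.
  by rewrite invgK permM perm1.
by rewrite !permM permK.
Qed.

Lemma lettersK n : cancel (@letters n) (of_letters n).
Proof.
move=> v; move: v; apply: fock_ext => [||s a t w].
- exact: linear_compose (@linearP _ _ _ _ (word_lift _)) (@letters_linear n).
- by [].
- rewrite letters_gen /of_letters word_liftE /= /fock_word.
  by rewrite word_U_gen closed_gen.
Qed.

Lemma letters_inj n : injective (@letters n).
Proof. exact: can_inj (@lettersK n). Qed.

(** A retraction onto the factor $U_n$ alone, with words containing closed letters sent to $0$. It
    gives injectivity of [U_letters] directly, without cancelling a tensor factor. *)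
Definition U_of_letters n : Q -> Ubim A n.
Proof.
apply: word_lift.
exists (fun w => if closed_part w is [::] then word_U n w else 0)
  => [i j w c x y|w c x y|w w' e] /=.
- by case: closed_part => [|z s]; rewrite ?word_U_op // scaler0 addr0.
- by rewrite scaler0 addr0.
- have ec := perm_closed e; rewrite (word_U_perm n e).
  case: closed_part ec => [|z s].
    by rewrite perm_sym => /perm_nilP ->.
  by move/perm_size; case: closed_part.
Defined.

Lemma U_letters_inj n : injective (@U_letters n).
Proof.
apply: (can_inj (g := U_of_letters n)) => v; move: v; apply: U_ext => [||s a t].
- exact: linear_compose (@linearP _ _ _ _ (word_lift _)) (@U_letters_linear n).
- by [].
have -> : U_letters (U_mk s (pure a) t) = word (gen_word s a t [::]).
  by rewrite -letters_gen lettersE sym_lettersE mulr1.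
by rewrite /U_of_letters word_liftE /= closed_gen word_U_gen.
Qed.

Definition sym_of_letters : Q -> SymAlg (Acyc A).
Proof.
apply: word_lift.
exists (fun w => if open_part w is [::] then sym_word (closed_part w) else 0)
  => [i j w c x y|w c x y|w w' e] /=.
- by rewrite scaler0 addr0.
- by case: open_part => [|z s]; rewrite ?sym_word_linear // scaler0 addr0.
- have eo := perm_open e; rewrite (sym_word_perm (perm_closed e)).
  case: open_part eo => [|z s].
    by rewrite perm_sym => /perm_nilP ->.
  by move/perm_size; case: open_part.
Defined.

Lemma sym_letters_inj : injective sym_letters.
Proof.
apply: (can_inj (g := sym_of_letters)) => v; move: v; apply: sym_ext => [||w].
- exact: linear_compose (@linearP _ _ _ _ (word_lift _)) sym_letters_linear.
- by [].
rewrite sym_lettersE /sym_of_letters word_liftE /=.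
have -> : open_part (map cl w) = [::] by elim: w.
by congr sym_word; elim: w => //= x w ->.
Qed.

Section LiftVia.
Variables (M N : lmodType k) (i : M -> N).
Hypotheses (li : linear i) (i_inj : injective i).

(** The formula through an injective map yields well-definedness as well: [U_letters] respects the
    relations, hence so does [i] composed with [f], hence so does [f]. The next two lemmas use the
    same argument. *)
Lemma U_lift_via n (f : 'S_n -> tpow A n -> 'S_n -> M) (F : Q -> N) :
  linear F -> (forall s x t, i (f s x t) = F (U_letters (U_mk s x t))) ->
  linear (U_lift f) /\ forall u, i (U_lift f u) = F (U_letters u).
Proof.
move=> lF fF.
have [lf fE] : linear (U_lift f) /\ forall s x t, U_lift f (U_mk s x t) = f s x t.
  apply: U_liftP => [s t c x y|s t r a]; apply: i_inj.
    by rewrite li !fF U_mk_linear U_letters_linear lF.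
  by rewrite !fF U_mk_perm.
split=> // u; move: u; apply: U_ext => [||s a t].
- exact: linear_compose li lf.
- exact: linear_compose lF (@U_letters_linear n).
- by rewrite fE fF.
Qed.

Lemma sym_lift_via (f : seq (Acyc A) -> M) (F : Q -> N) :
  linear F -> (forall w, i (f w) = F (word (map cl w))) ->
  linear (sym_lift f) /\ forall u, i (sym_lift f u) = F (sym_letters u).
Proof.
move=> lF fF.
have [lf fE] : linear (sym_lift f) /\ forall w, sym_lift f (sym_word w) = f w.
  apply: sym_liftP => [s c x y|s t st]; apply: i_inj.
    by rewrite li !fF word_cl lF.
  by rewrite !fF; congr F; apply: word_perm; exact: perm_map.
split=> // u; move: u; apply: sym_ext => [||w].
- exact: linear_compose li lf.
- exact: linear_compose lF sym_letters_linear.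
- by rewrite fE fF sym_lettersE.
Qed.

Lemma tens_lift_via n (f : Ubim A n -> SymAlg (Acyc A) -> M) (F : Q -> N) :
  linear F -> (forall x w, i (f x w) = F (letters (tens_mk x w))) ->
  linear (tens_lift f) /\ forall u, i (tens_lift f u) = F (letters u).
Proof.
move=> lF fF.
have [lf fE] : linear (tens_lift f) /\ forall v w, tens_lift f (tens_mk v w) = f v w.
  apply: tens_liftP; split=> z c x y; apply: i_inj; rewrite li !fF.
    by rewrite tens_mk_linearl letters_linear lF.
  by rewrite tens_mk_linearr letters_linear lF.
split=> // u; move: u; apply: tens_ext => [||x w].
- exact: linear_compose li lf.
- exact: linear_compose lF (@letters_linear n).
- by rewrite fE fF.
Qed.
End LiftVia.
End Embedding.

(** * The operations of the Fock wheelgebra on letters *)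

Section Labels.

(** The identity beyond [n], which makes it an injective relabelling of all naturals. *)
Definition nperm n (s : 'S_n) (x : nat) : nat :=
  if insub x is Some i then val (s i) else x.

Lemma npermE n (s : 'S_n) (i : 'I_n) : nperm s i = s i.
Proof. by rewrite /nperm valK. Qed.

Lemma nperm_ge n (s : 'S_n) x : (n <= x)%N -> nperm s x = x.
Proof. by move=> nx; rewrite /nperm insubF // ltnNge nx. Qed.

Lemma npermP n (s : 'S_n) (P : nat -> nat -> Prop) :
  (forall i : 'I_n, P i (s i)) -> (forall x, (n <= x)%N -> P x x) ->
  forall x, P x (nperm s x).
Proof.
move=> Pi Px x; case: (ltnP x n) => [xn|nx].
  by rewrite -[x]/(nat_of_ord (Ordinal xn)) npermE; exact: Pi.
by rewrite nperm_ge //; exact: Px.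
Qed.

Lemma nperm1 n : nperm (1%g : 'S_n) =1 id.
Proof.
by move=> x; apply: (npermP (P := fun x y => y = x)) => // i; rewrite perm1.
Qed.

Lemma npermM n (s t : 'S_n) x : nperm (s \oS t) x = nperm s (nperm t x).
Proof.
apply: (npermP (s := t) (P := fun x y => nperm (s \oS t) x = nperm s y)) => [i|y ny].
- by rewrite !npermE permM.
- by rewrite !nperm_ge.
Qed.

Lemma npermK n (s : 'S_n) : cancel (nperm s) (nperm s^-1%g).
Proof.
move=> x; rewrite -npermM -[RHS](nperm1 n); congr (nperm _ _).
by apply/permP => y; rewrite permM permK perm1.
Qed.

Lemma nperm_inj n (s : 'S_n) : injective (nperm s).
Proof. exact: can_inj (npermK s). Qed.

(* The renumbering of labels after the removal of l from 0, ..., n.  Sending l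
   to n instead of leaving it undefined keeps it injective. *)
Definition del (l n x : nat) : nat :=
  if x == l then n else if (l < x <= n)%N then x.-1 else x.

Lemma delP l n x : (x = l /\ del l n x = n \/
  l < x /\ x <= n /\ del l n x = x.-1 \/
  (x < l \/ l < x /\ n < x) /\ del l n x = x)%N.
Proof.
rewrite /del; case: eqP => [->|xl]; first by left.
case: ifP => h; [right; left | right; right]; lia.
Qed.

Lemma del_inj l n : (l <= n)%N -> injective (del l n).
Proof. by move=> ln x y; have := delP l n x; have := delP l n y; lia. Qed.

Lemma bumpP j x : (bump j x = x.+1 /\ j <= x \/ bump j x = x /\ x < j)%N.
Proof. by rewrite /bump; case: leqP; [left | right]. Qed.

Lemma del_lift n (a : 'I_n.+1) (i : 'I_n) : del a n (lift a i) = i.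
Proof.
have := ltn_ord i; rewrite /=; have := bumpP a i; have := delP a n (bump a i).
lia.
Qed.

(** Renumbering intertwines a permutation with its lift. The deleted label is sent to [n], which
    lies outside the range of [q] and is therefore fixed. *)
Lemma nperm_lift n (a b : 'I_n.+1) (q : 'S_n) x :
  nperm q (del a n x) = del b n (nperm (lift_perm a b q) x).
Proof.
apply: (npermP (P := fun x y => nperm q (del a n x) = del b n y)) => [i|y ny].
  case: (unliftP a i) => [j ->|->].
    by rewrite lift_perm_lift !del_lift npermE.
  by rewrite lift_perm_id /del !eqxx nperm_ge.
have h (c : 'I_n.+1) : del c n y = y by have := ltn_ord c; have := delP c n y; lia.
by rewrite !h nperm_ge // ltnW.
Qed.

Lemma ldelE n (j : 'I_n.+1) (s : 'S_n.+1) : lift_perm (s^-1%g j) j (ldel j s) = s.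
Proof.
by apply: invg_inj; rewrite lift_permV /ldel invgK rdelE.
Qed.

Lemma nperm_ldel n (j : 'I_n.+1) (s : 'S_n.+1) x :
  nperm (ldel j s) (del (s^-1%g j) n x) = del j n (nperm s x).
Proof. by rewrite (nperm_lift _ j) ldelE. Qed.

Lemma ldelV n (i : 'I_n.+1) (t : 'S_n.+1) : ldel i t^-1%g = ((rdel i t)^-1)%g.
Proof. by rewrite /ldel invgK. Qed.

Lemma psumV n m (s : 'S_n) (t : 'S_m) : ((psum s t)^-1 = psum s^-1 t^-1)%g.
Proof.
apply/permP => i; apply: (@perm_inj _ (psum s t)); rewrite permKV.
by case: (split_ordP i) => j ->; rewrite ?(psum_lshift, psum_rshift) permKV.
Qed.

End Labels.

Section FockOperations.
Variables (k : fieldType) (A : assoc_algebra k).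
Local Notation Q := (letter_alg A).

Lemma relabel_linear f g : linear (relabel f g : Q -> Q).
Proof. exact: linearP. Qed.

(** Only labels below [n] occur in [letters v], so the conventional values of [nperm] and [del]
    beyond them are harmless. *)
Lemma relabel_letters n f g f' g' (v : fock_car A n) :
  (forall x, (x < n)%N -> f x = f' x) -> (forall x, (x < n)%N -> g x = g' x) ->
  relabel f g (letters v) = relabel f' g' (letters v).
Proof.
move=> ff' gg'; move: v; apply: fock_ext => [||s a t w].
- exact: linear_compose (relabel_linear f g) (@letters_linear _ _ n).
- exact: linear_compose (relabel_linear f' g') (@letters_linear _ _ n).
rewrite lettersE U_lettersE !relabelM !relabel_sym !relabel_mono; congr (_ * _).
by apply: eq_mono => i /=; rewrite ?ff' ?gg'.
Qed.

Lemma relabel_letters_id n f g (v : fock_car A n) :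
  (forall x, (x < n)%N -> f x = x) -> (forall x, (x < n)%N -> g x = x) ->
  relabel f g (letters v) = letters v.
Proof. by move=> fx gx; rewrite -[RHS]relabel_id; exact: relabel_letters. Qed.

Lemma U_letters_l n (s : 'S_n) (x : Ubim A n) :
  U_letters (U_l s x) = relabel (nperm s) id (U_letters x).
Proof.
apply: (U_lift_via (@U_letters_linear k A n) (@U_letters_inj k A n) _ _).2.
  exact: relabel_linear.
move=> u y t; rewrite !U_lettersE relabel_mono; apply: eq_mono => i //=.
by rewrite npermE permM.
Qed.

Lemma U_letters_r n (s : 'S_n) (x : Ubim A n) :
  U_letters (U_r x s) = relabel id (nperm s^-1%g) (U_letters x).
Proof.
apply: (U_lift_via (@U_letters_linear k A n) (@U_letters_inj k A n) _ _).2.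
  exact: relabel_linear.
move=> u y t; rewrite !U_lettersE relabel_mono; apply: eq_mono => i //=.
by rewrite npermE invMg permM.
Qed.

Lemma fock_l_via n (s : 'S_n) : linear (@fock_l k A n s) /\
  forall v : fock_car A n, letters (fock_l s v) = relabel (nperm s) id (letters v).
Proof.
apply: (tens_lift_via (@letters_linear k A n) (@letters_inj k A n)).
  exact: relabel_linear.
by move=> x w; rewrite !lettersE U_letters_l relabelM relabel_sym.
Qed.

Lemma fock_l_linear n (s : 'S_n) : linear (@fock_l k A n s).
Proof. exact: (fock_l_via s).1. Qed.
Lemma letters_l n (s : 'S_n) (v : fock_car A n) :
  letters (fock_l s v) = relabel (nperm s) id (letters v).
Proof. exact: (fock_l_via s).2. Qed.

Lemma fock_r_via n (s : 'S_n) : linear (fun v : fock_car A n => fock_r v s) /\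
  forall v : fock_car A n,
    letters (fock_r v s) = relabel id (nperm s^-1%g) (letters v).
Proof.
apply: (tens_lift_via (@letters_linear k A n) (@letters_inj k A n)).
  exact: relabel_linear.
by move=> x w; rewrite !lettersE U_letters_r relabelM relabel_sym.
Qed.

Lemma fock_r_linear n (s : 'S_n) : linear (fun v => @fock_r k A n v s).
Proof. exact: (fock_r_via s).1. Qed.
Lemma letters_r n (s : 'S_n) (v : fock_car A n) :
  letters (fock_r v s) = relabel id (nperm s^-1%g) (letters v).
Proof. exact: (fock_r_via s).2. Qed.

Definition shift n : Q -> Q := relabel (addn n) (addn n).
HB.instance Definition _ n := GRing.Linear.on (shift n).

Lemma shift_linear n : linear (shift n). Proof. exact: linearP. Qed.

Lemma sym_letters_mul (x y : SymAlg (Acyc A)) :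
  sym_letters (sym_mul x y) = sym_letters x * sym_letters y.
Proof.
have inner (s : seq (Acyc A)) (z : SymAlg (Acyc A)) :
    sym_letters (sym_lift (fun t => sym_word (s ++ t)) z) =
    word (map cl s) * sym_letters z.
  have [l e] := sym_lift_via (@sym_letters_linear k A) (@sym_letters_inj k A)
    (f := fun t => sym_word (s ++ t)) (F := fun q => word (map cl s) * q)
    (linear_mul _ (fun c x y => erefl))
    (fun w => etrans (sym_lettersE _)
      (etrans (congr1 (@word k A) (map_cat _ _ _)) (word_cat_mul _ _))).
  exact: e.
apply: (sym_lift_via (@sym_letters_linear k A) (@sym_letters_inj k A)
  (F := fun q => q * sym_letters y) _ _).2 => [c u v|w].
- by rewrite mulrDl scalerAl.
- exact: inner.
Qed.

Lemma mono_psum n m (s t : 'S_n) (s' t' : 'S_m) (a : tpow A n) (b : tpow A m) :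
  mono (fun i => psum s s' i) (fun i => (psum t t')^-1%g i) (tcat a b) =
  mono (fun i => s i) (fun i => t^-1%g i) a *
  shift n (mono (fun i => s' i) (fun i => t'^-1%g i) b).
Proof.
move: a; apply: tpow_ext => [||a].
- exact: linear_compose (@mono_linear _ _ _ _ _) (tcat_linearl _).
- by move=> c u v; rewrite linearP mulrDl scalerAl.
move: b; apply: tpow_ext => [||b].
- exact: linear_compose (@mono_linear _ _ _ _ _) (tcat_linearr _).
- apply: linear_mul.
  exact: linear_compose (shift_linear _) (@mono_linear _ _ _ _ _).
rewrite tcatE !monoE big_split_ord /shift relabel_prod /=; congr (_ * _).
- apply: eq_bigr => i _.
  by rewrite psumV !psum_lshift tnth_lshift.
- apply: eq_bigr => i _.
  by rewrite psumV !psum_rshift tnth_rshift relabel_lt.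
Qed.

Lemma U_letters_mul n m (x : Ubim A n) (y : Ubim A m) :
  U_letters (U_mul x y) = U_letters x * shift n (U_letters y).
Proof.
have inner s a t := U_lift_via (@U_letters_linear k A (n + m))
  (@U_letters_inj k A (n + m))
  (f := fun s' a' t' => U_mk (psum s s') (tcat a a') (psum t t'))
  (F := fun q => U_letters (U_mk s a t) * shift n q)
  (linear_mul _ (shift_linear n)).
apply: (U_lift_via (@U_letters_linear k A (n + m)) (@U_letters_inj k A (n + m))
  (F := fun q => q * shift n (U_letters y)) _ _).2 => [c u v|s a t].
- by rewrite mulrDl scalerAl.
apply: (inner s a t _).2 => s' a' t'.
by rewrite !U_lettersE mono_psum.
Qed.

Lemma letters_mul n m (v : fock_car A n) (w : fock_car A m) :
  letters (fock_mul v w : fock_car A (n + m)) = letters v * shift n (letters w).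
Proof.
apply: (tens_lift_via (@letters_linear k A (n + m)) (@letters_inj k A (n + m))
  (F := fun q => q * shift n (letters w)) _ _).2 => [c u u'|x y].
- by rewrite mulrDl scalerAl.
apply: (tens_lift_via (@letters_linear k A (n + m)) (@letters_inj k A (n + m))
  (F := fun q => letters (tens_mk x y) * shift n q) _ _).2 => [|x' y'].
- exact: linear_mul (shift_linear n).
rewrite !lettersE U_letters_mul sym_letters_mul /shift relabelM relabel_sym.
by rewrite mulrACA.
Qed.

Lemma letters_embed n (x : tpow A n) :
  letters (fock_embed x) = mono (fun i => i) (fun i => i) x.
Proof.
rewrite lettersE U_lettersE sym_lettersE mulr1.
by apply: eq_mono => i; rewrite ?invg1 perm1.
Qed.

Lemma letters_one : letters (fock_one A) = 1.
Proof. by rewrite letters_embed monoE big_ord0. Qed.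

Lemma letters_cast m n (e : m = n) (v : fock A m) :
  letters (wcast e v : fock_car A n) = letters (v : fock_car A m).
Proof. by case: _ / e. Qed.
End FockOperations.

(** * The cycles in the definition of the contractions *)

Section CycLabels.
Local Ltac case_lia :=
  repeat (case: eqP => ? /=); repeat (case: ifP => ? /=); lia.

Lemma lift_if n (i j : 'I_n.+1) (x : 'I_n) :
  (if lift j x == i then j else lift j x) =
  (if bump j x == i :> nat then j : nat else bump j x) :> nat.
Proof. by rewrite -(inj_eq val_inj) /=; case: ifP. Qed.

(** The input label of the strand at place [x] after the contraction. The merged strand $a_ia_j$ has
    the input of $a_j$, the others keep theirs. Places are renumbered by removing [j] but inputs by
    removing [i]; the discrepancy is the cycle. *)
Lemma cyc_insert n (i j : 'I_n.+1) (x : 'I_n) : (i < j)%N ->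
  (cyc n i j.-1)^-1%g x =
  del i n (if lift j x == i then j else lift j x) :> nat.
Proof.
move=> ij; have jn := ltn_ord j; have xn := ltn_ord x.
have hij : (i <= j.-1 < n)%N by lia.
rewrite lift_if; set y := del i n _.
have yE : y = (if x == i :> nat then j.-1 else if (i < x < j)%N then x.-1 else x)%N.
  rewrite /y /del; move: (bumpP j x); move: (bump j x) => z hz.
  case: (z =P i) => zi; case_lia.
have yn : (y < n)%N by rewrite yE; case_lia.
rewrite -[y]/(nat_of_ord (Ordinal yn)); congr nat_of_ord.
apply: (canLR (permK _)); apply: val_inj; rewrite /= cycE //=.
move: yE; case: (x =P i :> nat) => xi; last case: ifP => ?; move=> ->; case_lia.
Qed.

Lemma cyc_insertV n (i j : 'I_n.+1) (x : 'I_n) : (j < i)%N ->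
  cyc n j i.-1 x = del i n (if lift j x == i then j else lift j x) :> nat.
Proof.
move=> ij; have jn := ltn_ord i; have xn := ltn_ord x.
rewrite cycE; last lia.
rewrite lift_if /del; move: (bumpP j x); move: (bump j x) => z hz.
case: (z =P i) => zi; case_lia.
Qed.
End CycLabels.

(** * Contractions of the Fock wheelgebra as operators on letters *)

Section FockContraction.
Variables (k : fieldType) (A : assoc_algebra k).
Local Notation Q := (letter_alg A).

Lemma contr_linear j i : linear (contr j i : Q -> Q).
Proof. exact: linearP. Qed.

Lemma tlift_via (V M N : lmodType k) (h : M -> N) n (f : n.-tuple V -> M)
    (F : tpow V n -> N) : linear h -> injective h -> linear F ->
  (forall a, h (f a) = F (pure a)) ->
  linear (tlift f) /\ forall u, h (tlift f u) = F u.
Proof.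
move=> lh h_inj lF fF.
have mf : multilinear f.
  by move=> a i c x y; apply: h_inj; rewrite lh !fF pure_multilinear lF.
split; first exact: tlift_linear mf.
apply: tpow_ext => //.
  exact: linear_compose lh (tlift_linear mf).
by move=> a; rewrite tliftE.
Qed.

Lemma relabel_op f g o i (a : A) :
  relabel f g (lt (op o i a)) = lt (op (f o) (g i) a).
Proof. exact: relabel_lt. Qed.

Lemma relabel_sym_prod n f g (P : pred 'I_n) (o i : 'I_n -> nat)
    (a : 'I_n -> A) w :
  relabel f g ((\prod_(x | P x) lt (op (o x) (i x) (a x))) * sym_letters w) =
  (\prod_(x | P x) lt (op (f (o x)) (g (i x)) (a x))) * sym_letters w.
Proof.
rewrite relabelM relabel_sym relabel_prod; congr (_ * _).
by apply: eq_bigr => x _; rewrite relabel_lt.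
Qed.

Lemma contr_diag n (i : 'I_n.+1) (a : n.+1.-tuple A) w :
  contr i i ((\prod_(x < n.+1) lt (op x x (tnth a x))) * sym_letters w) =
  lt (cl (cycproj (tnth a i))) *
  ((\prod_(x < n) lt (op (lift i x) (lift i x) (tnth a (lift i x)))) *
   sym_letters w).
Proof.
rewrite (bigD1_ord i) //= -mulrA -(relabel_sym_prod (bump i) (bump i) _
  (fun x => x) (fun x => x)) /=.
have bi x : bump i x != i by rewrite eq_sym neq_bump.
by rewrite contr_mulr // contr_lt /= eqxx !mul1r.
Qed.

Lemma contr_off_diag n (j i : 'I_n.+1) (a : n.+1.-tuple A) w : i != j ->
  contr j i ((\prod_(x < n.+1) lt (op x x (tnth a x))) * sym_letters w) =
  (\prod_(x < n) (if lift j x == i then lt (op i j (amul (tnth a i) (tnth a j)))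
    else lt (op (lift j x) (lift j x) (tnth a (lift j x))))) * sym_letters w.
Proof.
move=> ij; have [x0 i_def|/eqP] := unliftP j i; last by rewrite (negbTE ij).
rewrite (bigD1_ord j) //= (bigD1 x0) //= -i_def.
rewrite [in RHS](bigD1 x0) //= -i_def eqxx.
rewrite [in RHS](eq_bigr
  (fun x => lt (op (lift j x) (lift j x) (tnth a (lift j x))))) => [|x xx0];
  last by rewrite i_def (inj_eq lift_inj) (negbTE xx0).
rewrite mulrA -!mulrA mulrA; set r := _ * sym_letters w.
(* Fixes the labels of the remaining factors [r] and sends the two contracted ones out of the
   way. *)
pose f x := if (x == i :> nat) || (x == j :> nat) then n.+1 else x.
have fi x : f x != i.
  by rewrite /f; case: ifP => [_|/norP[]//]; rewrite neq_ltn ltn_ord orbT.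
have fj x : f x != j.
  by rewrite /f; case: ifP => [_|/norP[]//]; rewrite neq_ltn ltn_ord orbT.
have <- : relabel f f r = r.
  rewrite /r (relabel_sym_prod f f); congr (_ * _); apply: eq_bigr => x xx0.
  have fx : f (lift j x) = lift j x.
    rewrite /f i_def !(inj_eq val_inj) (inj_eq lift_inj) (negbTE xx0).
    by rewrite eq_sym (negbTE (neq_lift _ _)).
  by rewrite fx.
rewrite contr_mulr //; congr (_ * _).
have ij' : (i == j :> nat) = false by rewrite (inj_eq val_inj) (negbTE ij).
have ji' : (j == i :> nat) = false by rewrite eq_sym.
rewrite contrM !contr_lt bider_lt merge_op /=.
rewrite -[bump j x0]/(nat_of_ord (lift j x0)) -i_def !eqxx ij' ji' /=.
by rewrite !(mul0r, mulr0, add0r, addr0, mul1r).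
Qed.

Lemma letters_contr_pure n (j i : 'I_n.+1) (a : n.+1.-tuple A) w :
  letters (fock_contr_pure j i a w) =
  relabel (del j n) (del i n)
    (contr j i ((\prod_(x < n.+1) lt (op x x (tnth a x))) * sym_letters w)).
Proof.
rewrite /fock_contr_pure; case: (ltngtP i j) => ij.
- have nij : i != j by rewrite -(inj_eq val_inj) /= neq_ltn ij.
  rewrite contr_off_diag // lettersE U_lettersE relabelM relabel_sym.
  rewrite relabel_prod monoE; congr (_ * _); apply: eq_bigr => x _.
  rewrite perm1 cyc_insert // tnth_mktuple.
  by case: eqP => [<-|_]; rewrite relabel_op del_lift.
- have nij : i != j by rewrite -(inj_eq val_inj) /= neq_ltn ij orbT.
  rewrite contr_off_diag // lettersE U_lettersE relabelM relabel_sym.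
  rewrite relabel_prod monoE; congr (_ * _); apply: eq_bigr => x _.
  rewrite perm1 invgK cyc_insertV // tnth_mktuple.
  by case: eqP => [<-|_]; rewrite relabel_op del_lift.
- have <- : i = j by exact: val_inj.
  rewrite contr_diag lettersE U_lettersE sym_letters_mul sym_lettersE monoE.
  rewrite relabelM relabel_lt relabel_sym_prod [RHS]mulrCA.
  congr (_ * (_ * _)); apply: eq_bigr => x _.
  by rewrite invg1 perm1 !del_lift tnth_mktuple.
Qed.

Lemma fock_contr_via n (j i : 'I_n.+1) : linear (@fock_contr k A n j i) /\
  forall v : fock_car A n.+1, letters (fock_contr j i v) =
    relabel (del j n) (del i n) (contr j i (letters v)).
Proof.
pose F j i : Q -> Q := fun q => relabel (del j n) (del i n) (contr j i q).
have lF j' i' : linear (F j' i').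
  exact: linear_compose (relabel_linear _ _) (contr_linear _ _).
have lw w : linear (fun q : Q => q * sym_letters w).
  by move=> c x y; rewrite mulrDl scalerAl.
have pureP (j' i' : 'I_n.+1) w := tlift_via
  (f := fun a => fock_contr_pure j' i' a w)
  (F := fun y => F j' i' (mono (fun x => x) (fun x => x) y * sym_letters w))
  (@letters_linear k A n) (@letters_inj k A n)
  (linear_compose (lF j' i') (linear_compose (lw w) (@mono_linear _ _ _ _ _))).
apply: (tens_lift_via (@letters_linear k A n) (@letters_inj k A n) (lF j i)).
move=> x w; rewrite lettersE.
apply: (U_lift_via (@letters_linear k A n) (@letters_inj k A n)
  (linear_compose (lF j i) (lw w)) _).2 => s y t /=.
rewrite letters_l letters_r relabel_comp (pureP _ _ _ _).2; last first.
  by move=> a; rewrite letters_contr_pure monoE.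
rewrite U_lettersE /F.
have -> : mono (fun i => s i) (fun i => t^-1%g i) y * sym_letters w =
    relabel (nperm s) (nperm t^-1%g)
      (mono (fun x => x) (fun x => x) y * sym_letters w).
  rewrite relabelM relabel_sym relabel_mono; congr (_ * _).
  by apply: eq_mono => z /=; rewrite npermE.
(* A general element $s\cdot y\cdot t$ is a relabelling of $1\cdot y\cdot 1$; pulling the contracted
   labels back along it reduces to the generators, and [nperm_ldel] turns the relabelling into
   [ldel j s] and [rdel i t]. *)
have sj : j = nperm s (s^-1%g j) :> nat by rewrite npermE permKV.
have ti : i = nperm t^-1%g (t i) :> nat by rewrite npermE permK.
rewrite [in RHS]sj [in RHS]ti contr_relabel; try exact: nperm_inj.
rewrite -sj -ti !relabel_comp; apply: eq_relabel => z /=.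
  by rewrite -nperm_ldel.
by rewrite -nperm_ldel invgK ldelV.
Qed.

Lemma fock_contr_linear n (j i : 'I_n.+1) : linear (@fock_contr k A n j i).
Proof. exact: (fock_contr_via j i).1. Qed.

Lemma letters_contr n (j i : 'I_n.+1) (v : fock_car A n.+1) :
  letters (fock_contr j i v) =
  relabel (del j n) (del i n) (contr j i (letters v)).
Proof. exact: (fock_contr_via j i).2. Qed.
End FockContraction.

(** * Multidegree by labels and the image of the embedding *)

Section Grading.
Variables (k : fieldType) (A : assoc_algebra k).
Local Notation Q := (letter_alg A).

(** The multidegree of a word: its outputs and inputs up to order. It serves to show that brackets
    of elements in the image of [letters] are again in an image. *)
Definition word_of_type (P I : seq nat) (u : Q) : Prop :=
  exists w, [/\ u = word w, perm_eq (outs w) P & perm_eq (ins w) I].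

Definition hom (P I : seq nat) : Q -> Prop := in_span (word_of_type P I).

Lemma hom0 P I : hom P I 0. Proof. exact: in_span0. Qed.
Lemma homD P I u v : hom P I u -> hom P I v -> hom P I (u + v).
Proof. exact: in_span_add. Qed.
Lemma homZ P I c u : hom P I u -> hom P I (c *: u).
Proof. exact: in_span_scale. Qed.
Lemma homN P I u : hom P I u -> hom P I (- u).
Proof. by rewrite -scaleN1r; exact: homZ. Qed.

Lemma hom_word w P I : perm_eq (outs w) P -> perm_eq (ins w) I -> hom P I (word w).
Proof. by move=> wP wI; apply: in_span_gen; exists w. Qed.

Lemma hom_perm P I P' I' u : perm_eq P P' -> perm_eq I I' ->
  hom P I u -> hom P' I' u.
Proof.
move=> PP II; elim=> [|c r v [w [-> wP wI]] _ ih]; first exact: hom0.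
by apply: homD ih; apply: homZ; apply: hom_word;
  [exact: perm_trans wP PP | exact: perm_trans wI II].
Qed.

Lemma outs_cat (s t : seq (letter A)) : outs (s ++ t) = outs s ++ outs t.
Proof. by rewrite /outs /open_part pmap_cat map_cat. Qed.
Lemma ins_cat (s t : seq (letter A)) : ins (s ++ t) = ins s ++ ins t.
Proof. by rewrite /ins /open_part pmap_cat map_cat. Qed.

Lemma hom_mul P I P' I' u v :
  hom P I u -> hom P' I' v -> hom (P ++ P') (I ++ I') (u * v).
Proof.
move=> hu hv; elim: hu => [|c r x [w [-> wP wI]] _ ih].
  by rewrite mul0r; exact: hom0.
rewrite mulrDl -scalerAl; apply: homD ih; apply: homZ.
elim: hv => [|d s y [w' [-> wP' wI']] _ ih].
  by rewrite mulr0; exact: hom0.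
rewrite mulrDr -scalerAr; apply: homD ih; apply: homZ.
rewrite -word_cat_mul; apply: hom_word; rewrite ?outs_cat ?ins_cat;
  exact: perm_cat.
Qed.

Lemma hom_der (d : letter_map A Q) P I w :
  (forall l, hom (outs [:: l] ++ P) (ins [:: l] ++ I) (d l)) ->
  hom (outs w ++ P) (ins w ++ I) (der d (word w)).
Proof.
move=> hd; elim: w => [|l w ih]; first by rewrite word_nil der1; exact: hom0.
rewrite word_cons der_ltM -cat1s outs_cat ins_cat; apply: homD.
  have hw := hom_word (perm_refl (outs w)) (perm_refl (ins w)).
  apply: hom_perm (hom_mul (hd l) hw).
    by rewrite -!catA perm_cat2l perm_catC.
  by rewrite -!catA perm_cat2l perm_catC.
by rewrite -!catA; apply: hom_mul ih; exact: hom_word.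
Qed.

Lemma hom_linear P I (f : Q -> Q) P' I' u : linear f ->
  (forall w, perm_eq (outs w) P -> perm_eq (ins w) I -> hom P' I' (f (word w))) ->
  hom P I u -> hom P' I' (f u).
Proof.
move=> lf fw; elim=> [|c r v [w [-> wP wI]] _ ih].
  by rewrite linear_prop0 //; exact: hom0.
by rewrite lf; apply: homD ih; apply: homZ; exact: fw.
Qed.

Lemma hom_mono2 o1 i1 o2 i2 t :
  hom [:: o1; o2] [:: i1; i2] (mono2 o1 i1 o2 i2 t : Q).
Proof.
elim/tpow_ind: t => [|c a u ih]; first by rewrite linear0; exact: hom0.
rewrite mono2_linear; apply: homD ih; apply: homZ; rewrite mono2E.
by rewrite -[lt (op o2 _ _)]/(word [:: _]) -word_cons; exact: hom_word.
Qed.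

Section Bracket.
Variable D : {linear tpow A 2 -> tpow A 2}.
Hypothesis hD : is_double_bracket D.

Lemma hom_pbr_fun l m :
  hom (outs [:: l] ++ outs [:: m]) (ins [:: l] ++ ins [:: m]) (pbr_fun D l m).
Proof.
elim/letter_case: l => [i j a|x]; elim/letter_case: m => [p q b|y].
- apply: hom_perm (hom_mono2 _ _ _ _ _); last by [].
  exact: (permEl (perm_catC [:: p] [:: i])).
- by apply: homN; exact: hom_word.
- exact: hom_word.
- exact: hom_word.
Qed.

Lemma hom_pbr P I P' I' u v :
  hom P I u -> hom P' I' v -> hom (P ++ P') (I ++ I') (pbr hD u v).
Proof.
move=> hu hv; apply: (hom_linear (f := fun z => pbr hD z v)) hu => [|w wP wI].
  exact: pbr_linearl.
apply: (@hom_perm (outs w ++ P') (ins w ++ I')); rewrite ?perm_cat2r //.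
apply: hom_der => l /=.
apply: (hom_linear (f := der (pbr_symbol hD l))) hv => [|w' wP' wI'].
  exact: linearP.
apply: (@hom_perm (outs w' ++ outs [:: l]) (ins w' ++ ins [:: l])).
- by rewrite perm_catC perm_cat2l.
- by rewrite perm_catC perm_cat2l.
apply: hom_der => m; apply: hom_perm (hom_pbr_fun l m); exact/permPl/perm_catC.
Qed.
End Bracket.

Lemma hom_relabel_letters n f g (v : fock_car A n) :
  hom (map f (iota 0 n)) (map g (iota 0 n)) (relabel f g (letters v)).
Proof.
pose G := fun v : fock_car A n => relabel f g (letters v).
have lG : linear G.
  exact: linear_compose (relabel_linear _ _) (@letters_linear k A n).
rewrite -/(G v); elim/fock_ind: v => [|c u v hu hv|s a t w].
- by rewrite linear_prop0 //; exact: hom0.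
- by rewrite lG; apply: homD hv; exact: homZ.
- rewrite /G letters_gen /relabel word_liftE /=.
  have E : open_part (map (relabel_letter f g) (gen_word s a t w)) =
      [seq (f l.1.1, g l.1.2, l.2) | l <- open_part (gen_word s a t w)].
    by elim: (gen_word s a t w) => [|[[[i j] b]|x] r ih] //=; rewrite ih.
  have /andP[bo bi] := balanced_gen s a t w.
  apply: hom_word; rewrite /outs /ins E -map_comp.
  - by have := perm_map f bo; rewrite -map_comp.
  - by have := perm_map g bi; rewrite -map_comp.
Qed.

Lemma hom_letters n (v : fock_car A n) : hom (iota 0 n) (iota 0 n) (letters v).
Proof.
by rewrite -[letters v]relabel_id -[iota 0 n]map_id; exact: hom_relabel_letters.
Qed.

Lemma hom_shift n m (w : fock_car A m) :
  hom (iota n m) (iota n m) (shift n (letters w)).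
Proof. by rewrite -[n in iota n]addn0 iotaDl; exact: hom_relabel_letters. Qed.

Lemma perm_split (w : seq (letter A)) :
  perm_eq w ([seq inl x | x <- open_part w] ++ [seq inr x | x <- closed_part w]).
Proof.
elim: w => //= -[x|x] w ih /=; first by rewrite perm_cons.
by rewrite perm_sym -cat1s perm_catCA /= perm_cons perm_sym.
Qed.

Lemma letters_word n (w : seq (letter A)) : balanced n w ->
  exists v : fock_car A n, letters v = word w.
Proof.
move=> /andP[bo bi].
pose o := open_part w; pose d : nat * nat * A := (0%N, 0%N, 0).
(* [Is] lists the positions of the strands in the order of their outputs. *)
have [Is hI hE] : exists2 Is, perm_eq Is (iota 0 (size (outs w))) &
    iota 0 n = map (nth 0%N (outs w)) Is.
  by apply/perm_iotaP; rewrite perm_sym.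
pose o' := map (nth d o) Is.
have oo' : perm_eq o' o.
  rewrite -[X in perm_eq _ X](mkseq_nth d) /mkseq; apply: perm_map.
  by rewrite -(size_map (fun l => l.1.1) o).
have out' : [seq l.1.1 | l <- o'] = iota 0 n.
  rewrite hE -map_comp; apply/eq_in_map => x xI /=.
  rewrite (nth_map d) //.
  by move: xI; rewrite (perm_mem hI) mem_iota size_map.
have size' : size o' = n by rewrite -(size_map (fun l => l.1.1)) out' size_iota.
pose g (i : 'I_n) := (nth d o' i).1.2.
have ins' : perm_eq [seq l.1.2 | l <- o'] (iota 0 n).
  by apply: perm_trans bi; exact: perm_map.
have glt i : (g i < n)%N.
  have : g i \in [seq l.1.2 | l <- o'] by apply: map_f; rewrite mem_nth ?size'.
  by rewrite (perm_mem ins') mem_iota.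
have ginj : injective (fun i => Ordinal (glt i)).
  move=> i j [gij]; apply: val_inj; apply/eqP.
  have u : uniq [seq l.1.2 | l <- o'] by rewrite (perm_uniq ins') iota_uniq.
  have E (e : 'I_n) : nth 0%N [seq l.1.2 | l <- o'] e = g e.
    by rewrite (nth_map d) ?size'.
  have lts (e : 'I_n) : (e < size [seq l.1.2 | l <- o'])%N.
    by rewrite size_map size'.
  by have := nth_uniq 0%N (lts i) (lts j) u; rewrite !E gij eqxx => <-.
(* The input label of the strand at place $i$ is $t^{-1}(i)$, so the right permutation is the
   inverse of the one given by the inputs. *)
exists (fock_gen 1%g [tuple (nth d o' i).2 | i < n] (perm ginj)^-1%g
  (closed_part w)).
rewrite letters_gen; apply: word_perm; rewrite perm_sym.
apply: perm_trans (perm_split w) _; apply: perm_cat; last by [].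
apply: (@perm_trans _ (map inl o')).
  by apply: perm_map; rewrite perm_sym.
rewrite -[o' in map inl o'](mkseq_nth d) size' /mkseq -val_enum_ord -!map_comp.
match goal with |- is_true (perm_eq ?x ?y) => suff -> : x = y by [] end.
apply: eq_map => i /=.
rewrite perm1 invgK permE tnth_mktuple /op.
have : nth 0%N [seq l.1.1 | l <- o'] i = i by rewrite out' nth_iota.
rewrite (nth_map d) ?size' // => o1.
congr inl; rewrite [LHS]surjective_pairing; congr (_, _).
by rewrite [LHS]surjective_pairing o1.
Qed.

Lemma letters_surj n u : hom (iota 0 n) (iota 0 n) u ->
  exists v : fock_car A n, letters v = u.
Proof.
elim=> [|c r x [w [-> wP wI]] _ [v <-]].
  by exists 0; rewrite linear_prop0 //; exact: letters_linear.
have [|v' <-] := @letters_word n w; first by rewrite /balanced wP wI.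
by exists (c *: v' + v); rewrite letters_linear.
Qed.
End Grading.

(** * The Poisson wheelgebra axioms *)

Section Pairings.
Variables (k : fieldType) (A : assoc_algebra k).
Local Notation Q := (letter_alg A).
Local Notation F := (fock A).
Local Notation L n := (@letters k A n).

Lemma nperm_lshift n m (s : 'S_n) (t : 'S_m) x : (x < n)%N ->
  nperm (psum s t) x = nperm s x.
Proof.
move=> xn; have -> : x = lshift m (Ordinal xn) by [].
by rewrite npermE psum_lshift /= -(npermE s).
Qed.

Lemma nperm_rshift n m (s : 'S_n) (t : 'S_m) x :
  nperm (psum s t) (n + x)%N = (n + nperm t x)%N.
Proof.
apply: (npermP (s := t) (P := fun x y => nperm (psum s t) (n + x) = (n + y)%N))
  => [i|y my].
  by rewrite -[(n + i)%N]/(nat_of_ord (rshift n i)) npermE psum_rshift.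
by rewrite nperm_ge // leq_add2l.
Qed.

Lemma eq_letters n (v w : F n) : L n v = L n w -> v = w.
Proof. exact: letters_inj. Qed.

Lemma letters_wl n (s : 'S_n) (v : F n) :
  L n (wl s v) = relabel (nperm s) id (L n v).
Proof. exact: letters_l. Qed.

Lemma letters_wr n (s : 'S_n) (v : F n) :
  L n (wr v s) = relabel id (nperm s^-1%g) (L n v).
Proof. exact: letters_r. Qed.

Lemma letters_wt n (j i : 'I_n.+1) (v : F n.+1) :
  L n (wt j i v) = relabel (del j n) (del i n) (contr j i (L n.+1 v)).
Proof. exact: letters_contr. Qed.

Lemma letters_wcast m n (e : m = n) (v : F m) : L n (wcast e v) = L m v.
Proof. exact: letters_cast. Qed.

(** * Bimodule and contraction axioms, for the product and the bracket at once *)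

Section Star.
Variable star : Q -> Q -> Q.
Hypothesis star_bilinear : bilinear_map star.
Hypothesis relabel_star : forall f g u v,
  relabel f g (star u v) = star (relabel f g u) (relabel f g v).
Hypothesis contr_starr : forall f g j i,
  (forall x, f x != j) -> (forall x, g x != i) -> forall u v,
  contr j i (star u (relabel f g v)) = star (contr j i u) (relabel f g v).
Hypothesis contr_starl : forall f g j i,
  (forall x, f x != j) -> (forall x, g x != i) -> forall u v,
  contr j i (star (relabel f g v) u) = star (relabel f g v) (contr j i u).
Variable p : pairing F.
Hypothesis letters_pairing : forall n m (v : F n) (w : F m),
  L (n + m) (p v w) = star (L n v) (shift n (L m w)).

Lemma pairing_bimodule : is_bimodule_pairing p.
Proof.
split=> [n m|n m s s' t t' v w].
  split=> [w|v] c x y; apply: eq_letters;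
    rewrite (@letters_linear k A (n + m)) !letters_pairing.
    by rewrite (@letters_linear k A n) star_bilinear.1.
  by rewrite (@letters_linear k A m) shift_linear star_bilinear.2.
apply: eq_letters; rewrite letters_pairing.
rewrite (letters_wl (psum s t)) (letters_wr (psum s' t')) letters_pairing.
rewrite (letters_wl s) (letters_wr s') (letters_wl t) (letters_wr t').
rewrite !relabel_comp.
rewrite relabel_star /shift !relabel_comp psumV; congr star.
  by apply: relabel_letters => x xn /=; rewrite nperm_lshift.
by apply: relabel_letters => x xn /=; rewrite nperm_rshift.
Qed.

(** The deleted label goes to [n] first, then past the labels of the second factor to [n + m]. *)
Lemma del_widen j n m x : (j <= n)%N -> del j (n + m) x = del n (n + m) (del j n x).
Proof.
move=> jn; have := delP j (n + m) x; have := delP j n x.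
have := delP n (n + m) (del j n x); lia.
Qed.

Lemma pairing_contraction : contraction_compatible p.
Proof.
split=> n m j i v w; apply: eq_letters.
(* Restated with the index [(n + m).+1], which is only convertible to [n.+1 + m]. *)
- have E1 : L (n + m).+1 (p v w) = star (L n.+1 v) (shift n.+1 (L m w)).
    exact (letters_pairing v w).
  rewrite letters_wt E1 /= [shift n.+1 _]/shift contr_starr => [|x|x]; last first.
  + by rewrite eq_sym neq_ltn (leq_trans (ltn_ord i)) ?leq_addr.
  + by rewrite eq_sym neq_ltn (leq_trans (ltn_ord j)) ?leq_addr.
  rewrite relabel_star letters_pairing; congr star; last first.
    rewrite /shift relabel_comp; apply: relabel_letters => x xm /=.
      by have := ltn_ord j; have := delP j (n + m) (n.+1 + x); lia.
    by have := ltn_ord i; have := delP i (n + m) (n.+1 + x); lia.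
  have E (l : 'I_n.+1) : del l (n + m) =1 del n (n + m) \o del l n.
    by move=> x; apply: del_widen; rewrite -ltnS.
  rewrite (eq_relabel _ (E j) (E i)) -relabel_comp -letters_wt.
  by apply: relabel_letters_id => x xn; have := delP n (n + m) x; lia.
- rewrite letters_wt letters_wcast letters_pairing /=.
  (* Fixes the labels of [v] and misses the contracted ones, which lie between [n] and [n + m]. *)
  pose f x := if (x < n)%N then x else (n + m).+1.
  have fE : relabel f f (L n v) = L n v.
    by apply: relabel_letters_id => x xn; rewrite /f xn.
  have fj (l : 'I_m.+1) x : f x != (n + l)%N.
    have := ltn_ord l; rewrite /f; case: ifP => h1 h2; apply/eqP; lia.
  rewrite -fE contr_starl // fE relabel_star letters_pairing; congr star.
    apply: relabel_letters_id => x xn.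
      by have := delP (n + j) (n + m) x; lia.
    by have := delP (n + i) (n + m) x; lia.
  rewrite letters_wt /shift contr_relabel; try exact: addnI.
  rewrite !relabel_comp; apply: eq_relabel => x /=.
    by have := delP (n + j) (n + m) (n + x); have := delP j m x; lia.
  by have := delP (n + i) (n + m) (n + x); have := delP i m x; lia.
Qed.
End Star.

Lemma fock_sbimodule : is_sbimodule F.
Proof.
split.
- by move=> n s; exact: fock_l_linear.
- by move=> n s; exact: fock_r_linear.
- move=> n v; apply: eq_letters; rewrite letters_wl -[RHS]relabel_id.
  by apply: eq_relabel => // x; rewrite nperm1.
- move=> n v; apply: eq_letters; rewrite letters_wr -[RHS]relabel_id.
  by apply: eq_relabel => // x; rewrite invg1 nperm1.
- move=> n s t v; apply: eq_letters; rewrite !letters_wl relabel_comp.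
  by apply: eq_relabel => // x; rewrite npermM.
- move=> n s t v; apply: eq_letters; rewrite !letters_wr relabel_comp.
  apply: eq_relabel => // x /=.
  by rewrite -npermM; congr (nperm _ x); rewrite /pcomp invMg.
- move=> n s t v; apply: eq_letters; rewrite !(letters_wl, letters_wr).
  by rewrite !relabel_comp.
Qed.

Definition swap_last (n x : nat) : nat :=
  if x == n then n.+1 else if x == n.+1 then n else x.

Lemma swap_lastP n x : (x = n /\ swap_last n x = n.+1 \/
  x = n.+1 /\ swap_last n x = n \/
  (x < n \/ n.+1 < x) /\ swap_last n x = x)%N.
Proof.
rewrite /swap_last; case: eqP => [->|xn]; first by left.
by case: eqP => [->|xn1]; [right; left | right; right; split=> //; lia].
Qed.

(* Innermost first, discarding impossible branches at once: one single call of
   lia on all the cases produces a huge proof term. *)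
Local Ltac del_lia := repeat match goal with
  | |- context [del ?l ?n ?x] =>
      lazymatch x with context [del _ _ _] => fail | _ => idtac end;
      case: (delP l n x) => [[? ->]|[[? [? ->]]|[? ->]]]; try (exfalso; lia)
  | |- context [swap_last ?n ?x] =>
      lazymatch x with context [del _ _ _] => fail | _ => idtac end;
      case: (swap_lastP n x) => [[? ->]|[[? ->]|[? ->]]]; try (exfalso; lia)
  end; lia.

(* The two orders of contraction differ by which of the two contracted labels
   is stored as n and which as n + 1. *)
Lemma swap_idxP n (j : 'I_n.+1) (l : 'I_n.+2) :
  [/\ (swap_idx j l).2 = bump l j :> nat,
      bump (swap_idx j l).2 (swap_idx j l).1 = l :> nat &
      forall x, del (swap_idx j l).1 n (del (swap_idx j l).2 n.+1 x) =
                swap_last n (del j n (del l n.+1 x))].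
Proof.
have := ltn_ord j; have := ltn_ord l; rewrite /swap_idx => ln jn.
case: ltnP => jl /=; rewrite !inordK; try lia; split=> [||x].
- by have := bumpP l j; lia.
- by have := bumpP j l.-1; lia.
- by move: (j : nat) (l : nat) jn ln jl => {j l} j l jn ln jl; del_lia.
- by have := bumpP l j; lia.
- by have := bumpP j.+1 l; lia.
- by move: (j : nat) (l : nat) jn ln jl => {j l} j l jn ln jl; del_lia.
Qed.
End Pairings.

(** * Block permutations with two and three blocks, as maps of labels *)

Section Blocks.

Lemma nperm_blk N r (m : r.-tuple nat) (tau : 'S_r) x : sumn m = N ->
  (x < N)%N -> nperm (blk N m tau) x = block_fun m tau x.
Proof.
move=> mN xN; rewrite -[x]/(nat_of_ord (Ordinal xN)) npermE.
exact: blkE.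
Qed.

Lemma npermV n (s : 'S_n) x y : nperm s y = x -> nperm s^-1%g x = y.
Proof. by move=> <-; rewrite npermK. Qed.

Lemma sum_ord2 (P : pred 'I_2) (F : 'I_2 -> nat) : (\sum_(i < 2 | P i) F i)%N =
  ((if P 0%R then F 0%R else 0) + (if P 1%R then F 1%R else 0))%N.
Proof.
rewrite big_mkcond big_ord_recl big_ord1 /=.
by have -> : lift ord0 ord0 = 1 :> 'I_2 by exact: val_inj.
Qed.

Lemma sum_ord3 (P : pred 'I_3) (F : 'I_3 -> nat) : (\sum_(i < 3 | P i) F i)%N =
  ((if P 0%R then F 0%R else 0) + (if P 1%R then F 1%R else 0) +
   (if P 2%R then F 2%R else 0))%N.
Proof.
rewrite big_mkcond !big_ord_recl big_ord0 /= addn0 addnA.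
have -> : lift ord0 ord0 = 1 :> 'I_3 by exact: val_inj.
by have -> : lift ord0 (lift ord0 ord0) = 2 :> 'I_3 by exact: val_inj.
Qed.

Lemma nperm_blk2l N n m x : (n + m)%N = N -> (x < n)%N ->
  nperm (blk N [tuple n; m] (cyc 2 0 1)) x = (m + x)%N.
Proof.
move=> nm xn; rewrite nperm_blk //; [| rewrite /= addn0 // | lia].
have := @block_funE 2 [tuple n; m] (cyc 2 0 1) 0 x xn.
rewrite !sum_ord2 cyc2V !cyc2E /= !(tnth_nth 0%N) /= !addn0; lia.
Qed.

Lemma nperm_blk2r N n m x : (n + m)%N = N -> (x < m)%N ->
  nperm (blk N [tuple n; m] (cyc 2 0 1)) (n + x) = x.
Proof.
move=> nm xn; rewrite nperm_blk //; [| rewrite /= addn0 // | lia].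
have := @block_funE 2 [tuple n; m] (cyc 2 0 1) 1 x xn.
rewrite !sum_ord2 cyc2V !cyc2E /= !(tnth_nth 0%N) /= !addn0 addnC; lia.
Qed.

Section Three.
Variables (N a b c : nat).
Hypothesis abc : (a + b + c)%N = N.

Let blk3 (tau : 'S_3) (j : 'I_3) s : (s < tnth [tuple a; b; c] j)%N ->
  nperm (blk N [tuple a; b; c] tau)
    (s + \sum_(i < 3 | (i < j)%N) tnth [tuple a; b; c] i)%N =
  (s + \sum_(i < 3 | (i < tau j)%N) tnth [tuple a; b; c] (tau^-1%g i))%N.
Proof.
move=> hs; rewrite nperm_blk.
- exact: block_funE.
- by rewrite /= addn0 addnA.
- move: hs; rewrite sum_ord3; case: j => -[|[|[|[]]]] // p;
    rewrite !(tnth_nth 0%N) /=; lia.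
Qed.

Lemma cyc301E (x : 'I_3) :
  cyc 3 0 1 x = if x == 0 then 1 else if x == 1 then 0 else 2.
Proof. by apply: val_inj; rewrite /= cycE //; case: x => -[|[|[|[]]]]. Qed.

Lemma cyc301V : ((cyc 3 0 1)^-1 = cyc 3 0 1)%g.
Proof.
apply/eqP; rewrite eq_invg_mul; apply/eqP/permP => x.
by rewrite perm1 permM !cyc301E; case: x => -[|[|[|[]]]] // p; apply: val_inj.
Qed.

Lemma cyc302VE (x : 'I_3) :
  (cyc 3 0 2)^-1%g x = if x == 0 then 2 else if x == 1 then 0 else 1.
Proof.
apply: (canLR (permK _)); rewrite cyc3E.
by case: x => -[|[|[|[]]]] // p; apply: val_inj.
Qed.

Lemma nperm_swap12 x :
  [/\ (x < a)%N -> nperm (blk N [tuple a; b; c] (cyc 3 0 1)) x = (b + x)%N,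
      (x < b)%N -> nperm (blk N [tuple a; b; c] (cyc 3 0 1)) (a + x) = x &
      (x < c)%N -> nperm (blk N [tuple a; b; c] (cyc 3 0 1)) (a + b + x) =
                   (b + a + x)%N].
Proof.
split=> hx; [have := @blk3 (cyc 3 0 1) 0 x hx | have := @blk3 (cyc 3 0 1) 1 x hx
  | have := @blk3 (cyc 3 0 1) 2 x hx]; rewrite !sum_ord3 cyc301V !cyc301E /=
  !(tnth_nth 0%N) /= ?addn0 ?add0n ![(x + _)%N]addnC //.
Qed.

Lemma nperm_rot x :
  [/\ (x < a)%N -> nperm (blk N [tuple a; b; c] (cyc 3 0 2)) x = (c + x)%N,
      (x < b)%N -> nperm (blk N [tuple a; b; c] (cyc 3 0 2)) (a + x) =
                   (c + a + x)%N &
      (x < c)%N -> nperm (blk N [tuple a; b; c] (cyc 3 0 2)) (a + b + x) = x].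
Proof.
split=> hx; [have := @blk3 (cyc 3 0 2) 0 x hx | have := @blk3 (cyc 3 0 2) 1 x hx
  | have := @blk3 (cyc 3 0 2) 2 x hx]; rewrite !sum_ord3 !cyc302VE !cyc3E /=
  !(tnth_nth 0%N) /= ?addn0 ?add0n ![(x + _)%N]addnC //.
Qed.

Lemma nperm_rotV x :
  [/\ (x < a)%N -> nperm (blk N [tuple a; b; c] (cyc 3 0 2)^-1%g) x =
                   (b + c + x)%N,
      (x < b)%N -> nperm (blk N [tuple a; b; c] (cyc 3 0 2)^-1%g) (a + x) = x &
      (x < c)%N -> nperm (blk N [tuple a; b; c] (cyc 3 0 2)^-1%g) (a + b + x) =
                   (b + x)%N].
Proof.
split=> hx; [have := @blk3 (cyc 3 0 2)^-1%g 0 x hx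
  | have := @blk3 (cyc 3 0 2)^-1%g 1 x hx
  | have := @blk3 (cyc 3 0 2)^-1%g 2 x hx]; rewrite !sum_ord3 invgK !cyc302VE
  !cyc3E /= !(tnth_nth 0%N) /= ?addn0 ?add0n ![(x + _)%N]addnC //.
Qed.
End Three.
End Blocks.

(** * The commutative wheelgebra axioms *)

Section Wheelgebra.
Variables (k : fieldType) (A : assoc_algebra k).
Local Notation Q := (letter_alg A).
Local Notation F := (fock A).
Local Notation L n := (@letters k A n).

Lemma fock_contr_equivariant n (j i : 'I_n.+1) (s t : 'S_n.+1) (v : F n.+1) :
  wt j i (wl s (wr v t)) =
  wl (ldel j s) (wr (wt (s^-1%g j) (t i) v) (rdel i t)).
Proof.
apply: eq_letters.
rewrite letters_wl letters_wr !letters_wt letters_wl letters_wr !relabel_comp.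
rewrite (@contr_relabel_at _ _ (nperm s \o id) (id \o nperm t^-1%g) _ _
  (s^-1%g j) (t i)).
- rewrite relabel_comp; apply: eq_relabel => x /=; first by rewrite nperm_ldel.
  by have := nperm_ldel i t^-1%g x; rewrite invgK ldelV => ->.
- exact: nperm_inj.
- exact: nperm_inj.
- by rewrite /= npermE permKV.
- by rewrite /= npermE permK.
Qed.

(** Expresses both contractions in the labels of [v] itself: what is called [j] after the removal of
    [l] was [bump l j] before. *)
Lemma letters_wt2 n (i j : 'I_n.+1) (p l : 'I_n.+2) (v : F n.+2) :
  L n (wt j i (wt l p v)) =
  relabel (del j n \o del l n.+1) (del i n \o del p n.+1)
    (contr (bump l j) (bump p i) (contr l p (L n.+2 v))).
Proof.
have E (j' : 'I_n.+1) (l' : 'I_n.+2) : del l' n.+1 (bump l' j') = j'.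
  have := ltn_ord j'; have := bumpP l' j'; have := delP l' n.+1 (bump l' j').
  lia.
have le (l' : 'I_n.+2) : (l' <= n.+1)%N by rewrite -ltnS.
rewrite !letters_wt.
rewrite (contr_relabel_at _ (del_inj (le l)) (del_inj (le p)) (E j l) (E i p)).
by rewrite relabel_comp.
Qed.

Lemma swap_last_lt n x : (x < n)%N -> swap_last n x = x.
Proof. by move=> xn; rewrite /swap_last !ltn_eqF // ltnW. Qed.

Lemma fock_contr_comm n (i j : 'I_n.+1) (p l : 'I_n.+2) (v : F n.+2) :
  wt j i (wt l p v) =
  wt (swap_idx j l).1 (swap_idx i p).1
    (wt (swap_idx j l).2 (swap_idx i p).2 v).
Proof.
apply: eq_letters.
have [yj xl dj] := swap_idxP j l; have [yi xp di] := swap_idxP i p.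
rewrite [RHS]letters_wt2 (eq_relabel _ dj di) xl xp yj yi contr_comm.
(* The two orders now differ by [swap_last], which moves only [n] and [n + 1], labels absent from
   weight [n]. *)
rewrite -[RHS](relabel_comp (swap_last n) (swap_last n)) -letters_wt2.
by rewrite relabel_letters_id // => x; exact: swap_last_lt.
Qed.

Lemma fock_wheelspace : is_wheelspace F.
Proof.
split; first exact: fock_sbimodule.
- by move=> n j i; exact: fock_contr_linear.
- exact: fock_contr_equivariant.
- exact: fock_contr_comm.
Qed.

Lemma mul_bilinear : bilinear_map (fun u v : Q => u * v).
Proof.
split=> u c x y; first by rewrite mulrDl scalerAl.
by rewrite mulrDr scalerAr.
Qed.

Lemma letters_fock_mul n m (v : F n) (w : F m) :
  L (n + m) (fock_mul v w) = L n v * shift n (L m w).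
Proof. exact: letters_mul. Qed.

Lemma shiftD n m (u : Q) : shift n (shift m u) = shift (n + m) u.
Proof.
by rewrite /shift relabel_comp; apply: eq_relabel => x /=; rewrite addnA.
Qed.

Lemma shift0 (u : Q) : shift 0 u = u.
Proof. by rewrite /shift -[RHS]relabel_id; exact: eq_relabel. Qed.

Lemma shiftM n (u v : Q) : shift n (u * v) = shift n u * shift n v.
Proof. exact: relabelM. Qed.

(** Serves both the commutativity of the product and the antisymmetry of the bracket. *)
Lemma relabel_swap n m (star : Q -> Q -> Q) (v : F n) (w : F m) :
  (forall f g u v, relabel f g (star u v) = star (relabel f g u) (relabel f g v)) ->
  relabel (nperm (blk (m + n) [tuple m; n] (cyc 2 0 1)))
    (nperm (blk (m + n) [tuple n; m] (cyc 2 0 1))^-1%g)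
    (star (L m w) (shift m (L n v))) = star (shift n (L m w)) (L n v).
Proof.
move=> rs; rewrite rs /shift relabel_comp; congr star.
- apply: relabel_letters => x xm; first by rewrite nperm_blk2l.
  by apply: npermV; rewrite nperm_blk2r // addnC.
- apply: relabel_letters_id => x xn /=; first by rewrite nperm_blk2r.
  by apply: npermV; rewrite nperm_blk2l // addnC.
Qed.

Lemma fock_comm_wheelgebra : is_comm_wheelgebra (@fock_mul k A) (fock_one A).
Proof.
have one : L 0 (fock_one A) = 1 by exact: letters_one.
split.
- exact: fock_wheelspace.
- apply: (pairing_bimodule mul_bilinear); last exact: letters_fock_mul.
  exact: relabelM.
- apply: (pairing_contraction (star := fun u v : Q => u * v)) => //.
  + exact: relabelM.
  + by move=> *; exact: contr_mulr.
  + by move=> *; exact: contr_mull.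
  + exact: letters_fock_mul.
- move=> p n m u v w; apply: eq_letters.
  by rewrite letters_wcast !letters_fock_mul shiftM shiftD mulrA.
- move=> n v; apply: eq_letters.
  by rewrite [LHS]letters_fock_mul one mul1r shift0.
- move=> n v; apply: eq_letters; rewrite letters_wcast letters_fock_mul one.
  by rewrite /shift relabel1 mulr1.
- move=> n m v w; apply: eq_letters.
  rewrite letters_wcast letters_wl letters_wr !letters_fock_mul relabel_comp.
  by rewrite (relabel_swap v w (@relabelM k A)) mulrC.
Qed.
End Wheelgebra.

(** * The Poisson bracket on the Fock wheelgebra *)

Section FockBracket.
Variables (k : fieldType) (A : assoc_algebra k).
Variable D : {linear tpow A 2 -> tpow A 2}.
Hypothesis hD : is_double_poisson D.
Local Notation Q := (letter_alg A).
Local Notation F := (fock A).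
Local Notation L n := (@letters k A n).
Local Notation "{ u , v }" := (pbr hD.1 u v) (format "{ u ,  v }").

Definition fock_br : pairing F := fun n m v w =>
  of_letters (n + m) {L n v, shift n (L m w)}.

(** The retraction in [fock_br] loses nothing: by multidegree, the bracket uses each label below
    [n + m] once as output and once as input, so it lies in the image of [letters]. *)
Lemma letters_br n m (v : F n) (w : F m) :
  L (n + m) (fock_br v w) = {L n v, shift n (L m w)}.
Proof.
have h := hom_pbr hD.1 (hom_letters v) (hom_shift n w).
rewrite -iotaD in h; have [z zE] := letters_surj h.
by rewrite /fock_br -zE lettersK.
Qed.

Lemma relabel_br f g u v :
  relabel f g {u, v} = {relabel f g u, relabel f g v}.
Proof. exact: relabel_pbr. Qed.

Lemma fock_br_contraction : contraction_compatible fock_br.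
Proof.
apply: (pairing_contraction (star := pbr hD.1)).
- exact: relabel_br.
- by move=> *; exact: contr_pbrr.
- by move=> *; exact: contr_pbrl.
- exact: letters_br.
Qed.

Lemma fock_br_antisym n m (v : F n) (w : F m) :
  fock_br v w = - wcast (addnC m n)
    (wl (blk _ [tuple m; n] (cyc 2 0 1))
      (wr (fock_br w v) (blk _ [tuple n; m] (cyc 2 0 1)))).
Proof.
apply: eq_letters; rewrite (linear_propN (@letters_linear k A (n + m))).
rewrite letters_wcast letters_wl letters_wr !letters_br relabel_comp.
by rewrite (relabel_swap v w relabel_br) pbrC.
Qed.

Lemma fock_br_leibniz p n m (u : F p) (v : F n) (w : F m) :
  fock_br u (fock_mul v w : F (n + m)) =
  wcast (esym (addnA p n m)) (fock_mul (fock_br u v : F (p + n)) w : F (p + n + m)) +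
  wcast (addnCA n p m)
    (wl (blk _ [tuple n; p; m] (cyc 3 0 1))
      (wr (fock_mul v (fock_br u w : F (p + m)) : F (n + (p + m)))
          (blk _ [tuple p; n; m] (cyc 3 0 1)))).
Proof.
apply: eq_letters; rewrite (linear_propD (@letters_linear k A (p + (n + m)))).
rewrite !letters_wcast letters_wl letters_wr !(letters_br, letters_fock_mul).
rewrite shiftM shiftD pbrMr relabel_comp relabelM.
have h1 : (n + p + m = n + (p + m))%N by rewrite addnA.
have h2 : (p + n + m = n + (p + m))%N by rewrite addnCA addnA.
(* Outputs move by the left permutation ([S1]), inputs by the inverse of the right one, so [S2] is
   read backwards with [npermV]. *)
have S1 x := nperm_swap12 h1 x; have S2 x := nperm_swap12 h2 x.
congr (_ + _ * _).
- apply/esym; rewrite /shift; apply: relabel_letters => x xn /=.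
    by have [e _ _] := S1 x; rewrite e.
  by apply: npermV; have [_ e _] := S2 x; rewrite e.
- rewrite /shift !relabel_br !relabel_comp; congr (pbr _ _ _); apply/esym.
    apply: relabel_letters_id => x xp /=; first by have [_ e _] := S1 x; rewrite e.
    by apply: npermV; have [e _ _] := S2 x; rewrite e.
  apply: relabel_letters => x xm /=; rewrite (addnA n p x).
    by have [_ _ e] := S1 x; rewrite e.
  by apply: npermV; have [_ _ e] := S2 x; rewrite e.
Qed.

Lemma fock_is_bracket : is_bracket (@fock_mul k A) fock_br.
Proof.
split.
- apply: (pairing_bimodule (star := pbr hD.1)).
  + split=> u; [exact: pbr_linearl | exact: pbr_linearr].
  + exact: relabel_br.
  + exact: letters_br.
- exact: fock_br_antisym.
- exact: fock_br_leibniz.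
Qed.

Lemma fock_br_jacobi : bracket_jacobi fock_br.
Proof.
move=> p n m u v w; apply: eq_letters.
rewrite (linear_prop0 (@letters_linear k A (p + (n + m)))).
rewrite !(linear_propD (@letters_linear k A (p + (n + m)))).
rewrite !letters_wcast.
rewrite (letters_wl (blk _ [tuple n; m; p] _)) (letters_wr (blk _ _ _^-1%g)).
rewrite (letters_wl (blk _ [tuple m; p; n] _)) letters_wr !letters_br.
rewrite !relabel_comp /shift !relabel_br !relabel_comp.
have h1 : (n + m + p = n + (m + p))%N by rewrite addnA.
have h2 : (p + n + m = n + (m + p))%N by rewrite -addnA addnC addnA.
have h3 : (m + p + n = m + (p + n))%N by rewrite addnA.
have h4 : (p + n + m = m + (p + n))%N by rewrite addnC.
have R1 x := nperm_rot h1 x; have V2 x := nperm_rotV h2 x.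
have V3 x := nperm_rotV h3 x; have R4 x := nperm_rot h4 x.
(* The letters of [u], [v], [w] occupy consecutive blocks of labels in this order; in the two
   rotated terms the block permutations restore exactly these positions. *)
set V := relabel (addn p) (addn p) (L n v).
pose W := relabel (addn (p + n)) (addn (p + n)) (L m w).
have -> : relabel (addn p \o addn n) (addn p \o addn n) (L m w) = W.
  by apply: eq_relabel => x /=; rewrite addnA.
apply: etrans (esym (jacobi hD (L p u) V W)) _; rewrite /jacobiator.
congr (_ + _ + _); congr (pbr hD.1 _ (pbr hD.1 _ _)); apply/esym.
- apply: relabel_letters => x xn /=; first by have [e _ _] := R1 x; rewrite e.
  by apply: npermV; have [_ e _] := V2 x; rewrite e.
- apply: relabel_letters => x xm /=; first by have [_ e _] := R1 x; rewrite e.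
  by apply: npermV; have [_ _ e] := V2 x; rewrite e.
- apply: relabel_letters_id => x xp /=; rewrite (addnA n m x).
    by have [_ _ e] := R1 x; rewrite e.
  by apply: npermV; have [e _ _] := V2 x; rewrite e.
- apply: relabel_letters => x xm /=; first by have [e _ _] := V3 x; rewrite e.
  by apply: npermV; have [_ _ e] := R4 x; rewrite e.
- apply: relabel_letters_id => x xp /=; first by have [_ e _] := V3 x; rewrite e.
  by apply: npermV; have [e _ _] := R4 x; rewrite e.
- apply: relabel_letters => x xn /=; rewrite (addnA m p x).
    by have [_ _ e] := V3 x; rewrite e.
  by apply: npermV; have [_ e _] := R4 x; rewrite e.
Qed.

Lemma fock_br_values : fock_bracket_values D fock_br.
Proof.
have g1 (a : A) : L 1 (fock_gen1 a) = lt (op 0 0 a).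
  by rewrite letters_embed monoE big_ord1.
have g0 (x : Acyc A) : L 0 (fock_gen0 x) = lt (cl x).
  by rewrite lettersE U_lettersE sym_lettersE monoE big_ord0 mul1r.
have sh n i j (a : A) : shift n (lt (op i j a)) = lt (op (n + i) (n + j) a).
  exact: relabel_op.
have sc n (x : Acyc A) : shift n (lt (cl x)) = lt (cl x) by exact: relabel_lt.
split=> a b; apply: eq_letters.
(* With labels $0$ for [a] and $1$ for [b], Van den Bergh's formula has outputs $(1,0)$ and inputs
   $(0,1)$: the transposition sits on the left. *)
- rewrite (letters_br (fock_gen1 a) (fock_gen1 b)) !g1 sh pbr_lt pbr_op_op.
  rewrite letters_l letters_embed relabel_mono; apply: eq_mono => x /=.
    by rewrite npermE cyc2E; case: x => -[|[|[]]].
  by case: x => -[|[|[]]].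
- rewrite (letters_br (fock_gen0 _) (fock_gen1 b)) g0 !g1 sh pbr_lt pbr_cl_op.
  by rewrite (cyc_actE hD.1).
- rewrite (linear_propN (@letters_linear k A 1)).
  rewrite (letters_br (fock_gen1 b) (fock_gen0 _)) g0 !g1 sc pbr_lt pbr_op_cl.
  by rewrite (cyc_actE hD.1).
- rewrite (letters_br (fock_gen0 _) (fock_gen0 _)) !g0 sc pbr_lt pbr_cl_cl.
  by rewrite (cyc_bracketE hD.1) (cyc_actE hD.1).
Qed.

End FockBracket.

(** * A bracket is determined by its values on generators *)

Section Uniqueness.
Variables (k : fieldType) (A : assoc_algebra k).
Local Notation F := (fock A).
Local Notation L n := (@letters k A n).

Lemma fock_generated (H : forall n, F n -> Prop) :
  (forall n, H n 0) ->
  (forall n c (u v : F n), H n u -> H n v -> H n (c *: u + v)) ->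
  (forall n (s t : 'S_n) (v : F n), H n v -> H n (wl s (wr v t))) ->
  H 0 (fock_one A) ->
  (forall n a (v : F n), H n v -> H n.+1 (fock_mul (fock_gen1 a : F 1) v)) ->
  (forall n x (v : F n), H n v -> H n (fock_mul (fock_gen0 x : F 0) v)) ->
  forall n (v : F n), H n v.
Proof.
move=> H0 HD Hs H1 Hop Hcl n v; elim/fock_ind: v => [|c u v|s a t w].
- exact: H0.
- exact: HD.
have -> : fock_gen s a t w = wl s (wr (fock_gen 1%g a 1%g w : F n) t).
  apply: eq_letters; rewrite letters_wl letters_wr relabel_comp.
  rewrite !lettersE !U_lettersE relabelM relabel_sym relabel_mono.
  by congr (_ * _); apply: eq_mono => i /=; rewrite ?invg1 perm1 npermE.
apply: Hs; elim: w => [|x w ih]; last first.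
  have -> : fock_gen 1%g a 1%g (x :: w) =
      fock_mul (fock_gen0 x : F 0) (fock_gen 1%g a 1%g w : F n) :> F n.
    apply: eq_letters; rewrite (letters_fock_mul (fock_gen0 x)) shift0.
    rewrite !lettersE !U_lettersE !sym_lettersE !monoE big_ord0 mul1r.
    by rewrite mulrCA -word_cons.
  exact: Hcl.
elim: n a {s t} => [|n ih] a.
  rewrite [a]tuple0.
  have -> : fock_gen 1%g [tuple] 1%g [::] = fock_one A :> F 0 by [].
  exact: H1.
have -> : fock_gen 1%g a 1%g [::] =
    fock_mul (fock_gen1 (thead a) : F 1)
      (fock_gen 1%g [tuple of behead a] 1%g [::] : F n) :> F n.+1.
  apply: eq_letters; rewrite (letters_fock_mul (fock_gen1 (thead a))).
  rewrite letters_embed !lettersE !U_lettersE !sym_lettersE !monoE big_ord1.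
  rewrite big_ord_recl shiftM /shift relabel_prod relabel1 mulrA !mulr1.
  congr (lt (op _ _ _) * _); rewrite ?invg1 ?perm1 //.
  apply: eq_bigr => i _; rewrite relabel_op ?invg1 !perm1.
  by rewrite [a in LHS]tuple_eta tnthS.
exact: Hop.
Qed.

Section TwoBrackets.
Variables br br' : pairing F.
Hypotheses (hbr : is_bracket (@fock_mul k A) br)
           (hbr' : is_bracket (@fock_mul k A) br').

(** As $1\cdot1=1$, the Leibniz rule reads $\{v,1\}=\{v,1\}+\{v,1\}$; the block permutations are
    trivial because the blocks of $1$ are empty. *)
Lemma bracket_one (b : pairing F) : is_bracket (@fock_mul k A) b ->
  forall n (v : F n), b n 0 v (fock_one A) = 0.
Proof.
move=> hb n v; apply: eq_letters; rewrite (linear_prop0 (@letters_linear k A _)).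
have [_ _ leib] := hb.
have one1 : fock_mul (fock_one A : F 0) (fock_one A : F 0) = fock_one A :> F 0.
  apply: eq_letters; rewrite (letters_fock_mul (fock_one A)).
  by rewrite !letters_one shift0 mulr1.
have := congr1 (@letters k A _) (leib n 0 0 v (fock_one A) (fock_one A)).
rewrite one1 (linear_propD (@letters_linear k A _)) !letters_wcast.
rewrite letters_wl letters_wr !letters_fock_mul relabel_comp.
rewrite letters_one mul1r shift0 /shift relabel1 mulr1.
rewrite relabel_letters_id => [|x xn|x xn] /=.
- by move/eqP; rewrite -subr_eq0 opprD addNKr oppr_eq0 => /eqP.
- have [_ e _] := @nperm_swap12 (0 + (n + 0)) 0 n 0 erefl x.
  by apply: e; rewrite -[n]addn0.
- apply: npermV.
  have [e _ _] := @nperm_swap12 (0 + (n + 0)) n 0 0 (addn0 _) x.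
  by apply: e; rewrite -[n]addn0.
Qed.

Lemma wl1_wr1 n (v : F n) : wl 1%g (wr v 1%g) = v.
Proof. by rewrite (wl1 (fock_sbimodule A)) (wr1 (fock_sbimodule A)). Qed.

(* By antisymmetry and the Leibniz rule, agreement propagates from generators
   in the second argument. *)
Lemma bracket_agree p (u : F p) :
  (forall b, br u (fock_gen1 b : F 1) = br' u (fock_gen1 b : F 1)) ->
  (forall x, br u (fock_gen0 x : F 0) = br' u (fock_gen0 x : F 0)) ->
  forall n (v : F n), br u v = br' u v.
Proof.
move=> h1 h0; apply: (fock_generated (H := fun n (v : F n) => br u v = br' u v)).
- move=> n; have [[_ l] [_ l']] := (pairing_bilinear (bracket_pairing hbr) p n,
    pairing_bilinear (bracket_pairing hbr') p n).
  by rewrite !linear_prop0.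
- move=> n c v w hv hw.
  have [[_ l] [_ l']] := (pairing_bilinear (bracket_pairing hbr) p n,
    pairing_bilinear (bracket_pairing hbr') p n).
  by rewrite l l' hv hw.
- move=> n s t v hv; rewrite -[u]wl1_wr1.
  rewrite (pairing_equivariant (bracket_pairing hbr)).
  by rewrite (pairing_equivariant (bracket_pairing hbr')) hv.
- by rewrite !bracket_one.
- move=> n a v hv.
  rewrite (bracket_leibniz hbr u (fock_gen1 a) v).
  by rewrite (bracket_leibniz hbr' u (fock_gen1 a) v) hv h1.
- move=> n x v hv.
  rewrite (bracket_leibniz hbr u (fock_gen0 x) v).
  by rewrite (bracket_leibniz hbr' u (fock_gen0 x) v) hv h0.
Qed.
End TwoBrackets.

(** [bracket_agree] is applied twice: with a generator in the first argument, where the prescribed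
    values decide, and then with an arbitrary first argument, where antisymmetry leads back to the
    first case. *)
Lemma bracket_unique (D : {linear tpow A 2 -> tpow A 2}) (br br' : pairing F) :
  is_bracket (@fock_mul k A) br -> is_bracket (@fock_mul k A) br' ->
  fock_bracket_values D br -> fock_bracket_values D br' ->
  forall n m (v : F n) (w : F m), br n m v w = br' n m v w.
Proof.
move=> hb hb' [v11 v01 v10 v00] [v11' v01' v10' v00'].
have g1 b m (w : F m) : br 1 m (fock_gen1 b) w = br' 1 m (fock_gen1 b) w.
  apply: bracket_agree => // [a|x]; first by rewrite v11 v11'.
  by have [a ->] := cycproj_surj x; rewrite v10 v10'.
have g0 x m (w : F m) : br 0 m (fock_gen0 x) w = br' 0 m (fock_gen0 x) w.
  have [a ->] := cycproj_surj x.
  apply: bracket_agree => // [b|y]; first by rewrite v01 v01'.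
  by have [b ->] := cycproj_surj y; rewrite v00 v00'.
move=> n m v w; apply: bracket_agree => // [b|x].
- by rewrite (bracket_antisym hb) (bracket_antisym hb') g1.
- by rewrite (bracket_antisym hb) (bracket_antisym hb') g0.
Qed.
End Uniqueness.

(** That the bracket is determined on generators is rendered as existence together with uniqueness
    among all brackets with these values. *)
Theorem proposition6p8 (k : fieldType) (char0 : [pchar k] =i pred0)
  (A : assoc_algebra k) (D : {linear tpow A 2 -> tpow A 2})
  (hD : is_double_poisson D) :
  exists br : pairing (fock A),
    [/\ is_bracket (@fock_mul k A) br,
        fock_bracket_values D br,
        (forall br' : pairing (fock A),
           is_bracket (@fock_mul k A) br' -> fock_bracket_values D br' ->
           forall n m (v : fock A n) (w : fock A m),
             br' n m v w = br n m v w),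
        contraction_compatible br
      & is_poisson_wheelgebra (@fock_mul k A) (fock_one A) br].
Proof.
have brP := fock_is_bracket hD; have brV := fock_br_values hD.
have brC := fock_br_contraction hD.
exists (fock_br hD); split=> //.
- by move=> br' brP' brV' n m v w; exact: (bracket_unique brP' brP brV' brV).
- split=> //; first exact: fock_comm_wheelgebra.
  exact: fock_br_jacobi.
Qed.
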